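(* Let $X$ be an affine process on $K$ with parameters $(Q,b,B,c,\gamma,m,\mu)$, relative to the truncation function $\chi\equiv 0$, with $c=0$, $\gamma=0$, $m(K)<\infty$, $\mu(K)\in K^*$ and $\int_{\|\xi\|\ge1}\|\xi\|\,\mu(d\xi)\in K^*$ (i.e. $\mu$ is a finite measure with finite first moment). Suppose $\hat X$ is an affine process on $K$ with parameters $\hat Q=Q$, $\hat B=B$, $\hat b=b$, $\hat c=0$, $\hat\gamma=0$ and vanishing jump measures $\hat m$ and $\hat\mu$. Suppose that for any $t>0$ and $x\in K$ the transition probabilities $\hat p_t(x,d\xi)$ of $\hat X$ have a Lebesgue density which is strictly positive on $K^\circ$. Then both $X$ and $\hat X$ are aperiodic and irreducible with respect to the Lebesgue measure on $K$.
   Context: Setting. $V$ is a finite-dimensional real inner product space with norm $\|\cdot\|$; $V^*$ is identified with $V$. $K\subset V$ is a closed convex cone which is generating ($K-K=V$) and proper ($K\cap(-K)=\{0\}$). $K^*=\{u\in V:\langle u,x\rangle\ge0\ \forall x\in K\}$; $^\circ$ denotes interior. Affine process. A time-homogeneous Markov process $X$ with state space $K\cup\{\Delta\}$ ($\Delta\notin K$ an absorbing cemetery), transition kernels $p_t(x,d\xi)$ and laws $\mathbb P^x$, is affine if (a) $p_s(x,\cdot)\to p_t(x,\cdot)$ weakly on $K$ as $s\to t$ for all $t\ge0,x\in K$; (b) there are functions $\phi:\mathbb R_+\times K^*\to\mathbb R_+$, $\psi:\mathbb R_+\times K^*\to V$ with $\int_K e^{-\langle u,\xi\rangle}p_t(x,d\xi)=e^{-\phi(t,u)-\langle\psi(t,u),x\rangle}$.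 It is known that then $X$ is Feller, and under the finiteness assumptions of the claim (with $c=0,\gamma=0$, $\chi\equiv0$) $\partial_t\phi=F(\psi)$, $\phi(0,u)=0$, $\partial_t\psi=R(\psi)$, $\psi(0,u)=u$, with $$F(u)=\langle b,u\rangle-\int_K(e^{-\langle u,\xi\rangle}-1)m(d\xi),\qquad R(u)=-\tfrac12Q(u,u)+B^\top(u)-\int_K(e^{-\langle u,\xi\rangle}-1)\mu(d\xi),$$ where $b\in K$; $m$ is a finite Borel measure on $K$ with $m(\{0\})=0$; $\mu$ is a finite $K^*$-valued Borel measure on $K$ with $\mu(\{0\})=0$; $Q:V\times V\to V$ is symmetric bilinear with $Q(v,v)\in K^*$ for all $v\in V$ and $\langle x,Q(u,v)\rangle=0$ for all $v\in V$ whenever $u\in K^*$, $x\in K$, $\langle u,x\rangle=0$; $B^\top:V\to V$ is linear (adjoint of $B$) with $\langle x,B^\top(u)\rangle\ge0$ whenever $u\in K^*,x\in K,\langle u,x\rangle=0$. Under these assumptions the process is conservative ($p_t(x,K)=1$). Processes are taken in their càdlàg versions. Irreducibility and aperiodicity. For measurable $A$, let $\eta_A=\int_0^\infty 1_{\{X_t\in A\}}dt$. For a nontrivial $\sigma$-finite measure $\nu$, $X$ is $\nu$-irreducible (irreducible with respect to $\nu$) if $\nu(A)>0$ implies $\mathbb E^x[\eta_A]>0$ for all $x$. Then there is a maximal irreducibility measure (one with respect to which every irreducibility measure is absolutely continuous); $\mathcal B^+$ is the family of measurable sets of positive maximal irreducibility measure. A nonempty measurable set $C$ is small if there are $s>0$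 and a nontrivial measure $\nu_s$ with $\mathbb P^x[X_s\in A]\ge\nu_s(A)$ for all $x\in C$ and measurable $A$. An irreducible process is aperiodic if for some small $C\in\mathcal B^+$ there is $T$ with $\mathbb P^x[X_t\in C]>0$ for all $t\ge T$, $x\in C$. *)

(* Defs.v *)
From HB Require Import structures.
From mathcomp Require Import all_boot all_order all_algebra.
From mathcomp Require Import all_classical all_reals all_analysis measurable_realfun.

Set Implicit Arguments.
Unset Strict Implicit.
Unset Printing Implicit Defensive.

Import Order.TTheory GRing.Theory Num.Theory.
Import numFieldNormedType.Exports.

Local Open Scope classical_set_scope.
Local Open Scope ring_scope.

Notation borel T := (g_sigma_algebraType (@open T)).

Section lebesgue.
Context (R : realType).

Lemma measurable_fun_rV d (T : measurableType d) n (f : T -> borel 'rV[R]_n) :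
  (forall i, measurable_fun setT (fun t => (f t : 'rV[R]_n) ord0 i)) ->
  measurable_fun setT f.
Proof.
move=> mf; apply: (@measurability _ _ T (borel 'rV[R]_n) setT f (@open _) erefl) => _ [U oU <-].
rewrite setTI.
pose B (q : 'rV[rat]_n) (k : nat) : set 'rV[R]_n :=
  [set v | forall i, `|ratr (q ord0 i) - v ord0 i| < k.+1%:R^-1].
have mB q k : measurable (f @^-1` B q k).
  rewrite (_ : f @^-1` B q k = \bigcap_(i in [set: 'I_n])
    ((fun t => (f t : 'rV[R]_n) ord0 i) @^-1` (ball (ratr (q ord0 i) : R) k.+1%:R^-1))).
    apply: fin_bigcap_measurable => //= i _.
    rewrite -[X in measurable X]setTI.
    by apply: mf => //; exact: measurable_ball.
  by apply/seteqP; split=> [t Bt i _|t Bt i]; [exact: Bt|exact: (Bt i I)].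
rewrite (_ : f @^-1` U = \bigcup_(qk in [set qk | B qk.1 qk.2 `<=` U])
    f @^-1` B qk.1 qk.2); last first.
  apply/seteqP; split=> [t Ut|t [qk /= BU Bt]]; last exact: BU.
  have /nbhs_ballP[e /= e0 eU] : nbhs (f t : 'rV[R]_n) U.
    by move: oU; rewrite openE => /(_ _ Ut).
  have [k ke] : exists k, k.+1%:R^-1 < e / 2.
    exists (Num.truncn (2 / e)).
    rewrite -[ltRHS]invrK ltf_pV2 ?posrE// ?invr_gt0 ?divr_gt0// invf_div.
    by rewrite truncnS_gt.
  have k0 : 0 < k.+1%:R^-1 :> R by rewrite invr_gt0.
  have /choice[q qP] : forall i, exists q : rat,
      `|ratr q - (f t : 'rV[R]_n) ord0 i| < k.+1%:R^-1.
    move=> i; have /rat_in_itvoo[q] :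
        (f t : 'rV[R]_n) ord0 i < (f t : 'rV[R]_n) ord0 i + k.+1%:R^-1.
      by rewrite ltrDl.
    rewrite in_itv/= => /andP[q1 q2]; exists q.
    by rewrite gtr0_norm ?subr_gt0// ltrBlDl.
  exists (\row_i q i, k) => /=; last by move=> i; rewrite mxE.
  move=> v Bv; apply: eU; split=> // i j; rewrite (ord1 i) /ball /=.
  rewrite -(subrK (ratr (q j)) ((f t : 'rV[R]_n) ord0 j)) -addrA.
  rewrite (le_lt_trans (ler_normD _ _))// [ltRHS](splitr e) ltrD//.
    by rewrite distrC (lt_trans (qP j)).
  by move: (Bv j); rewrite mxE => /lt_trans; apply.
by rewrite bigcup_mkcond; apply: countable_bigcupT_measurable => // -[q k];
  case: ifPn.
Qed.

Lemma measurable_coord n i :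
  measurable_fun setT (fun v : borel 'rV[R]_n => (v : 'rV[R]_n) ord0 i).
Proof.
apply: (@measurability _ _ (borel 'rV[R]_n) _ setT _ _ (RGenOpens.measurableE R)) => _ [_ [a [b ->] <-]].
rewrite setTI; apply: sub_sigma_algebra.
by move/continuousP: (@coord_continuous R 1 n ord0 i); apply;
  exact: interval_open.
Qed.

Definition rV_cons n (vx : borel 'rV[R]_n * R) : borel 'rV[R]_n.+1 :=
  \row_i oapp ((vx.1 : 'rV[R]_n) ord0) vx.2 (unlift ord0 i).

Lemma measurable_rV_cons n : measurable_fun setT (@rV_cons n).
Proof.
apply: measurable_fun_rV => i.
rewrite (_ : (fun t => _) =
  (fun t => oapp ((t.1 : 'rV[R]_n) ord0) t.2 (unlift ord0 i))); last first.
  by apply/funext => t; rewrite mxE.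
case: (unlift ord0 i) => [j|] /=; last exact: measurable_snd.
by apply: (measurableT_comp (@measurable_coord n j)); exact: measurable_fst.
Qed.

(* Lebesgue measure in the coordinates of ['rV[R]_n].  An inner product that is
   not the standard one rescales it by a positive constant, which affects neither
   null sets nor the existence and positivity of densities. *)
Fixpoint lebesgue_rV n : {measure set (borel 'rV[R]_n) -> \bar R} :=
  if n is n'.+1 then
    measure_function_pushforward__canonical__measure_function_Measure
      (lebesgue_rV n' \x @lebesgue_measure R)%E (@measurable_rV_cons n')
  else \d_(0 : borel 'rV[R]_0).

End lebesgue.

(* A finite-dimensional real inner product space is ['rV[R]_n] with an arbitrary
   inner product; all these inner products induce the topology of ['rV[R]_n]. *)
Record inner_product (R : realType) n := InnerProduct {
  ip :> 'rV[R]_n -> 'rV[R]_n -> R ;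
  ipC : forall u v, ip u v = ip v u ;
  ip_linear : forall u, scalar (ip u) ;
  ip_gt0 : forall u, u != 0 -> 0 < ip u u }.

Section cones.
Context (R : realType) (n : nat) (ip : inner_product R n).
Local Notation V := 'rV[R]_n.

Definition ip_norm (x : V) : R := Num.sqrt (ip x x).

Record proper_cone (K : set V) : Prop := ProperCone {
  cone_closed : closed K ;
  cone0 : K 0 ;
  coneD : forall x y, K x -> K y -> K (x + y) ;
  coneZ : forall (a : R) x, 0 <= a -> K x -> K (a *: x) ;
  cone_generating : forall v, exists x y, [/\ K x, K y & v = x - y] ;
  cone_proper : forall x, K x -> K (- x) -> x = 0 }.

Definition dual_cone (K : set V) : set V :=
  [set u | forall x, K x -> 0 <= ip u x].

Definition adjoint (f : V -> V) (u : V) : V :=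
  xget 0 [set w | forall x, ip (f x) u = ip x w].

(* The values lie in V, so a [cone_measure] is automatically finite.  Measures
   on K are represented by measures on V of which only the values at Borel
   subsets of K are ever used. *)
Record cone_measure (K : set V) := ConeMeasure {
  cm :> set (borel V) -> V ;
  cm0 : cm set0 = 0 ;
  cm_dual : forall A : set (borel V), measurable A -> dual_cone K (cm A) ;
  cm_sigma_additive : forall F : (set (borel V))^nat,
    (forall i, measurable (F i)) -> trivIset setT F ->
    (fun k => \sum_(0 <= i < k) cm (F i)) @ \oo --> cm (\bigcup_i F i) }.

(* [w] is the integral over D of f against mu.  For x in K, <x, mu(.)> is a
   finite nonnegative measure; as K is generating there is at most one w. *)
Definition is_cone_integral (K : set V) (mu : cone_measure K) (D : set V)
    (f : V -> R) (w : V) :=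
  forall x, K x ->
    (\int[fun A : set (borel V) => (ip x (mu A))%:E]_(xi in D) (f xi)%:E)%E
    = (ip x w)%:E.

Definition cone_integral (K : set V) (mu : cone_measure K) (D : set V)
    (f : V -> R) : V :=
  xget 0 [set w | is_cone_integral mu D f w].

(* Parameters relative to the truncation function 0. *)
Record affine_params (K : set V) := AffineParams {
  par_Q : V -> V -> V ;
  par_b : V ;
  par_B : {linear V -> V} ;
  par_c : R ;
  par_gamma : V ;
  par_m : {measure set (borel V) -> \bar R} ;
  par_mu : cone_measure K }.

Record admissible (K : set V) (par : affine_params K) : Prop := Admissible {
  adm_QC : forall u v, par_Q par u v = par_Q par v u ;
  adm_Q_linear : forall u, linear (par_Q par u) ;
  adm_Q_dual : forall v, dual_cone K (par_Q par v v) ;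
  adm_Q_boundary : forall u x v, dual_cone K u -> K x -> ip u x = 0 ->
    ip x (par_Q par u v) = 0 ;
  adm_b : K (par_b par) ;
  adm_B : forall u x, dual_cone K u -> K x -> ip u x = 0 ->
    0 <= ip x (adjoint (par_B par) u) ;
  adm_c : 0 <= par_c par ;
  adm_gamma : dual_cone K (par_gamma par) ;
  adm_m0 : par_m par [set 0] = 0%E ;
  adm_mu0 : par_mu par [set 0] = 0 }.

Definition Fmap (K : set V) (par : affine_params K) (u : V) : R :=
  ip (par_b par) u + par_c par
  - \int[par_m par]_(xi in K) (expR (- ip u xi) - 1).

Definition Rmap (K : set V) (par : affine_params K) (u : V) : V :=
  - (2^-1 *: par_Q par u u) + adjoint (par_B par) u + par_gamma par
  - cone_integral (par_mu par) K (fun xi => expR (- ip u xi) - 1).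

End cones.

Section markov.
Context (R : realType) (n : nat).
Local Notation V := 'rV[R]_n.
(* [None] is the cemetery state. *)
Local Notation E := (one_point_compactification V).

Definition state_space (K : set V) : set E := [set None] `|` Some @` K.

(* The topology of [E] restricted to [state_space K] is that of the one-point
   compactification of the closed set K.  Kernels and laws are total on [E];
   only their values at points of [state_space K] are used. *)
Record markov_process (K : set V) := MarkovProcess {
  mp_display : measure_display ;
  mp_Omega : measurableType mp_display ;
  mp_P : E -> probability mp_Omega R ;
  mp_X : R -> mp_Omega -> E ;
  mp_p : R -> R.-pker (borel E) ~> (borel E) ;
  mp_measurable : forall t : R, 0 <= t ->
    measurable_fun setT (mp_X t : mp_Omega -> borel E) ;
  mp_state : forall (t : R) w, 0 <= t -> state_space K (mp_X t w) ;
  mp_right_continuous : forall (t : R) w, 0 <= t ->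
    mp_X s w @[s --> t^'+] --> mp_X t w ;
  mp_left_limit : forall (t : R) w, 0 < t ->
    exists l : E, mp_X s w @[s --> t^'-] --> l ;
  mp_init : forall x, state_space K x ->
    mp_P x (mp_X 0 @^-1` [set x]) = 1%E ;
  mp_absorbing : forall t : R, 0 <= t -> mp_p t None [set None] = 1%E ;
  mp_markov : forall x (s t : R) (G : set mp_Omega) (A : set (borel E)),
    state_space K x -> 0 <= s -> 0 <= t -> measurable A ->
    <<s [set H | exists (r : R) (B : set (borel E)),
           [/\ 0 <= r <= s, measurable B & H = mp_X r @^-1` B]] >> G ->
    mp_P x (G `&` mp_X (s + t) @^-1` A)
    = (\int[mp_P x]_(w in G) mp_p t (mp_X s w) A)%E }.

End markov.

Arguments mp_X [R n K] _ _ _.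

Section affine.
Context (R : realType) (n : nat).
Local Notation V := 'rV[R]_n.
Context (ip : inner_product R n) (K : set V).

(* Functions on K are extended by 0 at the cemetery state. *)
Definition affine_process (par : affine_params ip K) (X : markov_process K) :=
  admissible par /\
  (forall (t : R) x (f : V -> R), 0 <= t -> K x ->
    {within K, continuous f} -> (exists M : R, forall y, K y -> `|f y| <= M) ->
    (\int[mp_p X s (Some x)]_(xi in Some @` K) (oapp f 0 xi)%:E)%E
      @[s --> within [set s : R | 0 <= s] (nbhs t)] -->
    (\int[mp_p X t (Some x)]_(xi in Some @` K) (oapp f 0 xi)%:E)%E) /\
  exists (phi : R -> V -> R) (psi : R -> V -> V),
    [/\ forall (t : R) u, 0 <= t -> dual_cone ip K u -> 0 <= phi t u,
        forall (t : R) u x, 0 <= t -> dual_cone ip K u -> K x ->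
          (\int[mp_p X t (Some x)]_(xi in Some @` K)
             (oapp (fun y => expR (- ip u y)) 0 xi)%:E)%E
          = (expR (- phi t u - ip (psi t u) x))%:E,
        forall u, dual_cone ip K u -> phi 0 u = 0 /\ psi 0 u = u,
        forall (t : R) u, 0 <= t -> dual_cone ip K u ->
          h^-1 * (phi (t + h) u - phi t u)
            @[h --> within [set h | 0 <= t + h] ((0 : R)^')] --> Fmap par (psi t u) &
        forall (t : R) u, 0 <= t -> dual_cone ip K u ->
          h^-1 *: (psi (t + h) u - psi t u)
            @[h --> within [set h | 0 <= t + h] ((0 : R)^')] --> Rmap par (psi t u)].

End affine.

Section irreducibility.
Context (R : realType) (n : nat).
Local Notation V := 'rV[R]_n.
Context (K : set V) (X : markov_process K).
Implicit Types (nu psi : {measure set (borel V) -> \bar R}) (C : set (borel V)).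
Local Open Scope ereal_scope.

Definition occupation_time (A : set V) (w : mp_Omega X) : \bar R :=
  \int[lebesgue_measure]_(t in `[0%R, +oo[) (\1_(Some @` A) (mp_X X t w))%:E.

Definition irreducible_wrt nu :=
  [/\ sigma_finite (K : set (borel V)) nu, 0 < nu K &
      forall A : set (borel V), measurable A -> A `<=` K -> 0 < nu A ->
      forall x, K x -> 0 < \int[mp_P X (Some x)]_w occupation_time A w].

Definition maximal_irreducibility_measure psi :=
  irreducible_wrt psi /\
  forall nu, irreducible_wrt nu ->
    forall A : set (borel V), measurable A -> A `<=` K -> psi A = 0 -> nu A = 0.

Definition Bplus C :=
  [/\ measurable C, C `<=` K &
      exists2 psi, maximal_irreducibility_measure psi & 0 < psi C].

Definition small C :=
  [/\ measurable C, C `<=` K, C !=set0 &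
      exists (s : R) nu, [/\ (0 < s)%R, 0 < nu K &
        forall x (A : set (borel V)), C x -> measurable A -> A `<=` K ->
        nu A <= mp_P X (Some x) (mp_X X s @^-1` (Some @` A))]].

Definition aperiodic :=
  (exists nu, irreducible_wrt nu) /\
  exists C, [/\ small C, Bplus C &
    exists T : R, forall t x, (T <= t)%R -> (0 <= t)%R -> C x ->
      0 < mp_P X (Some x) (mp_X X t @^-1` (Some @` C))].

Definition positive_lebesgue_density :=
  forall (t : R) x, (0 < t)%R -> K x ->
    exists f : borel V -> R,
      [/\ measurable_fun setT f, forall y, (0 <= f y)%R,
          forall y : V, K° y -> (0 < f y)%R &
          forall A : set (borel V), measurable A -> A `<=` K ->
            mp_p X t (Some x) (Some @` A)
            = \int[lebesgue_rV R n]_(y in A) (f y)%:E].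

End irreducibility.

(* Main.v *)
(* Removing the jumps costs only a killing at rate kappa(x) = m(K) + <mu(K), x>: writing P, P' for
   the semigroups of X and of the diffusion X', combinations g >= 0 of the exponentials
   e_u = exp(-<u, .>) satisfy
     P_{s+h} g >= P'_h (exp(- h kappa) P_s g) - o(h),
   because the jump part of the generator is positive and both sides are explicit through the
   Riccati flows.  Iterating N times with h = t0/N, and using that kappa grows at most linearly
   while the first moments of X' stay bounded, gives for g <= 1 and every real r
     P_t0 g >= exp(- r) ((1 + r) P'_t0 g - k),   k affine,
   at first for exponents u in u0 + K*, where u0 is interior to K*.  Exponential sums approximate all
   Borel sets in L^1, so p_t0(x, A) >= exp(- r) ((1 + r) q(x, A) - k(x)) with
   q(x, dy) = exp(- <u0, y>) p'_t0(x, dy), which charges exactly the Lebesgue nonnull subsets of K.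
   Large r gives p_t0(x, A) > 0 as soon as A has positive Lebesgue measure, hence irreducibility.  The
   bound is moreover uniform in x where q is bounded below and k above; combined with a two-step
   minorization (Fubini and truncation of a Radon-Nikodym density) it yields a small set that is
   charged at all large times. *)

From HB Require Import structures.
Require Import Defs.
From mathcomp Require Import all_boot all_order all_algebra.
From mathcomp Require Import all_classical all_reals all_analysis measurable_realfun.
From mathcomp Require Import lra ring.

Set Implicit Arguments.
Unset Strict Implicit.
Unset Printing Implicit Defensive.
Set SsrOldRewriteGoalsOrder.

Import Order.TTheory GRing.Theory Num.Theory.
Import numFieldNormedType.Exports.

Local Open Scope classical_set_scope.
Local Open Scope ring_scope.

(** * Two-step minorization *)

(** The two processes are known only through their Laplace transforms, so everything is compared on
    exponentials and carried over to sets by density. The shape of the bound is that of a tangent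
    line: if [L] is the killing accumulated up to [t0], then [exp(-L) >= exp(-r) * (1 + r - L)] for
    every real [r], and for [0 <= g <= 1] the mean of the right side against [g] involves only
    [P'_t0 g] and the mean of [L]. An unbounded rate leaves no constant below [exp(-L)], but the
    mean of [L] stays below an affine function of the starting point. Iteration needs an error
    [o(h)] uniform over the unbounded cone, whereas the expansions of the flows have errors growing
    with [x]. Exponents above [u0] supply a factor [exp(-c |x| / 2)] that absorbs this growth while
    the flow stays close to its start; hence [t0] is small. Smallness of a set asks for a uniform
    bound, which positivity of each [p_t0(x, A)] does not give. Finally [Bplus] refers to a maximal
    irreducibility measure; it is built as the law at an independent exponential time, started from
    a measure equivalent to Lebesgue measure on [K]. *)

Section truncation.
Context d (T : measurableType d) (R : realType).
Local Open Scope ereal_scope.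

(** The Radon-Nikodym density [f] is finite everywhere, so the sets where [f > k] decrease to the
    empty set and their [nu]-mass tends to 0. [W] is a sublevel set of [f]. *)
Lemma null_dominates_truncation (nu : subprobability T R)
    (mu : subprobability T R) (e : R) : (0 < e)%R -> nu `<< mu ->
  exists (W : set T) (M : R), [/\ measurable W, (0 < M)%R, nu (~` W) < e%:E &
    forall S, measurable S -> nu (S `&` W) <= M%:E * mu S].
Proof.
move=> e0 numu.
pose f := Radon_Nikodym (charge_of_finite_measure nu) mu.
have fin x : f x \is a fin_num by exact: Radon_Nikodym_fin_num.
have intf : mu.-integrable setT f by exact: Radon_Nikodym_integrable.
have mf : measurable_fun setT f by exact: measurable_int intf.
have nuE A : measurable A -> nu A = \int[mu]_(x in A) f x.
  by move=> mA; rewrite -Radon_Nikodym_integral.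
pose W k := [set x | f x <= k%:R%:E].
have mW k : measurable (W k).
  by rewrite -[W k]setTI; exact: emeasurable_fun_infty_c.
have W0 : \bigcap_k ~` W k = set0.
  rewrite -subset0 => x /= /(_ (Num.truncn (fine (f x))).+1 I) /=; apply.
  rewrite /W/= -[f x]fineK// lee_fin.
  have [f0|f0] := leP 0%R (fine (f x)); first by rewrite ltW// truncnS_gt.
  by rewrite (le_trans (ltW f0)).
have cvg0 : nu (~` W k) @[k --> \oo] --> 0.
  rewrite -(measure0 nu) -W0; apply: nonincreasing_cvg_mu.
  - by rewrite ltey_eq fin_num_measure//; exact: measurableC.
  - by move=> k; exact: measurableC.
  - by rewrite W0.
  - move=> k l kl; apply/subsetPset; apply: subsetC => x /le_trans; apply.
    by rewrite lee_fin ler_nat.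
have [k ke] : exists k, nu (~` W k) < e%:E.
  have : \forall k \near \oo, nu (~` W k) < e%:E.
    by have := cvg0 [set y | y < e%:E]; apply; apply: open_ereal_lt'; rewrite lte_fin.
  by case=> k _ /(_ k (leqnn _)); exists k.
(* Level [k] already bounds the density on [W k]; [k + 1] keeps [M] positive when [k = 0]. *)
exists (W k), k.+1%:R; split => // S mS.
have mSW : measurable (S `&` W k) by exact: measurableI.
rewrite nuE//; apply: (@le_trans _ _ (\int[mu]_(x in S `&` W k) k%:R%:E)).
  apply: le_integral => //.
  - exact: integrableS intf.
  - exact: finite_measure_integrable_cst.
  - by move=> x /[!inE] -[].
rewrite integral_cst// lee_pmul ?lee_fin ?ler_nat//.
by apply: le_measure; rewrite ?inE//; exact: subIsetl.
Qed.

End truncation.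

Section integral_inequalities.
Context d (T : measurableType d) (R : realType).
Variable mu : {measure set T -> \bar R}.
Local Open Scope ereal_scope.

(** The difference [g - f] is positive on [B], and finiteness of the smaller integral allows the
    cancellation that makes its integral 0. *)
Lemma lt_integral_null (B : set T) (f g : T -> \bar R) : measurable B ->
  measurable_fun B f -> measurable_fun B g ->
  (forall x, B x -> 0 <= f x) -> (forall x, B x -> f x < g x) ->
  \int[mu]_(x in B) f x < +oo ->
  \int[mu]_(x in B) g x <= \int[mu]_(x in B) f x -> mu B = 0.
Proof.
move=> mB mf mg f0 fg foo gf.
have mgf : measurable_fun B (g \- f) by exact: emeasurable_funB.
have fx x : B x -> f x \is a fin_num.
  move=> Bx; rewrite ge0_fin_numE ?f0//.
  by rewrite (lt_le_trans (fg _ Bx))// leey.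
have gf0 x : B x -> 0 < (g \- f) x by move=> /fg; rewrite /= sube_gt0.
have gE : \int[mu]_(x in B) g x =
    \int[mu]_(x in B) f x + \int[mu]_(x in B) (g \- f) x.
  rewrite -ge0_integralD//; last by move=> x Bx; exact/ltW/gf0.
  apply: eq_integral => x /[!inE] Bx.
  by rewrite /= addeC subeK// fx.
have I0 : \int[mu]_(x in B) (g \- f) x = 0.
  apply/eqP; rewrite eq_le; apply/andP; split; last first.
    by apply: integral_ge0 => x Bx; exact/ltW/gf0.
  move: gf; rewrite gE -[leRHS]adde0 leeD2lE//.
  by rewrite ge0_fin_numE//; exact: integral_ge0.
have /(ae_eq_integral_abs mu mB mgf) : \int[mu]_(x in B) `|(g \- f) x| = 0.
  rewrite -I0; apply: eq_integral => x /[!inE] Bx.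
  by rewrite gee0_abs//; exact/ltW/gf0.
move=> [N [mN N0 BN]].
apply: subset_measure0 N0 => // x Bx; apply: BN => /= /(_ Bx) /eqP.
by rewrite gt_eqF// gf0.
Qed.

Lemma markov_ineq (f : T -> \bar R) (a : R) : (0 <= a)%R ->
  measurable_fun setT f -> (forall x, 0 <= f x) ->
  a%:E * mu [set x | a%:E <= f x] <= \int[mu]_x f x.
Proof.
move=> a0 mf f0.
have mA : measurable [set x | a%:E <= f x].
  by rewrite -[X in measurable X]setTI; exact: emeasurable_fun_c_infty.
rewrite -integral_cst//; apply: (@le_trans _ _ (\int[mu]_(x in [set x | a%:E <= f x]) f x)).
  by apply: ge0_le_integral => //; exact: measurable_funTS.
by apply: ge0_subset_integral.
Qed.

End integral_inequalities.

Section semidirect.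
Context d d' (T : measurableType d) (T' : measurableType d') (R : realType).
Variables (mu : subprobability T R) (p : R.-spker T ~> T').
Local Open Scope ereal_scope.

(** The joint law of a point drawn from [mu] and its successor under [p]. *)
Definition semidirect (S : set (T * T')) := \int[mu]_x p x (xsection S x).

Lemma measurable_kernel_xsection (S : set (T * T')) : measurable S ->
  measurable_fun setT (fun x => p x (xsection S x)).
Proof.
move=> mS; have [l_ hl_] := measure_uub p.
by apply: measurable_fun_xsection_finite_kernel => // /[!inE].
Qed.

Let semidirect0 : semidirect set0 = 0.
Proof. by rewrite [LHS]integral0_eq// => x/= _; rewrite xsection0 measure0. Qed.

Let semidirect_ge0 A : 0 <= semidirect A.
Proof. by apply: integral_ge0 => // *. Qed.

Let semidirect_additive : semi_sigma_additive semidirect.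
Proof.
move=> F mF tF mUF.
rewrite [X in _ --> X](_ : _ = \sum_(n <oo) semidirect (F n)).
  by apply/cvg_closeP; split; [exact: is_cvg_nneseries|rewrite closeE].
rewrite -integral_nneseries//; last by move=> n; exact: measurable_kernel_xsection.
apply: eq_integral => x _; apply/esym/cvg_lim => //=; rewrite xsection_bigcup.
apply: (measure_sigma_additive _ (trivIset_xsection tF)) => ?.
exact: measurable_xsection.
Qed.

HB.instance Definition _ := isMeasure.Build _ _ _ semidirect
  semidirect0 semidirect_ge0 semidirect_additive.

Let semidirectT : semidirect setT <= 1.
Proof.
apply: (@le_trans _ _ (\int[mu]_x 1)).
  apply: ge0_le_integral => //; first exact: measurable_kernel_xsection.
  move=> x _; rewrite (le_trans _ (sprob_kernel_le1 p x))//.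
  by apply: le_measure; rewrite ?inE//; exact: measurable_xsection.
by rewrite integral_cst// mul1e; exact: sprobability_setT.
Qed.

HB.instance Definition _ :=
  Measure_isSubProbability.Build _ _ _ semidirect semidirectT.

End semidirect.

Section two_step.
Context d (T : measurableType d) (R : realType).
Variables (lam : subprobability T R) (p : R.-spker T ~> T) (K : set T).
Hypotheses (mK : measurable K) (lamK : lam (~` K) = 0%E) (lam0 : (0 < lam setT)%E).
Hypothesis pos : forall x A, K x -> measurable A -> (0 < lam A)%E -> (0 < p x A)%E.
Local Open Scope ereal_scope.

Let nu : subprobability (T * T)%type R := product_subprobability (lam, lam).

Let nuE1 S : nu S = \int[lam]_x lam (xsection S x).
Proof. by []. Qed.

Let nuE2 S : measurable S -> nu S = \int[lam]_y lam (ysection S y).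
Proof.
move=> mS; have := indic_fubini_tonelli lam lam mS.
by rewrite -indic_fubini_tonelli1// -indic_fubini_tonelli2//
  !integral_indic// !setIT => ->.
Qed.

(** If [p x] gives mass 0 to almost every section of [S], then [pos] forces these sections to be
    [lam]-null, and Fubini makes [S] null for the product. *)
Let nu_dom : nu `<< semidirect lam p.
Proof.
apply/null_content_dominatesP => S mS S0.
have mpS : measurable_fun setT (fun x => p x (xsection S x)).
  exact: measurable_kernel_xsection.
have mlS : measurable_fun setT (fun x => lam (xsection S x)).
  exact: measurable_fun_xsection.
have /(ae_eq_integral_abs lam measurableT mpS) ae0 :
    \int[lam]_x `|p x (xsection S x)| = 0.
  by rewrite -S0; apply: eq_integral => x _; rewrite gee0_abs.
rewrite nuE1; transitivity (\int[lam]_x `|lam (xsection S x)|).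
  by apply: eq_integral => x _; rewrite gee0_abs.
apply/(ae_eq_integral_abs lam measurableT mlS).
have aeK : {ae lam, forall x, K x} by exists (~` K); split => //; exact: measurableC.
apply: filterS2 ae0 aeK => x p0 Kx _; apply/eqP; rewrite -measure_le0 leNgt.
apply/negP => /(pos Kx (measurable_xsection _ mS)).
by rewrite p0// ltxx.
Qed.

(** Off a set [U] of small product measure, [lam \x lam] is at most [M] times the joint law of one
    step, so almost every [p y] dominates [lam / M] on the section of [W] at [y]. A single step may
    miss part of the target through [U]. Two steps repair this: points of [C] reach most [z], and
    most [z] reach at least half of [A & D], since the sections of [U] above [C] and across [D] are
    small. The fibrewise bounds hold almost everywhere only, so the exceptional set of [y] depends
    on [A]. *)
Lemma two_step_minorization :
  exists (C D : set T) (c : R), [/\ measurable C, measurable D, C `<=` K,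
    0 < lam C & 0 < lam D] /\ (0 < c)%R /\
    forall A, measurable A ->
      lam [set y | C y /\ kcomp_noparam p p y A < c%:E * lam (A `&` D)] = 0.
Proof.
pose L := fine (lam setT).
have LE : lam setT = L%:E by rewrite fineK// fin_num_measure.
have L0 : (0 < L)%R by rewrite -lte_fin -LE.
have lamE A : measurable A -> lam A = (fine (lam A))%:E.
  by move=> mA; rewrite fineK// fin_num_measure.
have lamC A : measurable A -> fine (lam (~` A)) = (L - fine (lam A))%R.
  move=> mA; have /= := measureU lam mA (measurableC mA) (setICr A).
  rewrite setUv LE [lam A]lamE// [lam (~` A)]lamE; last exact: measurableC.
  by rewrite -EFinD => -[->]; rewrite addrC addKr.
have lamD A B : measurable A -> measurable B ->
    lam (A `\` B) = (fine (lam A) - fine (lam (A `&` B)))%:E.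
  move=> mA mB; have mAB := measurableI _ _ mA mB; have mDAB := measurableD mA mB.
  have /= := measureU lam mDAB mAB.
  rewrite setUC setUIDK setDE -setIA (setICA _ A) setICl !setI0 => /(_ erefl).
  rewrite -setDE [lam A]lamE// [lam (A `&` B)]lamE// [lam (A `\` B)]lamE//.
  by rewrite -EFinD => -[->]; rewrite addrK.
(* With total mass below [L * (L / 4)], Markov's inequality at level [L / 4] leaves a set of
   positive measure with small sections, in either coordinate. *)
have [W [M [mW M0 We WM]]] : exists (W : set (T * T)) (M : R),
    [/\ measurable W, (0 < M)%R, nu (~` W) < (L * (L / 4))%:E &
    forall S, measurable S -> nu (S `&` W) <= M%:E * semidirect lam p S].
  by apply: null_dominates_truncation => //; rewrite !mulr_gt0// invr_gt0.
pose U := ~` W; have mU : measurable U by exact: measurableC.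
have msub (f : T -> \bar R) (a : R) : measurable_fun setT f ->
    measurable [set x | f x < a%:E].
  by move=> mf; rewrite -[X in measurable X]setTI; exact: emeasurable_fun_infty_o.
have large (f : T -> \bar R) : measurable_fun setT f -> (forall x, 0 <= f x) ->
    \int[lam]_x f x < (L * (L / 4))%:E -> 0 < lam [set x | f x < (L / 4)%:E].
  move=> mf f0 fL; have mS := msub _ (L / 4)%R mf.
  have := @markov_ineq _ _ _ lam f (L / 4) _ mf f0.
  have -> : [set x | (L / 4)%:E <= f x] = ~` [set x | f x < (L / 4)%:E].
    by apply/seteqP; split=> x /=; rewrite leNgt => /negP.
  move=> /(_ ltac:(by rewrite divr_ge0// ltW)) /le_lt_trans /(_ fL) /=.
  rewrite [lam (~` _)]lamE; last exact: measurableC.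
  rewrite lamC// -EFinM lte_fin mulrC ltr_pM2r ?divr_gt0//.
  by rewrite [lam [set _ | _]]lamE// lte_fin; lra.
have mxU : measurable_fun setT (fun x => lam (xsection U x)).
  exact: measurable_fun_xsection.
have myU : measurable_fun setT (fun x => lam (ysection U x)).
  exact: measurable_fun_ysection.
pose C := [set x | lam (xsection U x) < (L / 4)%:E] `&` K.
pose D := [set x | lam (ysection U x) < (L / 4)%:E].
have mD : measurable D by exact: msub.
have mC : measurable C by apply: measurableI => //; exact: msub.
have C0 : 0 < lam C.
  have := large _ mxU (fun x => measure_ge0 _ _) We.
  rewrite -(setIT [set _ | _]) -(setUv K) setIUr => /lt_le_trans; apply.
  rewrite (le_trans (measureU2 _ _ _))//.
  - by apply: measurableI; [exact: msub|exact: measurableC].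
  - rewrite -[leRHS]adde0 leeD2l//.
    rewrite -lamK; apply: le_measure; rewrite ?inE.
    + by apply: measurableI; [exact: msub|exact: measurableC].
    + exact: measurableC.
    + exact: subIsetr.
have D0 : 0 < lam D by apply: large => //; rewrite -nuE2.
(* Testing the domination on S restricted to the exceptional set shows that it holds fibrewise. *)
have fibre S : measurable S ->
    lam [set y | p y (xsection S y) < M^-1%:E * lam (xsection (S `&` W) y)] = 0.
  move=> mS; have mSW : measurable (S `&` W) by exact: measurableI.
  have mf : measurable_fun setT (fun y => p y (xsection S y)).
    exact: measurable_kernel_xsection.
  have mg : measurable_fun setT (fun y => M^-1%:E * lam (xsection (S `&` W) y)).
    by apply: measurable_funeM; exact: measurable_fun_xsection.
  set B := [set y | _].
  have mB : measurable B.
    by rewrite -[B]setTI; exact: emeasurable_fun_lt.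
  have mBT : measurable (B `*` [set: T]) by exact: measurableX.
  apply: (@lt_integral_null _ _ _ _ B (fun y => p y (xsection S y))
    (fun y => M^-1%:E * lam (xsection (S `&` W) y))) => //.
  - exact: measurable_funTS.
  - exact: measurable_funTS.
  - rewrite (@le_lt_trans _ _ (\int[lam]_(x in B) 1))//.
      apply: ge0_le_integral => //; first exact: measurable_funTS.
      move=> x _; rewrite (le_trans _ (sprob_kernel_le1 p x))//.
      by apply: le_measure; rewrite ?inE//; exact: measurable_xsection.
    by rewrite integral_cst// mul1e ltey_eq fin_num_measure.
  have := WM (S `&` (B `*` setT)) (measurableI _ _ mS mBT).
  rewrite nuE1 /semidirect => le1.
  rewrite ge0_integralZl//; last 2 first.
    exact/measurable_funTS/measurable_fun_xsection.
    by rewrite lee_fin invr_ge0 ltW.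
  rewrite lee_pdivrMl//.
  have secE (m : {measure set T -> \bar R}) S' x :
      m (xsection (S' `&` (B `*` setT)) x) =
      (fun x => m (xsection S' x)) \_ B x.
    rewrite patchE; case: ifPn => [xB|xB].
      by rewrite xsectionI in_xsectionX// setIT.
    by rewrite xsectionI notin_xsectionX// setI0 measure0.
  rewrite [leLHS]integral_mkcond [in leRHS]integral_mkcond.
  move: le1; congr (_ <= _ * _); apply: eq_integral => x _.
    by rewrite setIAC secE.
  by rewrite secE !patchE.
(* Product of the two steps: mass at least [L / (4 M)] reaches [E], and from [E] mass at least
   [l / (2 M)] reaches [A], where [l = lam (A & D)]. *)
exists C, D, (L / (8 * M ^+ 2))%R; split; first by split => //; exact: subIsetr.
split; first by rewrite divr_gt0// mulr_gt0// exprn_gt0.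
move=> A mA.
pose AD := A `&` D; have mAD : measurable AD by exact: measurableI.
pose l := fine (lam AD).
have lE : lam AD = l%:E by exact: lamE.
have : (0 <= l)%R by rewrite -lee_fin -lE.
rewrite le_eqVlt => /predU1P[l0|l0].
  rewrite (_ : [set y | _] = set0) ?measure0//; apply/seteqP; split=> // y /= [_].
  rewrite -/AD lE -l0 mule0 ltNge => /negP; apply.
  by apply: integral_ge0.
pose N1 := [set y | p y AD < M^-1%:E * lam (xsection (setT `*` AD `&` W) y)].
have mN1 : measurable N1.
  rewrite -[N1]setTI; apply: emeasurable_fun_lt => //; first exact: measurable_kernel.
  apply: measurable_funeM; apply: measurable_fun_xsection.
  by apply: measurableI => //; exact: measurableX.
have N10 : lam N1 = 0.
  have := fibre (setT `*` AD) (measurableX measurableT mAD).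
  rewrite /N1; congr (_ = _); congr (lam _); apply/seteqP; split=> y /=;
  by rewrite (in_xsectionX (X1:=setT)) ?in_setT.
pose V := U `&` (setT `*` AD).
have mV : measurable V by apply: measurableI => //; exact: measurableX.
have mlV : measurable_fun setT (fun z => lam (xsection V z)).
  exact: measurable_fun_xsection.
(* Points [z] whose section of [W] keeps more than half of [AD]. By definition of [D] the set [V]
   has measure at most [(L / 4) * l], so Markov's inequality at level [l / 2] bounds the complement
   by [L / 2]. *)
pose G := [set z | lam (xsection V z) < (l / 2)%:E].
have mG : measurable G by exact: msub.
have G2 : (fine (lam (~` G)) <= L / 2)%R.
  have h1 : nu V <= (L / 4 * l)%:E.
    rewrite nuE2//.
    apply: (@le_trans _ _ (\int[lam]_(y in AD) (L / 4)%:E)); last first.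
      by rewrite integral_cst//= lE.
    rewrite [leRHS]integral_mkcond; apply: ge0_le_integral => //.
    - exact: measurable_fun_ysection.
    - by apply/measurable_restrict => //; rewrite setTI; exact: measurable_cst.
    move=> y _; rewrite patchE; case: ifPn => yAD.
      rewrite (@le_trans _ _ (lam (ysection U y)))//; last first.
        by move: yAD => /[!inE] -[_ /ltW].
      apply: le_measure; rewrite ?inE; [exact: measurable_ysection..|].
      by apply: le_ysection; exact: subIsetl.
    rewrite [ysection V y](_ : _ = set0) ?measure0//; apply/seteqP; split => // x.
    by rewrite /ysection/= inE => -[_ [_]] /mem_set; rewrite (negbTE yAD).
  have := @markov_ineq _ _ _ lam (fun z => lam (xsection V z)) (l / 2) _ mlV (fun x => measure_ge0 _ _).
  have -> : [set x | (l / 2)%:E <= lam (xsection V x)] = ~` G.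
    by apply/seteqP; split=> x /=; rewrite leNgt => /negP.
  move=> /(_ ltac:(by rewrite divr_ge0// ltW)) /le_trans /(_ h1) /=.
  rewrite [X in _ * X <= _]lamE; last exact: measurableC.
  rewrite -EFinM lee_fin; nra.
(* Intermediate points: [N1] is the null set on which the fibrewise bound fails for [AD]. *)
pose E := ~` N1 `&` G.
have mE : measurable E by apply: measurableI => //; exact: measurableC.
have pE z : E z -> (l / (2 * M))%:E <= p z A.
  move=> [nN1 Gz]; apply: (@le_trans _ _ (p z AD)); last first.
    by apply: le_measure; rewrite ?inE//; exact: subIsetl.
  move: nN1 => /negP; rewrite -leNgt; apply: le_trans.
  have -> : xsection (setT `*` AD `&` W) z = AD `\` xsection V z.
    apply/seteqP; split => x; rewrite /xsection/= !inE.
      by move=> -[[_ ADx] Wx]; split => // -[].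
    by move=> [ADx nV]; split => //; apply: contrapT => nW; exact: nV.
  have mxV : measurable (xsection V z) by exact: measurable_xsection.
  rewrite lamD//.
  have : lam (AD `&` xsection V z) <= lam (xsection V z).
    by apply: le_measure; rewrite ?inE//; apply: measurableI.
  move=> /le_lt_trans /(_ Gz).
  rewrite [lam (AD `&` _)]lamE; last exact: measurableI.
  rewrite lte_fin -EFinM lee_fin => h.
  rewrite [leLHS](_ : _ = (M^-1 * (l / 2))%R); last by field; rewrite gt_eqF.
  by rewrite ler_pM2l ?invr_gt0//; move: h; rewrite lE /=; lra.
pose N2 := [set y | p y E < M^-1%:E * lam (xsection (setT `*` E `&` W) y)].
have N20 : lam N2 = 0.
  have := fibre (setT `*` E) (measurableX measurableT mE).
  rewrite /N2; congr (_ = _); congr (lam _); apply/seteqP; split=> y /=;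
  by rewrite (in_xsectionX (X1:=setT)) ?in_setT.
have mN2 : measurable N2.
  rewrite -[N2]setTI; apply: emeasurable_fun_lt => //; first exact: measurable_kernel.
  apply: measurable_funeM; apply: measurable_fun_xsection.
  by apply: measurableI => //; exact: measurableX.
have mp2 : measurable_fun setT (fun y => kcomp_noparam p p y A).
  exact: (measurable_kernel (mkcomp_noparam p p) A mA).
apply: (subset_measure0 _ mN2) N20.
  rewrite (_ : [set y | _] =
    C `&` [set y | kcomp_noparam p p y A < (L / (8 * M ^+ 2) * l)%:E]).
    by apply: measurableI => //; exact: msub.
  by apply/seteqP; split => y /=; rewrite -/AD lE -EFinM.
move=> y /= [[Uy Ky]]; rewrite -/AD lE -EFinM => h.
apply: contrapT => /negP; rewrite -leNgt => h2.
move: h; rewrite ltNge => /negP; apply.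
apply: (@le_trans _ _ (\int[p y]_(z in E) (l / (2 * M))%:E)); last first.
  apply: (@le_trans _ _ (\int[p y]_(z in E) p z A)).
    apply: ge0_le_integral => //.
    - by move=> z _; rewrite lee_fin divr_ge0// ?mulr_ge0// ltW.
    - exact/measurable_funTS/measurable_kernel.
  apply: ge0_subset_integral => //; exact: measurable_kernel.
rewrite integral_cst//.
have -> : (L / (8 * M ^+ 2) * l)%:E = (l / (2 * M))%:E * (M^-1 * (L / 4))%:E.
  by rewrite -EFinM; congr EFin; field; rewrite gt_eqF.
apply: lee_pmul => //.
  by rewrite lee_fin divr_ge0// ?mulr_ge0// ltW.
  by rewrite lee_fin mulr_ge0 ?invr_ge0 ?divr_ge0// ltW.
apply: le_trans h2; rewrite EFinM; apply: lee_pmul => //.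
  by rewrite lee_fin invr_ge0 ltW.
  by rewrite lee_fin divr_ge0// ltW.
have -> : xsection (setT `*` E `&` W) y = E `\` xsection U y.
  apply/seteqP; split => x; rewrite /xsection/= !inE.
    by move=> -[[_ Ex] Wx]; split => // -[].
  by move=> [Ex nV]; split => //; apply: contrapT => nW; exact: nV.
have mxU' : measurable (xsection U y) by exact: measurable_xsection.
rewrite lamD//.
have : lam (E `&` xsection U y) <= lam (xsection U y).
  by apply: le_measure; rewrite ?inE//; apply: measurableI.
move=> /le_lt_trans /(_ Uy).
rewrite [lam (E `&` _)]lamE; last exact: measurableI.
(* [E] has mass at least [L / 2], and the section of [U] at a point of [C] removes less than [L / 4]
   of it. *)
have GE : lam G <= lam E.
  rewrite -[leRHS]adde0 -N10; apply: le_trans (measureU2 _ mE mN1).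
  apply: le_measure; rewrite ?inE//; first exact: measurableU.
  by move=> x Gx; have [?|?] := pselect (N1 x); [right|left].
move: GE G2; rewrite lamC// [lam G]lamE// [lam E]lamE//.
rewrite !lee_fin lte_fin; lra.
Qed.

End two_step.

Section integral_positivity.
Context d (T : measurableType d) (R : realType).
Variable mu : {measure set T -> \bar R}.
Local Open Scope ereal_scope.

Lemma integral_eq0_null (D : set T) (f : T -> \bar R) : measurable D ->
  measurable_fun D f -> (forall x, D x -> 0 <= f x) ->
  \int[mu]_(x in D) f x = 0 -> mu (D `&` [set x | 0 < f x]) = 0.
Proof.
move=> mD mf f0 I0.
have /(ae_eq_integral_abs mu mD mf) : \int[mu]_(x in D) `|f x| = 0.
  by rewrite -I0; apply: eq_integral => x /[!inE] Dx; rewrite gee0_abs// f0.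
move=> [N [mN N0 DN]]; apply: subset_measure0 N0 => //.
  exact: emeasurable_fun_o_infty.
by move=> x /= [Dx fx]; apply: DN => /= /(_ Dx) /eqP; rewrite gt_eqF.
Qed.

Lemma null_integral_eq0 (D : set T) (f : T -> \bar R) : measurable D ->
  measurable_fun D f -> (forall x, D x -> 0 <= f x) ->
  mu (D `&` [set x | 0 < f x]) = 0 -> \int[mu]_(x in D) f x = 0.
Proof.
move=> mD mf f0 I0.
have mE : measurable (D `&` [set x | 0 < f x]) by exact: emeasurable_fun_o_infty.
have : \int[mu]_(x in D) `|f x| = 0.
  apply/(ae_eq_integral_abs mu mD mf).
  exists (D `&` [set x | 0 < f x]); split => // x /= /not_implyP[Dx /eqP fx].
  by split => //; rewrite lt_neqAle eq_sym fx f0.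
by move=> <-; apply: eq_integral => x /[!inE] Dx; rewrite gee0_abs// f0.
Qed.

Lemma integral_gt0 (D E : set T) (f : T -> \bar R) : measurable D -> measurable E ->
  measurable_fun D f -> (forall x, D x -> 0 <= f x) -> E `<=` D ->
  (forall x, E x -> 0 < f x) -> 0 < mu E -> 0 < \int[mu]_(x in D) f x.
Proof.
move=> mD mE mf f0 ED fE E0; rewrite lt_neqAle integral_ge0// andbT eq_sym.
apply/negP => /eqP /(integral_eq0_null mD mf f0) N0.
move: E0; rewrite ltNge => /negP; apply; rewrite -N0; apply: le_measure; rewrite ?inE//.
  exact: emeasurable_fun_o_infty.
by move=> x Ex; split; [exact: ED|exact: fE].
Qed.

End integral_positivity.

Section integral_mrestr.
Context d (T : measurableType d) (R : realType).
Variable mu : {measure set T -> \bar R}.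
Local Open Scope ereal_scope.

Lemma ge0_integral_mrestr (D : set T) (mD : measurable D) (f : T -> \bar R) :
  measurable_fun setT f -> (forall x, 0 <= f x) ->
  \int[mrestr mu mD]_x f x = \int[mu]_(x in D) f x.
Proof.
move=> mf f0; rewrite -(setUv D) ge0_integral_setU//=; last 3 first.
- exact: measurableC.
- exact: measurable_funTS.
- exact/disj_setPCl.
rewrite [X in _ + X](_ : _ = 0) ?adde0.
  by apply: eq_measure_integral => A mA AD; rewrite /= /mrestr setIidl.
apply: null_integral_eq0 => //=; [exact: measurableC|exact: measurable_funTS|].
by rewrite /mrestr setIAC setICl set0I measure0.
Qed.

End integral_mrestr.

(** * Laws on V and joint measurability *)

Section one_point_measurability.
Context (R : realType) (n : nat).
Local Notation V := 'rV[R]_n.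
Local Notation E := (one_point_compactification V).

Lemma measurable_image_some (A : set (borel V)) : measurable A ->
  measurable (Some @` A : set (borel E)).
Proof.
move: A; apply: smallest_sub; last first.
  by move=> U oU; apply: sub_sigma_algebra; exact: one_point_compactification_open_some.
split.
- by rewrite image_set0.
- move=> B mB; rewrite setTD.
  rewrite (_ : Some @` (~` B) = (Some @` [set: V]) `\` (Some @` B)).
    apply: measurableD => //; apply: sub_sigma_algebra.
    by apply: one_point_compactification_open_some; exact: openT.
  apply/seteqP; split => [_ [x nBx <-]|_ [[x _ <-] nB]].
    by split; [exists x|move=> [y By [yx]]; apply: nBx; rewrite -yx].
  by exists x => // Bx; apply: nB; exists x.
- by move=> F mF; rewrite image_bigcup; exact: bigcup_measurable.
Qed.

Lemma measurable_none : measurable ([set None] : set (borel E)).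
Proof.
rewrite (_ : [set None] = ~` (Some @` [set: V])).
  by apply: measurableC; exact: measurable_image_some.
apply/seteqP; split => [_ -> []//|[x|//]]; by move=> /= /(_ (ex_intro2 _ _ x I erefl)).
Qed.

Lemma measurable_odflt : measurable_fun setT (odflt 0 : borel E -> borel V).
Proof.
move=> _ A mA; rewrite setTI.
rewrite (_ : _ @^-1` A = Some @` A `|` (if 0 \in A then [set None] else set0)).
  apply: measurableU; first exact: measurable_image_some.
  by case: ifP => // _; exact: measurable_none.
apply/seteqP; split => [[x|]/= Ax|x [[y Ay <-]//|]].
- by left; exists x.
- by right; rewrite mem_set.
- by case: ifPn => // /[!inE] A0 ->.
Qed.

Lemma measurable_some : measurable_fun setT (Some : borel V -> borel E).
Proof.
move=> _; apply: smallest_sub.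
  split.
  - by rewrite preimage_set0 setI0.
  - move=> B /=; rewrite !setTI setTD => mB; rewrite preimage_setC; exact: measurableC.
  - move=> F mF; rewrite setTI preimage_bigcup; apply: bigcup_measurable => k _.
    by have := mF k; rewrite /= setTI.
move=> U oU; rewrite /= setTI; apply: sub_sigma_algebra.
move: U oU; exact/continuousP/one_point_compactification_some_continuous.
Qed.

Lemma measurable_set1_some (x : V) : measurable ([set Some x] : set (borel E)).
Proof.
rewrite (_ : [set Some x] = Some @` [set x]); last by rewrite image_set1.
apply: measurable_image_some; rewrite -[[set x]]setCK; apply: measurableC.
apply: sub_sigma_algebra; apply: closed_openC.
exact/accessible_closed_set1/hausdorff_accessible/norm_hausdorff.
Qed.

Lemma closed_measurable_rV (A : set V) : closed A -> measurable (A : set (borel V)).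
Proof.
move=> cA; rewrite -[A]setCK; apply: measurableC; apply: sub_sigma_algebra.
exact: closed_openC.
Qed.

End one_point_measurability.

Section law.
Context (R : realType) (n : nat).
Local Notation V := 'rV[R]_n.
Local Notation E := (one_point_compactification V).
Context (K : set V) (mK : measurable (Some @` K : set (borel E))).
Context (X : markov_process K).
Local Open Scope ereal_scope.

Definition law (t : R) (x : borel V) : {measure set (borel V) -> \bar R} :=
  measure_function_pushforward__canonical__measure_function_Measure
    (mrestr (mp_p X t (Some x : borel E)) mK) (@measurable_odflt R n).

Lemma lawE t x A : law t x A = mp_p X t (Some x : borel E) (Some @` (A `&` K)).
Proof.
rewrite /law /pushforward /mrestr /=; congr (mp_p X t _ _).
apply/seteqP; split => [y [/= Ay [z Kz zy]]|y [z [Az Kz] <-]].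
  by exists z => //; split => //; rewrite -zy in Ay.
by split => //; exists z.
Qed.

Let measurable_law t U : measurable U -> measurable_fun setT (law t ^~ U).
Proof.
move=> mU; pose B : set (borel E) := Some @` (U `&` K).
have mB : measurable B.
  rewrite (_ : B = Some @` U `&` Some @` K); last first.
    apply/seteqP; split => [_ [y [Uy Ky] <-]|_ [[y Uy <-] [z Kz [zy]]]].
      by split; exists y.
    by exists y => //; split => //; rewrite -zy.
  by apply: measurableI => //; exact: measurable_image_some.
rewrite (_ : law t ^~ U = (fun y => mp_p X t y B) \o Some).
  by apply: measurableT_comp; [exact: measurable_kernel|exact: measurable_some].
by apply/funext => x; rewrite /= lawE.
Qed.

HB.instance Definition _ t := isKernel.Build _ _ _ _ R (law t) (measurable_law t).

Lemma law_le1 t x : law t x setT <= 1.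
Proof.
rewrite lawE -(@prob_kernel _ _ _ _ _ (mp_p X t) (Some x : borel E)).
by apply: le_measure; rewrite ?inE//; rewrite setTI; exact: mK.
Qed.

Let law_sub t : ereal_sup [set law t x [set: borel V] | x in setT] <= 1.
Proof. by apply: ge_ereal_sup => _ [x _ <-]; exact: law_le1. Qed.

HB.instance Definition _ t :=
  Kernel_isSubProbability.Build _ _ _ _ R (law t) (law_sub t).

Lemma law_integral t x (f : borel V -> \bar R) : (forall y, 0 <= f y) ->
  measurable_fun setT f ->
  \int[law t x]_y f y = \int[mp_p X t (Some x : borel E)]_(xi in Some @` K) f (odflt 0%R xi).
Proof.
move=> f0 mf; rewrite ge0_integral_pushforward//; last exact: measurable_odflt.
rewrite preimage_setT ge0_integral_mrestr//=.
by apply: measurableT_comp => //; exact: measurable_odflt.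
Qed.

Lemma law_setC t x : law t x (~` K) = 0.
Proof. by rewrite lawE setICl image_set0 measure0. Qed.

(** The Markov property from time 0 on the sure event; under [mp_P X x] the path starts at [x]
    almost surely. *)
Lemma mp_process t x B : (0 <= t)%R -> state_space K x ->
  measurable (B : set (borel E)) -> mp_P X x (mp_X X t @^-1` B) = mp_p X t x B.
Proof.
move=> t0 Kx mB.
have := @mp_markov _ _ _ X x 0%R t setT B Kx (lexx _) t0 mB.
rewrite setTI add0r => ->; last first.
  by move=> S [[S0 SC _] _]; rewrite -[setT]setD0; exact: SC.
have mX0 : measurable_fun setT (mp_X X 0 : _ -> borel E) by exact: mp_measurable.
have mx : measurable ([set x] : set (borel E)).
  by case: Kx => [->|[y _ <-]]; [exact: measurable_none|exact: measurable_set1_some].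
have mX : measurable (mp_X X 0 @^-1` [set x]).
  by rewrite -[X in measurable X]setTI; exact: mX0.
rewrite (ae_eq_integral (fun=> mp_p X t x B))//.
- rewrite integral_cst//; have /= -> := @probability_setT _ _ _ (mp_P X x).
  by rewrite mule1.
- by apply: (measurableT_comp (measurable_kernel (mp_p X t) B mB)).
- exists (~` (mp_X X 0 @^-1` [set x])); split.
  + exact: measurableC.
  + by have /= -> := probability_setC (mp_P X x) mX; rewrite mp_init// subee.
  + by move=> w /= H1 H2; apply: H1 => _; rewrite H2.
Qed.

Lemma mp_chapman_kolmogorov s t x B : (0 <= s)%R -> (0 <= t)%R ->
  state_space K x -> measurable (B : set (borel E)) ->
  mp_p X (s + t) x B = \int[mp_p X s x]_y mp_p X t y B.
Proof.
move=> s0 t0 Kx mB; rewrite -mp_process ?addr_ge0//.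
have := @mp_markov _ _ _ X x s t setT B Kx s0 t0 mB.
rewrite setTI => ->; last first.
  by move=> S [[S0 SC _] _]; rewrite -[setT]setD0; exact: SC.
have mXs : measurable_fun setT (mp_X X s : _ -> borel E) by exact: mp_measurable.
transitivity (\int[measure_function_pushforward__canonical__measure_function_Measure
    (mp_P X x) mXs]_y mp_p X t y B).
  by rewrite ge0_integral_pushforward//; exact: measurable_kernel.
by apply: eq_measure_integral => A mA _; exact: mp_process.
Qed.

(** The kernels are total on the compactification; it is the constraint [mp_state] on paths that
    keeps them in [K] and the cemetery. *)
Lemma mp_state_space s x : (0 <= s)%R -> state_space K x ->
  mp_p X s x (~` (Some @` K) `&` Some @` setT) = 0.
Proof.
move=> s0 Kx; rewrite -mp_process//; last first.
  by apply: measurableI; [exact: measurableC|exact: measurable_image_some].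
rewrite (_ : _ @^-1` _ = set0) ?measure0//; apply/seteqP; split => // w /=.
case: (@mp_state _ _ _ X s w s0) => [-> [_ [y]//]|[y Ky Xw]] [nK _].
by apply: nK; exists y.
Qed.

Lemma mp_none t (A : set (borel V)) : (0 <= t)%R -> measurable A ->
  mp_p X t (None : borel E) (Some @` A : set (borel E)) = 0.
Proof.
move=> t0 mA; apply/eqP; rewrite -measure_le0.
have := @prob_kernel _ _ _ _ _ (mp_p X t) (None : borel E).
have mn := @measurable_none R n.
rewrite -(setvU [set None]) measureU//; last 2 first.
- exact: measurableC.
- by rewrite setICl.
rewrite /= mp_absorbing// => n1.
have n0 : mp_p X t (None : borel E) [set~ None] = 0.
  move: n1; case: (mp_p X t (None : borel E) [set~ None]) => // r [/eqP].
  by rewrite -subr_eq0 addrK => /eqP ->.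
rewrite -[leRHS]n0; apply: le_measure; rewrite ?inE//.
- exact: measurable_image_some.
- exact: measurableC.
- by move=> _ [y _ <-].
Qed.

(** The intermediate state may be restricted to [K]: states of [V] outside [K] have mass 0, and from
    the absorbing cemetery no subset of [V] is reached. *)
Lemma law_chapman_kolmogorov s t x A : (0 <= s)%R -> (0 <= t)%R -> K x ->
  measurable A -> law (s + t) x A = \int[law s x]_y law t y A.
Proof.
move=> s0 t0 Kx mA.
have Sx : state_space K (Some x) by right; exists x.
pose B : set (borel E) := Some @` (A `&` K).
have mAK : measurable (A `&` K).
  apply: measurableI => //; rewrite (_ : K = Some @^-1` (Some @` K)).
    by rewrite -[X in measurable X]setTI; exact: measurable_some.
  by apply/seteqP; split => [y Ky|y [z Kz [<-]]//]; exists y.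
have mB : measurable B by exact: measurable_image_some.
rewrite law_integral//; last exact: measurable_kernel.
rewrite lawE mp_chapman_kolmogorov// -(setUv (Some @` K)) ge0_integral_setU//=; last 3 first.
- exact: measurableC.
- by apply: measurable_funTS; exact: measurable_kernel.
- exact/disj_setPCl.
rewrite [X in _ + X](_ : _ = 0) ?adde0.
  by apply: eq_integral => y /[!inE] -[z Kz <-]; rewrite /= lawE.
apply: null_integral_eq0 => //=; first exact: measurableC.
  by apply: measurable_funTS; exact: measurable_kernel.
apply: subset_measure0 (mp_state_space s0 Sx).
- apply: emeasurable_fun_o_infty; first exact: measurableC.
  by apply: measurable_funTS; exact: measurable_kernel.
- by apply: measurableI; [exact: measurableC|exact: measurable_image_some].
- move=> [y|] [nK By]; first by split => //; exists y.
  by move: By; rewrite /= mp_none// ltxx.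
Qed.

Lemma law_integral_chapman_kolmogorov s t x (f : borel V -> \bar R) :
  (0 <= s)%R -> (0 <= t)%R -> K x ->
  (forall y, 0 <= f y) -> measurable_fun setT f ->
  \int[law (s + t) x]_y f y = \int[law s x]_y \int[law t y]_z f z.
Proof.
move=> s0 t0 Kx f0 mf.
have := @integral_kcomp _ _ _ (borel V) (borel V) (borel V) R
  (law s) (kernel.kernel_snd (law t)) x f f0 mf.
rewrite /kernel.kernel_snd /= => <-.
apply: (@eq_measure_integral _ _ _ _
  (mkcomp (law s) (kernel.kernel_snd (law t)) x) (law (s + t) x)) => A mA _.
by rewrite law_chapman_kolmogorov.
Qed.

End law.

Section boxes.
Context (R : realType) (n : nat).
Local Notation V := 'rV[R]_n.

Lemma rV_coord_le (x : V) i : `|x ord0 i| <= `|x|.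
Proof.
by rewrite [leRHS]mx_normrE (bigD1 (ord0, i))//= le_max lexx.
Qed.

Lemma rV_norm_le (x : V) (M : R) : 0 <= M -> (forall i, `|x ord0 i| <= M) -> `|x| <= M.
Proof.
move=> M0 xM; rewrite [leLHS]mx_normrE; apply: bigmax_le => // -[i j] _ /=.
by rewrite (ord1 i).
Qed.

Lemma measurable_continuous_rV (f : V -> R) : continuous f ->
  measurable_fun setT (f : borel V -> R).
Proof.
move=> cf; apply: (@measurability _ _ (borel V) _ setT _ _ (RGenOpens.measurableE R)) => _ [_ [a [b ->] <-]].
rewrite setTI; apply: sub_sigma_algebra.
by move/continuousP: cf; apply; exact: interval_open.
Qed.

Definition box (a b : V) : set V := [set x | forall i, (a ord0 i < x ord0 i < b ord0 i)].

(** Continuous minorants of the indicator of [box a b], increasing to it with [m]. Continuity in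
    time is available for continuous test functions only, so indicators must be reached through such
    limits. *)
Definition bump (a b : V) (m : nat) (x : V) : R :=
  (\prod_(i < n) Num.min 1 (m%:R * Num.max 0 (Num.min (x ord0 i - a ord0 i) (b ord0 i - x ord0 i)))).

Lemma bump_continuous a b m : continuous (bump a b m).
Proof.
have c1 (u v : R) : continuous (fun y : R =>
    Num.min 1 (m%:R * Num.max 0 (Num.min (y - u) (v - y)))).
  move=> y.
  apply: (@continuous_min R R (cst 1) (fun y => m%:R * Num.max 0 (Num.min (y - u) (v - y))) y).
    exact: cvg_cst.
  apply: (@continuousM R R (cst m%:R) (fun y => Num.max 0 (Num.min (y - u) (v - y))) y).
    exact: cvg_cst.
  apply: (@continuous_max R R (cst 0) (fun y => Num.min (y - u) (v - y)) y).
    exact: cvg_cst.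
  apply: (@continuous_min R R (fun y => y - u) (fun y => v - y) y).
    by apply: cvgB; [exact: cvg_id|exact: cvg_cst].
  by apply: cvgB; [exact: cvg_cst|exact: cvg_id].
rewrite /bump; elim: (index_enum 'I_n) => [|i r IH].
  rewrite (_ : (fun _ => _) = fun=> 1); first exact: cst_continuous.
  by apply/funext => x; rewrite big_nil.
rewrite (_ : (fun _ => _) = (fun x : V => 
  Num.min 1 (m%:R * Num.max 0 (Num.min (x ord0 i - a ord0 i) (b ord0 i - x ord0 i))) *
  (\prod_(i <- r) Num.min 1 (m%:R * Num.max 0 (Num.min (x ord0 i - a ord0 i) (b ord0 i - x ord0 i)))))); last first.
  by apply/funext => x; rewrite big_cons.
move=> x; apply: (@continuousM R V
  (fun x : V => Num.min 1 (m%:R * Num.max 0 (Num.min (x ord0 i - a ord0 i) (b ord0 i - x ord0 i))))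
  (fun x : V => \prod_(i <- r) Num.min 1 (m%:R * Num.max 0 (Num.min (x ord0 i - a ord0 i) (b ord0 i - x ord0 i)))) x); last exact: IH.
apply: (@continuous_comp V R R (fun x : V => x ord0 i)
  (fun y => Num.min 1 (m%:R * Num.max 0 (Num.min (y - a ord0 i) (b ord0 i - y))))).
  exact: coord_continuous.
exact: c1.
Qed.

Lemma bump01 a b m x : (0 <= bump a b m x <= 1).
Proof.
apply/andP; split.
  by apply: prodr_ge0 => i _; rewrite le_min ler01 mulr_ge0// le_max lexx.
apply: prodr_ile1 => i _; rewrite le_min ler01 mulr_ge0//= ?le_max ?lexx//.
by rewrite ge_min lexx.
Qed.

Lemma bump_eq0 a b m x : ~ box a b x -> bump a b m x = 0.
Proof.
move=> nx; have [i] : exists i, ~ (a ord0 i < x ord0 i < b ord0 i).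
  by apply: contrapT => h; apply: nx => i; apply: contrapT => ?; apply: h; exists i.
move=> /negP; rewrite negb_and -!leNgt => hi.
rewrite /bump (bigD1 i)//=.
have -> : Num.max 0 (Num.min (x ord0 i - a ord0 i) (b ord0 i - x ord0 i)) = 0.
  by apply/max_idPl; rewrite ge_min !subr_le0.
by rewrite mulr0 min_r// mul0r.
Qed.

Lemma bump_supp a b m : exists M : R, forall y, (M < `|y|) -> bump a b m y = 0.
Proof.
exists (Num.max `|a| `|b|) => y My; apply: bump_eq0 => yab; move: My; apply/negP.
rewrite -leNgt; apply: rV_norm_le => [|i]; first by rewrite le_max normr_ge0.
have /andP[ay yb] := yab i; rewrite ler_norml; apply/andP; split.
  rewrite (le_trans _ (ltW ay))// lerNl (le_trans (ler_norm _))// normrN.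
  by rewrite (le_trans (rV_coord_le a i))// le_max lexx.
rewrite (le_trans (ltW yb))// (le_trans (ler_norm _))//.
by rewrite (le_trans (rV_coord_le b i))// le_max lexx orbT.
Qed.

Lemma bump_nd a b x : {homo (fun m => bump a b m x) : m m' / (m <= m')%N >-> (m <= m')}.
Proof.
move=> m m' mm'; apply: ler_prod => i _; rewrite le_min ler01 mulr_ge0//= ?le_max ?lexx//.
rewrite le_min !ge_min lexx/=; apply/orP; right.
by rewrite ler_wpM2r ?le_max ?lexx// ler_nat.
Qed.

Lemma bump_cvg a b x : (bump a b m x)%:E @[m --> \oo] --> (\1_(box a b) x)%:E.
Proof.
have [xab|nx] := pselect (box a b x); last first.
  rewrite indicE memNset//; under eq_fun do rewrite bump_eq0//; exact: cvg_cst.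
rewrite indicE mem_set//.
pose c := (\big[Num.min/1]_(i < n) Num.min (x ord0 i - a ord0 i) (b ord0 i - x ord0 i)).
have c0 : (0 < c).
  apply: (big_ind (fun y => 0 < y)) => [//|u v u0 v0|i _]; first by rewrite lt_min u0.
  by have /andP[? ?] := xab i; rewrite lt_min !subr_gt0; apply/andP.
have ci i : (c <= Num.min (x ord0 i - a ord0 i) (b ord0 i - x ord0 i)).
  by rewrite /c (bigD1 i)//= ge_min lexx.
apply: cvg_near_cst; exists (Num.truncn c^-1).+1 => // m /= cm; congr EFin.
rewrite /bump big1// => i _; apply/min_idPl.
rewrite max_r; last exact: le_trans (ltW c0) (ci i).
apply: le_trans (ler_wpM2l (ler0n _ _) (ci i)).
by rewrite -ler_pdivrMr// mul1r (le_trans (ltW (truncnS_gt _)))// ler_nat.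
Qed.

Definition box_sets : set (set (borel V)) := [set B | exists a b, B = box a b].

Lemma measurable_boxE : (@measurable _ (borel V)) = <<s box_sets >>.
Proof.
have mbox a b : measurable (box a b : set (borel V)).
  rewrite (_ : box a b = \bigcap_(i in [set: 'I_n])
    ((fun t : borel V => (t : V) ord0 i) @^-1` `]a ord0 i, b ord0 i[)).
    apply: fin_bigcap_measurable => //= i _.
    rewrite -[X in measurable X]setTI.
    by apply: measurable_coord => //; exact: measurable_itv.
  by apply/seteqP; split=> [t Bt i _|t Bt i]; have := Bt i; rewrite /= in_itv/=; [|apply].
apply/seteqP; split; last first.
  apply: smallest_sub; first exact: sigma_algebra_measurable.
  by move=> _ [a [b ->]]; exact: mbox.
have midG : measurable_fun setT (id : g_sigma_algebraType box_sets -> borel V).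
  apply: measurable_fun_rV => i.
  apply: (@measurability _ _ (g_sigma_algebraType box_sets) _ setT _ _ (RGenOpens.measurableE R)) => _ [_ [a [b ->] <-]].
  rewrite setTI.
  (* A slab in coordinate [i] is the union of the boxes whose other sides are []-m, m[]. *)
  rewrite (_ : _ @^-1` _ = \bigcup_m box (\row_j if j == i then a else - m%:R)
      (\row_j if j == i then b else m%:R)); last first.
    apply/seteqP; split => [x /=|x [m _ xm]]; last first.
      by have := xm i; rewrite !mxE eqxx /= in_itv.
    rewrite in_itv/= => xab.
    exists (Num.truncn `|x|).+1 => // j; rewrite !mxE; case: ifPn => [/eqP ->//|_].
    rewrite -ltr_norml (le_lt_trans (rV_coord_le x j))//.
    exact: truncnS_gt.
  apply: bigcupT_measurable => m; apply: sub_sigma_algebra.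
  by do 2 eexists; reflexivity.
by move=> A mA; have := midG measurableT A mA; rewrite setTI.
Qed.

End boxes.

Section joint_measurability.
Context d (T : measurableType d) (R : realType) (n : nat).
Local Notation V := 'rV[R]_n.
Variable k : R -> T -> {measure set (borel V) -> \bar R}.
Local Open Scope ereal_scope.
Hypothesis k_le1 : forall t z, (0 <= t)%R -> k t z setT <= 1.
Hypothesis mk : forall t A, (0 <= t)%R -> measurable A ->
  measurable_fun setT (fun z => k t z A).
Hypothesis k_cvg : forall t z (f : V -> R), (0 <= t)%R -> continuous f ->
  (forall y, (0 <= f y <= 1)%R) -> (exists M : R, forall y, (M < `|y|)%R -> f y = 0%R) ->
  \int[k s z]_y (f y)%:E @[s --> t^'+] --> \int[k t z]_y (f y)%:E.

(** [grid j (level j t)] lies strictly to the right of [|t|] within [1 / (j + 1)], so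
    right-continuity gives convergence along it; the absolute value makes negative times
    harmless. *)
Let grid (j : nat) (m : nat) : R := (m.+1%:R / j.+1%:R)%R.
Let level (j : nat) (t : R) : nat := Num.truncn (j.+1%:R * `|t|)%R.

Let grid_ge0 j m : (0 <= grid j m)%R. Proof. exact: divr_ge0. Qed.

Let measurable_level j m : measurable [set t | level j t = m].
Proof.
rewrite (_ : [set t | _] = (fun t => j.+1%:R * `|t|)%R @^-1` `[m%:R, m.+1%:R[).
  rewrite -[X in measurable X]setTI.
  have mf : measurable_fun setT (fun t : R => j.+1%:R * `|t|)%R.
    by apply: measurable_funM => //; exact: measurable_cst.
  by apply: mf => //; exact: measurable_itv.
apply/seteqP; split => t /=; rewrite in_itv/=.
  by move=> <-; apply: truncn_itv; exact: mulr_ge0.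
by move=> /truncn_def.
Qed.

Let level_cvg t : grid j (level j t) @[j --> \oo] --> (`|t|)%R^'+.
Proof.
have lt1 j : (`|t| < grid j (level j t))%R.
  rewrite /grid ltr_pdivlMr// mulrC.
  by have /andP[] := @truncn_itv _ (j.+1%:R * `|t|)%R (mulr_ge0 (ler0n _ _) (normr_ge0 _)).
have le1 j : (grid j (level j t) <= `|t| + j.+1%:R^-1)%R.
  rewrite /grid ler_pdivrMr// mulrDl mulVf ?pnatr_eq0//.
  rewrite -[in X in (X <= _)%R]natr1 lerD2r mulrC.
  by have /andP[] := @truncn_itv _ (j.+1%:R * `|t|)%R (mulr_ge0 (ler0n _ _) (normr_ge0 _)).
have cvg1 : grid j (level j t) @[j --> \oo] --> (`|t|)%R.
  apply: (@squeeze_cvgr _ _ _ _ (fun=> `|t|)%R (fun j => `|t| + j.+1%:R^-1)%R).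
  - by near=> j; rewrite (ltW (lt1 _)) le1.
  - exact: cvg_cst.
  - rewrite -[X in _ --> X]addr0; apply: cvgD; first exact: cvg_cst.
    exact: cvg_harmonic.
move=> A [e /= e0 eA].
have /cvgrPdist_lt /(_ _ e0) := cvg1; apply: filterS => j je.
by apply: eA => //=.
Unshelve. all: by end_near. Qed.

Let measurable_time (f : V -> R) : continuous f ->
  (forall y, (0 <= f y <= 1)%R) -> (exists M : R, forall y, (M < `|y|)%R -> f y = 0%R) ->
  measurable_fun setT (fun p : R * T => \int[k `|p.1| p.2]_y (f y)%:E).
Proof.
move=> cf f01 fM; have mf := measurable_continuous_rV cf.
apply: (@emeasurable_fun_cvg _ _ _ _
    (fun j (p : R * T) => \int[k (grid j (level j p.1)) p.2]_y (f y)%:E)); last first.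
  move=> [t z] _ /=.
  apply: (@cvg_comp _ _ _ (fun j => grid j (level j t))
    (fun s => \int[k s z]_y (f y)%:E) _ _ _ (@level_cvg t)).
  exact: k_cvg.
move=> j _ B mB; rewrite setTI.
rewrite (_ : _ @^-1` B = \bigcup_m ([set t | level j t = m] `*`
    ((fun z => \int[k (grid j m) z]_y (f y)%:E) @^-1` B))); last first.
  apply/seteqP; split => [[t z] /= Bz|[t z] [m _ [/= <-]]//].
  by exists (level j t).
apply: bigcup_measurable => m _; apply: measurableX; first exact: measurable_level.
rewrite -[X in measurable X]setTI.
apply: (measurable_fun_integral_kernel (l := k (grid j m))) => //.
- by move=> U mU; exact: mk.
- by move=> y; rewrite lee_fin; case/andP: (f01 y).
- exact/measurable_EFinP.
Qed.

(** For a continuous test function the integral is a limit of functions that are piecewise constant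
    in time. Increasing bumps give boxes, and boxes are stable under intersection and generate the
    Borel sets. *)
Lemma joint_measurable (A : set (borel V)) : measurable A ->
  measurable_fun setT (fun p : R * T => k `|p.1|%R p.2 A).
Proof.
have kfin t z B : (0 <= t)%R -> measurable B -> k t z B \is a fin_num.
  move=> t0 mB; rewrite ge0_fin_numE//; apply: le_lt_trans (ltry 1).
  by apply: le_trans (k_le1 z t0); apply: le_measure; rewrite ?inE.
have mbox a b : measurable_fun setT (fun p : R * T => k `|p.1|%R p.2 (box a b)).
  apply: (@emeasurable_fun_cvg _ _ _ _
    (fun j (p : R * T) => \int[k `|p.1|%R p.2]_y (bump a b j y)%:E)).
    by move=> j; apply: measurable_time; [exact: bump_continuous|exact: bump01|exact: bump_supp].
  move=> [t z] _ /=.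
  have mb : measurable (box a b : set (borel V)).
    by rewrite measurable_boxE; apply: sub_sigma_algebra; exists a, b.
  rewrite -[X in _ --> X]mul1e -(setIT (box a b)) -integral_indic//.
  rewrite (_ : 1 * _ = \int[k `|t|%R z]_x (fun x => limn (fun j => (bump a b j x)%:E)) x).
    apply: cvg_monotone_convergence.
    - exact: measurableT.
    - by move=> j; apply/measurable_EFinP; apply: measurable_continuous_rV; exact: bump_continuous.
    - by move=> j x _; rewrite lee_fin; have /andP[] := bump01 a b j x.
    - by move=> x _ i j ij; rewrite lee_fin; exact: bump_nd.
  rewrite mul1e; apply: eq_integral => x _; apply/esym/cvg_lim => //.
  exact: bump_cvg.
(* The total mass may depend on the point, so complements in the Dynkin argument need this case
   separately; the space is an increasing union of boxes. *)
have mT : measurable_fun setT (fun p : R * T => k `|p.1|%R p.2 setT).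
  pose F m : set (borel V) := box (\row_i - m%:R)%R (\row_i m%:R)%R.
  have mF m : measurable (F m).
    by rewrite measurable_boxE; apply: sub_sigma_algebra; do 2 eexists; reflexivity.
  have FT : \bigcup_m F m = setT.
    apply/seteqP; split => // x _; exists (Num.truncn `|x|%R).+1 => // j; rewrite !mxE.
    rewrite -ltr_norml (le_lt_trans (rV_coord_le x j))//.
    exact: truncnS_gt.
  apply: (@emeasurable_fun_cvg _ _ _ _ (fun j (p : R * T) => k `|p.1|%R p.2 (F j))).
    by move=> m; exact: mbox.
  move=> p _; rewrite -FT; apply: nondecreasing_cvg_mu => //.
    exact: bigcup_measurable.
  move=> i j ij; apply/subsetPset => x Fx l; have := Fx l; rewrite !mxE => /andP[h1 h2].
  by rewrite (le_lt_trans _ h1) ?(lt_le_trans h2) ?lerN2 ?ler_nat.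
rewrite [in X in X -> _]measurable_boxE.
apply: (dynkin_induction (P := fun A => measurable_fun setT (fun p : R * T => k `|p.1|%R p.2 A))
  (@measurable_boxE R n)) => //.
- move=> _ _ [a [b ->]] [a' [b' ->]].
  exists (\row_i Num.max (a ord0 i) (a' ord0 i))%R, (\row_i Num.min (b ord0 i) (b' ord0 i))%R.
  apply/seteqP; split => [x [h1 h2] i|x h].
    by have /andP[? ?] := h1 i; have /andP[? ?] := h2 i; rewrite !mxE gt_max lt_min; apply/andP; split; apply/andP.
  by split => i; have := h i; rewrite !mxE gt_max lt_min => /andP[/andP[? ?] /andP[? ?]]; apply/andP.
- by move=> _ [a [b ->]]; exact: mbox.
- move=> S mS kS.
  rewrite (_ : (fun _ => _) = (fun p : R * T => k `|p.1|%R p.2 setT - k `|p.1|%R p.2 S)).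
    exact: emeasurable_funB.
  apply/funext => p; rewrite -(setvU S) measureU//; last 2 first.
    exact: measurableC.
    by rewrite setICl.
  by rewrite addeK// kfin.
- move=> F mF tF kF.
  rewrite (_ : (fun _ => _) = (fun p : R * T => \sum_(i <oo) k `|p.1|%R p.2 (F i))).
    exact: ge0_emeasurable_sum.
  by apply/funext => p; apply: measure_semi_bigcup => //; exact: bigcup_measurable.
Qed.

End joint_measurability.

Section path_law.
Context (R : realType) (n : nat).
Local Notation V := 'rV[R]_n.
Local Notation E := (one_point_compactification V).
Context (K : set V) (mK : measurable (Some @` K : set (borel E))).
Context (X : markov_process K).
Local Open Scope ereal_scope.

(** Writing the path as a Dirac mass, or the zero measure after death, lets [joint_measurable] apply
    to paths as it does to transition laws. *)
Definition path_law (t : R) (w : mp_Omega X) : {measure set (borel V) -> \bar R} :=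
  if mp_X X t w is Some y then \d_(y : borel V) else mzero.

Lemma path_lawE t w (A : set (borel V)) :
  path_law t w A = (\1_(Some @` A) (mp_X X t w))%:E.
Proof.
rewrite /path_law indicE; case: (mp_X X t w) => [y|].
  rewrite /= diracE (_ : (Some y \in _) = (y \in A))//.
  by apply/idP/idP => /[!inE] => [[z Az [<-]]//|Ay]; exists y.
by rewrite memNset// => -[].
Qed.

Lemma path_law_integral t w (f : V -> R) : continuous f ->
  \int[path_law t w]_y (f y)%:E = (oapp f 0%R (mp_X X t w))%:E.
Proof.
move=> cf; rewrite /path_law; case: (mp_X X t w) => [y|].
  rewrite integral_dirac//; first by rewrite diracT mul1e.
  by apply/measurable_EFinP; exact: measurable_continuous_rV.
by rewrite integral_measure_zero.
Qed.

(** A function of bounded support vanishes near infinity, which is where the cemetery sits in the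
    compactification. *)
Lemma oapp_continuous (f : V -> R) : continuous f ->
  (exists M : R, forall y, (M < `|y|)%R -> f y = 0%R) ->
  continuous (oapp f 0%R : E -> R).
Proof.
move=> cf [M fM] [x|]; first exact: (cf x).
move=> A /= A0; exists [set y : V | (`|y| <= M)%R].
  have cl : closed [set y : V | (`|y| <= M)%R].
    rewrite (_ : [set _ | _] = (fun y : V => `|y|%R) @^-1` [set r | (r <= M)%R])//.
    apply: closed_comp => [y _|]; [exact: norm_continuous|exact: closed_le].
  split => //; apply: bounded_closed_compact => //.
  by exists M; split; [exact: num_real|move=> r Mr y /le_trans; apply; exact: ltW].
have A00 : A 0%R := nbhs_singleton A0.
by move=> y [[z /negP]|->//]; rewrite -ltNge => /fM f0 <-; rewrite /= f0.
Qed.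

Lemma path_law_joint_measurable (A : set (borel V)) : measurable A ->
  measurable_fun setT (fun p : R * mp_Omega X => path_law `|p.1|%R p.2 A).
Proof.
apply: joint_measurable.
- move=> t z t0; rewrite path_lawE lee_fin indicE.
  by rewrite lern1; case: (_ \in _).
- move=> t B t0 mB; rewrite (_ : (fun _ => _) =
    (fun w => (\1_(Some @` B : set (borel E)) w)%:E) \o mp_X X t); last first.
    by apply/funext => w; rewrite path_lawE.
  apply: measurableT_comp; last exact: mp_measurable.
  by apply/measurable_EFinP; apply: measurable_indic; exact: measurable_image_some.
- move=> t w f t0 cf f01 fM.
  rewrite path_law_integral//.
  under eq_fun do rewrite path_law_integral//.
  apply: cvg_EFin; first by near=> s.
  apply: (@cvg_comp _ _ _ (fun s => mp_X X s w) (oapp f 0%R)).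
    exact: (@mp_right_continuous _ _ _ X t w t0).
  exact: oapp_continuous.
Unshelve. all: by end_near. Qed.

Lemma mp_P_path_law t x (A : set (borel V)) : (0 <= t)%R -> K x -> A `<=` K -> measurable A ->
  mp_P X (Some x) (mp_X X t @^-1` (Some @` A)) = law mK X t x A.
Proof.
move=> t0 Kx AK mA; rewrite mp_process//; last first.
- exact: measurable_image_some.
- by right; exists x.
- by rewrite lawE setIidl.
Qed.

(** Tonelli's theorem on paths and times. Measurability is known in [|t|], hence the indicator of
    the half-line as a factor. *)
Lemma occupation_timeE (A : set (borel V)) x : measurable A -> A `<=` K -> K x ->
  \int[mp_P X (Some x)]_w occupation_time A w =
  \int[lebesgue_measure]_(t in `[0%R, +oo[) law mK X `|t|%R x A.
Proof.
move=> mA AK Kx.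
pose f (p : mp_Omega X * R) : \bar R := path_law `|p.2|%R p.1 A * (\1_(`[0%R, +oo[%classic : set R) p.2)%:E.
have mf : measurable_fun setT f.
  apply: emeasurable_funM.
    apply: (@measurableT_comp _ _ _ _ _ _ (fun p : R * mp_Omega X => path_law `|p.1|%R p.2 A)
      _ (fun p : mp_Omega X * R => (p.2, p.1))).
      exact: path_law_joint_measurable.
    exact: measurable_swap.
  by apply/measurable_EFinP; apply: measurableT_comp => //; exact: measurable_indic.
have f0 p : 0 <= f p by apply: mule_ge0 => //; rewrite lee_fin.
have this := @fubini_tonelli _ _ _ _ R (mp_P X (Some x)) lebesgue_measure f mf f0.
have restrE (g : R -> \bar R) : g \_ `[0%R, +oo[%classic =
    (fun t => g t * (\1_(`[0%R, +oo[%classic : set R) t)%:E).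
  apply/funext => t; rewrite patchE indicE; case: ifPn => _; first by rewrite mule1.
  by rewrite mule0.
transitivity (\int[mp_P X (Some x)]_w \int[lebesgue_measure]_t f (w, t)).
  apply: eq_integral => w _; rewrite /occupation_time integral_mkcond restrE.
  apply: eq_integral => t _; rewrite /f /= path_lawE.
  have [t0|t0] := leP 0%R t; first by rewrite ger0_norm.
  rewrite [\1_(`[0%R, +oo[%classic : set R) _](_ : _ = 0%R) ?mule0//.
  by rewrite indicE memNset//= in_itv/= andbT; apply/negP; rewrite -ltNge.
rewrite this [RHS]integral_mkcond restrE; apply: eq_integral => t _.
have mX : measurable (mp_X X `|t|%R @^-1` (Some @` A)).
  rewrite -[X in measurable X]setTI.
  by apply: (@mp_measurable _ _ _ X) => //; exact: measurable_image_some.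
rewrite /f /= ge0_integralZr//; last first.
  apply: (@measurableT_comp _ _ _ _ _ _ (fun p : R * mp_Omega X => path_law `|p.1|%R p.2 A)
    _ (fun w => (t : R, w))); first exact: path_law_joint_measurable.
  exact: measurable_pair1.
congr (_ * _); rewrite -mp_P_path_law// -[RHS]mule1 -[RHS]/(_ * 1%:E).
rewrite -[in RHS](setIT (_ @^-1` _)) muleC mul1e -integral_indic//.
by apply: eq_integral => w _; rewrite path_lawE.
Qed.

End path_law.

(** * Lebesgue measure *)

Section lebesgue_rV_lemmas.
Context (R : realType).
Local Open Scope ereal_scope.

Lemma lebesgue_measure_translation (a : R) (A : set R) : measurable A ->
  lebesgue_measure ((fun x : R => x + a)%R @^-1` A) = lebesgue_measure A.
Proof.
move=> mA; have ma : measurable_fun setT (fun x : measurableTypeR R => x + a : measurableTypeR R)%R.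
  by apply: measurable_funD => //; exact: measurable_cst.
apply/esym; rewrite -[RHS]/(pushforward lebesgue_measure (fun x : measurableTypeR R => x + a : measurableTypeR R)%R A).
apply: (@lebesgue_measure_unique _ (measure_function_pushforward__canonical__measure_function_Measure
  lebesgue_measure ma)) => //= _ [[u v]] _ <-.
rewrite /pushforward (_ : _ @^-1` _ = `]u - a, v - a]%classic)%R; last first.
  by apply/seteqP; split => x /=; rewrite !in_itv/= ltrBlDr lerBrDr.
by rewrite /= !lebesgue_measure_itv/= !lte_fin ltrD2r; case: ifP => // _; rewrite -!EFinB opprD addrACA subrr addr0.
Qed.

Lemma lebesgue_rVS n (A : set (borel 'rV[R]_n.+1)) :
  lebesgue_rV R n.+1 A =
  \int[lebesgue_rV R n]_v lebesgue_measure (xsection (@rV_cons R n @^-1` A) v).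
Proof. by []. Qed.

Definition cube n (M : R) : set (borel 'rV[R]_n) := [set x | forall i, (`|(x : 'rV[R]_n) ord0 i| <= M)%R].

Lemma measurable_cube n M : measurable (@cube n M).
Proof.
rewrite (_ : @cube n M = \bigcap_(i in [set: 'I_n])
    ((fun t : borel 'rV[R]_n => (t : 'rV[R]_n) ord0 i) @^-1` `[- M, M]%classic)%R).
  apply: fin_bigcap_measurable => //= i _.
  rewrite -[X in measurable X]setTI.
  by apply: measurable_coord => //; exact: measurable_itv.
by apply/seteqP; split=> [t Bt i _|t Bt i]; have := Bt i; rewrite /= in_itv/= -ler_norml; [|apply].
Qed.

Lemma lebesgue_rV_cube n M : lebesgue_rV R n (@cube n M) < +oo.
Proof.
elim: n => [|n IH] /=.
  by rewrite diracE ltry.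
rewrite /pushforward (_ : _ @^-1` _ = @cube n M `*` `[- M, M]%classic%R); last first.
  apply/seteqP; split => [[v x] /= h|[v x] /= [h xM] i].
    split => [i|]; last by have := h ord0; rewrite mxE unlift_none/= in_itv/= -ler_norml.
    by have := h (lift ord0 i); rewrite mxE liftK.
  rewrite mxE; case: (unliftP ord0 i) => [j _|_] /=; first exact: h.
  by move: xM; rewrite in_itv/= -ler_norml.
rewrite product_measure1E//; last exact: measurable_cube.
rewrite lte_mul_pinfty// ?ge0_fin_numE//= lebesgue_measure_itv/=.
by case: ifP => _; rewrite ?ltry// -EFinB ltry.
Qed.

Lemma rV0_eq (x y : 'rV[R]_0) : x = y.
Proof. by apply/rowP => -[]. Qed.

Lemma rV_cons_add n (a : 'rV[R]_n.+1) (v : borel 'rV[R]_n) (x : R) :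
  ((rV_cons (v, x) : 'rV[R]_n.+1) + a)%R =
  rV_cons (((v : 'rV[R]_n) + (\row_j a ord0 (lift ord0 j)))%R : borel 'rV[R]_n, (x + a ord0 ord0)%R) :> 'rV[R]_n.+1.
Proof.
by apply/rowP => i; rewrite !mxE; case: (unliftP ord0 i) => [j|] -> //=; rewrite !mxE.
Qed.

Lemma measurable_translation n (a : 'rV[R]_n) :
  measurable_fun setT (fun x : borel 'rV[R]_n => (x : 'rV[R]_n) + a : borel 'rV[R]_n)%R.
Proof.
apply: measurable_fun_rV => i.
under eq_fun do rewrite mxE.
by apply: measurable_funD; [exact: measurable_coord|exact: measurable_cst].
Qed.

Lemma lebesgue_rV_translation n (a : 'rV[R]_n) (A : set (borel 'rV[R]_n)) : measurable A ->
  lebesgue_rV R n ((fun x : 'rV[R]_n => x + a)%R @^-1` A) = lebesgue_rV R n A.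
Proof.
elim: n a A => [|n IH] a A mA.
  by rewrite (_ : (fun x : 'rV[R]_0 => _) = id)//; apply/funext => x; exact: rV0_eq.
rewrite !lebesgue_rVS.
pose B := @rV_cons R n @^-1` A.
have mB : measurable B by rewrite -[B]setTI; exact: measurable_rV_cons.
pose a' : 'rV[R]_n := \row_j a ord0 (lift ord0 j).
have ma' := measurable_translation a'.
transitivity (\int[lebesgue_rV R n]_v lebesgue_measure (xsection B ((v : 'rV[R]_n) + a')%R)).
  apply: eq_integral => v _.
  rewrite -[RHS](@lebesgue_measure_translation (a ord0 ord0)); last exact: measurable_xsection.
  congr (lebesgue_measure _); apply/seteqP; split => x; rewrite /xsection /B /= !inE /=.
    by rewrite rV_cons_add.
  by rewrite rV_cons_add.
have mg : measurable_fun setT (fun v : borel 'rV[R]_n => lebesgue_measure (xsection B v)).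
  exact: measurable_fun_xsection.
transitivity (\int[measure_function_pushforward__canonical__measure_function_Measure
   (lebesgue_rV R n) ma']_v lebesgue_measure (xsection B v)).
  by rewrite (ge0_integral_pushforward ma')// preimage_setT.
by apply: eq_measure_integral => D mD _; exact: IH.
Qed.

Lemma sigma_finite_lebesgue_rV n (K : set (borel 'rV[R]_n)) : measurable K ->
  sigma_finite K (lebesgue_rV R n).
Proof.
move=> mK; exists (fun m => K `&` @cube n m%:R%R).
  rewrite -setI_bigcupr (_ : \bigcup_i _ = setT) ?setIT//.
  apply/seteqP; split => // x _; exists (Num.truncn `|x|%R).+1 => // j.
  by rewrite (le_trans (rV_coord_le x j))// ltW// truncnS_gt.
move=> m; have mm := @measurable_cube n m%:R%R; split; first exact: measurableI.
rewrite (le_lt_trans _ (lebesgue_rV_cube n m%:R%R))//.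
by apply: le_measure; rewrite ?inE//; exact: measurableI.
Qed.

(** Two of the translates of a bounded piece of [Z] by [e / (k + 1)] could meet only at points of
    [Z] differing by a positive multiple of [e]. They are thus infinitely many disjoint sets of
    equal measure inside one bounded cube. *)
Lemma lebesgue_rV_null_translates n (Z : set (borel 'rV[R]_n)) (e : 'rV[R]_n) : measurable Z ->
  (forall z s, Z z -> (0 < s)%R -> ~ Z ((z : 'rV[R]_n) + s *: e)%R) -> lebesgue_rV R n Z = 0.
Proof.
move=> mZ Ze.
have mZm m : measurable (Z `&` @cube n m%:R%R).
  by apply: measurableI => //; exact: measurable_cube.
suff Z0 m : lebesgue_rV R n (Z `&` @cube n m%:R%R) = 0.
  rewrite (_ : Z = \bigcup_m (Z `&` @cube n m%:R%R)); last first.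
    rewrite -setI_bigcupr (_ : \bigcup_i _ = setT) ?setIT//.
    apply/seteqP; split => // x _; exists (Num.truncn `|x|%R).+1 => // j.
    by rewrite (le_trans (rV_coord_le x j))// ltW// truncnS_gt.
  apply/eqP; rewrite -measure_le0.
  apply: (le_trans (measure_sigma_subadditive _ mZm (bigcup_measurable (fun k _ => mZm k)) _)) => //.
  by rewrite eseries0.
pose F k := (fun x : 'rV[R]_n => x + (- k.+1%:R^-1 *: e))%R @^-1` (Z `&` @cube n m%:R%R).
have mF k : measurable (F k : set (borel 'rV[R]_n)).
  by rewrite -[F k]setTI; exact: (measurable_translation (- k.+1%:R^-1 *: e)%R).
have FE k : lebesgue_rV R n (F k) = lebesgue_rV R n (Z `&` @cube n m%:R%R).
  exact: lebesgue_rV_translation.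
have tF : trivIset setT F.
  apply: ltn_trivIset => i j ij; rewrite /F; apply/seteqP; split => // x /= [[Zi _] [Zj _]].
  apply: (Ze _ (j.+1%:R^-1 - i.+1%:R^-1)%R Zi).
    by rewrite subr_gt0 ltf_pV2 ?posrE// ltr_nat.
  rewrite -addrA -scalerDl; congr (Z _): Zj; congr (_ + _ *: _)%R.
  by rewrite addKr.
have Fsub : \bigcup_k F k `<=` @cube n (m%:R + `|e|)%R.
  move=> x [k _ [_ h]] i.
  have := h i; rewrite !mxE => h1.
  rewrite -[(x : 'rV[R]_n) ord0 i](addrK (- k.+1%:R^-1 * e ord0 i)%R).
  rewrite (le_trans (ler_normB _ _))// lerD// mulNr normrN normrM.
  rewrite (le_trans _ (rV_coord_le e i))// ler_piMl// ger0_norm// invf_le1 ?ler1n//.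
have mUF : measurable (\bigcup_k F k : set (borel 'rV[R]_n)) by exact: bigcup_measurable.
have UFoo : lebesgue_rV R n (\bigcup_k F k) < +oo.
  rewrite (le_lt_trans _ (lebesgue_rV_cube n (m%:R + `|e|)%R))//.
  by apply: le_measure; rewrite ?inE//; exact: measurable_cube.
move: UFoo; rewrite measure_semi_bigcup//.
under eq_eseriesr do rewrite FE.
set c := lebesgue_rV R n _; have c0 : 0 <= c by exact: measure_ge0.
move=> coo; apply/eqP; rewrite eq_le c0 andbT leNgt; apply/negP => cgt0.
have leN N : (\sum_(0 <= i < N) c <= \sum_(i <oo) c) by exact: nneseries_lim_ge.
have cfin : c \is a fin_num.
  rewrite ge0_fin_numE//; apply: le_lt_trans coo.
  by have := leN 1%N; rewrite big_nat1.
set T := \sum_(i <oo) c in coo leN.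
have Tfin : T \is a fin_num by rewrite ge0_fin_numE// nneseries_ge0.
(* This many copies of [c] exceed the total [T]. *)
have := leN (Num.truncn (fine T / fine c)).+1.
rewrite -[c]fineK// sumEFin -[T]fineK// lee_fin sumr_const_nat subn0.
rewrite leNgt => /negP; apply; rewrite -mulr_natl -ltr_pdivrMr ?truncnS_gt//.
by rewrite fine_gt0// cgt0 -ge0_fin_numE.
Qed.

End lebesgue_rV_lemmas.

(** * From the lower bound to irreducibility and aperiodicity *)

Section exponential_clock.
Context (R : realType).
Local Open Scope ereal_scope.

(* [exponential_prob] lives on the alias [measurableTypeR R]; this is its copy on [R] itself. *)
Definition exponential_clock (A : set R) : \bar R := exponential_prob 1 A.

Let clock : probability (measurableTypeR R) R :=
  exponential_distribution_exponential_prob__canonical__probability_measure_Probability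
    (ltr01 : (0 < 1 :> R)%R).

Let exponential_clock0 : exponential_clock set0 = 0.
Proof. exact: (measure0 clock). Qed.

Let exponential_clock_ge0 A : 0 <= exponential_clock A.
Proof. exact: (measure_ge0 clock). Qed.

Let exponential_clock_additive : semi_sigma_additive exponential_clock.
Proof. exact: (@measure_semi_sigma_additive _ _ _ clock). Qed.

HB.instance Definition _ := isMeasure.Build _ _ _ exponential_clock
  exponential_clock0 exponential_clock_ge0 exponential_clock_additive.

Let exponential_clockT : exponential_clock setT <= 1.
Proof. exact: (@sprobability_setT _ _ _ clock). Qed.

HB.instance Definition _ :=
  Measure_isSubProbability.Build _ _ _ exponential_clock exponential_clockT.

End exponential_clock.

Section kernel_at.
Context d d' (T : measurableType d) (T' : measurableType d') (R : realType).
Variable p : R.-spker T ~> T'.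

Definition kernel_at (x : T) : set T' -> \bar R := p x.

HB.instance Definition _ x := Measure.on (kernel_at x).

HB.instance Definition _ x :=
  Measure_isSubProbability.Build _ _ _ (kernel_at x) (sprob_kernel_le1 p x).

End kernel_at.

Lemma measure_full d (T : measurableType d) (R : realType)
    (mu : {measure set T -> \bar R}) (K : set T) :
  measurable K -> mu (~` K) = 0%E -> mu setT = mu K.
Proof.
move=> mK K0; rewrite -(setvU K) measureU//=; [|exact: measurableC|exact: setICl].
by rewrite K0 add0e.
Qed.

Lemma eq_integral_full d (T : measurableType d) (R : realType)
    (mu : {measure set T -> \bar R}) (K : set T) (f g : T -> \bar R) :
  measurable K -> mu (~` K) = 0%E -> measurable_fun setT f -> measurable_fun setT g ->
  (forall x, K x -> f x = g x) -> (\int[mu]_x f x = \int[mu]_x g x)%E.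
Proof.
move=> mK K0 mf mg fg; apply: ae_eq_integral => //.
exists (~` K); split => //; first exact: measurableC.
by move=> x /=; apply: contra_not => Kx _; exact: fg.
Qed.

Section conclusion.
Context (R : realType) (n : nat).
Local Notation V := 'rV[R]_n.
Local Notation E := (one_point_compactification V).
Context (K : set V) (cK : closed K).
Context (X : markov_process K).
Local Open Scope ereal_scope.

Let mK : measurable (K : set (borel V)) := closed_measurable_rV cK.
Let mSK : measurable (Some @` K : set (borel E)) := measurable_image_some mK.
Local Notation lawX := (law mSK X).
Local Notation leb := (lebesgue_rV R n).

Hypothesis law_cvg : forall (t : R) x (f : V -> R), (0 <= t)%R -> K x ->
  {within K, continuous f} -> (exists M : R, forall y, K y -> (`|f y| <= M)%R) ->
  \int[mp_p X s (Some x)]_(xi in Some @` K) (oapp f 0%R xi)%:E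
    @[s --> within [set s : R | (0 <= s)%R] (nbhs t)] -->
  \int[mp_p X t (Some x)]_(xi in Some @` K) (oapp f 0%R xi)%:E.
Hypothesis law_gt0 : forall (t : R) x, (0 <= t)%R -> K x -> 0 < lawX t x setT.

Variables (t0 : R) (q : R.-spker (borel V) ~> (borel V)) (k : borel V -> R) (x0 : V).
Hypotheses (t0_gt0 : (0 < t0)%R) (Kx0 : K x0) (mk : measurable_fun setT k).
Hypothesis law_lower_bound : forall x A (r : R), K x -> measurable A ->
  (expR (- r) * ((1 + r) * fine (q x A) - k x))%:E <= lawX t0 x A.
Hypothesis q_eq0 : forall x A, K x -> measurable A ->
  q x A = 0 <-> leb (A `&` K) = 0.
Hypothesis leb_gt0 : 0 < leb K.

Let q_gt0 x (A : set (borel V)) : K x -> measurable A -> 0 < leb (A `&` K) -> 0 < q x A.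
Proof.
move=> Kx mA; rewrite lt_neqAle eq_sym => /andP[/eqP n0 _].
by rewrite lt_neqAle measure_ge0 andbT eq_sym; apply/eqP => /q_eq0 h; apply: n0; exact: h.
Qed.

Let qE x (A : set (borel V)) : measurable A -> q x A = (fine (q x A))%:E.
Proof.
move=> mA; rewrite fineK// ge0_fin_numE//; apply: le_lt_trans (ltry 1).
by apply: le_trans (sprob_kernel_le1 q x); apply: le_measure; rewrite ?inE.
Qed.

Let law_t0_gt0 x (A : set (borel V)) : K x -> measurable A -> 0 < leb (A `&` K) -> 0 < lawX t0 x A.
Proof.
move=> Kx mA /(q_gt0 Kx mA); rewrite qE// lte_fin; set a := fine _ => a0.
(* With [r = |k x| / a] the bracket is [a + |k x| - k x], at least [a > 0]. *)
apply: lt_le_trans (law_lower_bound (`|k x| / a) Kx mA).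
rewrite lte_fin mulr_gt0 ?expR_gt0// mulrDl mul1r divfK ?gt_eqF//.
by rewrite -addrA ltr_pwDl// subr_ge0 ler_norm.
Qed.

(** Time [t] is split as [t - t0] followed by [t0]: positive mass survives the first stage in [K],
    and every point of [K] charges [A] during the second. *)
Let law_gt0_after t x (A : set (borel V)) : (t0 <= t)%R -> K x -> measurable A -> 0 < leb (A `&` K) ->
  0 < lawX t x A.
Proof.
move=> t0t Kx mA lA; rewrite -(subrK t0 t).
rewrite law_chapman_kolmogorov ?subr_ge0 ?(ltW t0_gt0)//.
apply: (@integral_gt0 _ _ _ (lawX (t - t0) x) setT K (fun y => lawX t0 y A)) => //.
- exact: measurable_kernel.
- by move=> y Ky; exact: law_t0_gt0.
- have := law_gt0 (t := t - t0) _ Kx; rewrite subr_ge0 => /(_ t0t).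
  by move=> /lt_le_trans; apply; rewrite (measure_full mK (law_setC mSK X (t - t0) x)).
Qed.

(** A finite reference measure with the same null sets as Lebesgue measure on [K], by [q_eq0]. *)
Let lam : subprobability (borel V) R := kernel_at q x0.

(** Continuity in time is assumed at points of [K] only; setting the kernel to 0 elsewhere makes it
    hold at every point, as [joint_measurable] requires. *)
Let mlawK (t : R) (y : borel V) : {measure set (borel V) -> \bar R} :=
  if y \in K then lawX t y else mzero.

Let mlawKE t y (A : set (borel V)) : K y -> mlawK t y A = lawX t y A.
Proof. by move=> Ky; rewrite /mlawK mem_set. Qed.

Let mlawK_le1 t y : mlawK t y setT <= 1.
Proof. by rewrite /mlawK; case: ifP => _; [exact: law_le1|exact: lee01]. Qed.

Let mlawK_joint (A : set (borel V)) : measurable A ->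
  measurable_fun setT (fun p : R * borel V => mlawK `|p.1|%R p.2 A).
Proof.
apply: joint_measurable.
- by move=> t z _; exact: mlawK_le1.
- move=> t B _ mB; rewrite (_ : (fun _ => _) = (fun y => lawX t y B) \_ K).
    apply/(measurable_restrict _ mK measurableT); rewrite setTI.
    by apply: measurable_funTS; exact: measurable_kernel.
  by apply/funext => y; rewrite patchE /mlawK; case: ifP.
- move=> t y f tge0 cf f01 [M fM].
  have mf := measurable_continuous_rV cf.
  rewrite /mlawK; case: ifPn => [/set_mem Ky|_]; last first.
    exact: cvg_cst.
  have lE s : \int[lawX s y]_z (f z)%:E =
     \int[mp_p X s (Some y)]_(xi in Some @` K) (oapp f 0%R xi)%:E.
    rewrite law_integral//.
    - by apply: eq_integral => xi /[!inE] -[z Kz <-].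
    - by move=> z; rewrite lee_fin; case/andP: (f01 z).
    - exact/measurable_EFinP.
  rewrite lE; under eq_fun do rewrite lE.
  have bf : exists M : R, forall y, K y -> (`|f y| <= M)%R.
    by exists 1%R => z _; have /andP[? ?] := f01 z; rewrite ger0_norm.
  have := law_cvg tge0 Ky (continuous_subspaceT cf) bf.
  apply: cvg_trans; apply: cvg_app.
  move=> P; rewrite /within/= /at_right => -[e /= e0 eP].
  exists e => //= s ts tls; apply: (eP s ts) => /=.
  by rewrite (le_trans tge0)// ltW.
Qed.

Let mlawK_kernel : R * borel V -> {measure set (borel V) -> \bar R} :=
  fun p => mlawK `|p.1|%R p.2.

HB.instance Definition _ := isKernel.Build _ _ _ _ R mlawK_kernel mlawK_joint.

Let mlawK_kernel_sub : ereal_sup [set mlawK_kernel p [set: borel V] | p in setT] <= 1.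
Proof. by apply: ge_ereal_sup => _ [p _ <-]; exact: mlawK_le1. Qed.

HB.instance Definition _ :=
  Kernel_isSubProbability.Build _ _ _ _ R mlawK_kernel mlawK_kernel_sub.

Let tau : subprobability R R := @exponential_clock R.

Let tau_null (N : set R) : measurable N ->
  tau N = 0 <-> lebesgue_measure (N `&` `[0%R, +oo[) = 0.
Proof.
move=> mN.
have mp : measurable_fun N (fun x => (exponential_pdf (R:=R) 1 x)%:E).
  by apply/measurable_EFinP/measurable_funTS; exact: measurable_exponential_pdf.
have p0 x : N x -> 0 <= (exponential_pdf (R:=R) 1 x)%:E.
  by rewrite lee_fin exponential_pdf_ge0.
have -> : N `&` `[0%R, +oo[ = N `&` [set x | 0 < (exponential_pdf (R:=R) 1 x)%:E].
  congr (_ `&` _); apply/seteqP; split => x /=; rewrite in_itv/= andbT lte_fin.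
    by move=> x0'; rewrite exponential_pdfE// mul1r expR_gt0.
  by have [//|x0'] := leP 0%R x; rewrite lt0_exponential_pdf// ltxx.
split => [h|h].
  exact: (integral_eq0_null (mu := lebesgue_measure) mN mp p0 h).
exact: (null_integral_eq0 (mu := lebesgue_measure) mN mp p0 h).
Qed.

(** The law of the process started from [lam] and observed at an independent exponential time. *)
Let psi : {measure set (borel V) -> \bar R} :=
  measure_function_pushforward__canonical__measure_function_Measure
   (semidirect (product_subprobability (tau, lam)) mlawK_kernel)
   (@measurable_snd _ _ (R * borel V)%type (borel V)).

(** For [y] in [K], the resolvent: the integral of [exp(-t) P_t(y, A)] over positive times. *)
Let green (y : borel V) (A : set (borel V)) : \bar R := \int[tau]_t mlawK `|t|%R y A.

Let measurable_green (A : set (borel V)) : measurable A -> measurable_fun setT (green ^~ A).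
Proof.
move=> mA.
exact: (@measurable_fun_fubini_tonelli_G _ _ _ _ _ tau (fun p => mlawK_kernel p A)
  (measurable_kernel mlawK_kernel A mA) (fun p => measure_ge0 _ _)).
Qed.

Let psiE (A : set (borel V)) : measurable A -> psi A = \int[lam]_y green y A.
Proof.
move=> mA; rewrite /psi /= /pushforward /semidirect.
transitivity (\int[tau \x lam]_p mlawK_kernel p A).
  by apply: eq_integral => p _; rewrite xsection_preimage_snd.
exact: (fubini_tonelli2 (fun p : R * borel V => mlawK_kernel p A)
  (measurable_kernel mlawK_kernel A mA) (fun p => measure_ge0 _ _)).
Qed.

Let mlaw_time x (A : set (borel V)) : K x -> measurable A ->
  measurable_fun setT (fun t : R => lawX `|t|%R x A).
Proof.
move=> Kx mA.
rewrite (_ : (fun _ => _) = (fun t => mlawK_kernel (t, x) A)).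
  exact: (measurable_fun_pair1 (f := fun p => mlawK_kernel p A) x (measurable_kernel mlawK_kernel A mA)).
by apply/funext => t; rewrite /mlawK_kernel mlawKE.
Qed.

(* The times at which [A] is charged form a null set for the exponential clock iff [A] is never visited. *)
Let green_eq0 x (A : set (borel V)) : K x -> measurable A -> A `<=` K -> green x A = 0 ->
  \int[mp_P X (Some x)]_w occupation_time A w = 0.
Proof.
move=> Kx mA AK; rewrite /green.
under eq_integral do rewrite mlawKE//.
have mt := mlaw_time Kx mA.
move=> /(integral_eq0_null measurableT mt (fun x _ => measure_ge0 _ _)); rewrite setTI.
move=> /tau_null h; rewrite (occupation_timeE mSK)//.
apply: null_integral_eq0 => //.
- exact: measurable_funTS.
- rewrite setIC; apply: h.
  by rewrite -[X in measurable X]setTI; exact: emeasurable_fun_o_infty.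
Qed.

Let occupation_gt0 x (A : set (borel V)) : K x -> measurable A -> A `<=` K -> 0 < leb A ->
  0 < \int[mp_P X (Some x)]_w occupation_time A w.
Proof.
move=> Kx mA AK lA; rewrite (occupation_timeE mSK)//.
apply: (@integral_gt0 _ _ _ lebesgue_measure `[0%R, +oo[%classic `[t0, (t0 + 1)%R]%classic (fun t => lawX `|t|%R x A)) => //.
- by apply: measurable_funTS; exact: mlaw_time.
- by move=> t /=; rewrite !in_itv/= andbT => /andP[t0t _]; apply: le_trans t0t; exact: ltW.
- move=> t /=; rewrite in_itv/= => /andP[t0t _].
  rewrite ger0_norm; last by apply: le_trans t0t; exact: ltW.
  by apply: law_gt0_after => //; rewrite setIidl.
- have h : lebesgue_measure `[t0, (t0 + 1)%R]%classic = 1 :> \bar R.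
    by rewrite lebesgue_measure_itv/= lte_fin ltrDl ltr01 -EFinB addrAC subrr add0r.
  exact: (eq_ind_r (fun z => 0 < z) lte01 h).
Qed.

Lemma irreducible_lebesgue : irreducible_wrt X leb.
Proof.
by split => //; [exact: sigma_finite_lebesgue_rV|move=> A mA AK lA x Kx; exact: occupation_gt0].
Qed.

Let lamK : lam (~` K) = 0.
Proof.
by apply/(q_eq0 Kx0); [exact: measurableC|rewrite setICl measure0].
Qed.

Let lam_gt0 : 0 < lam K.
Proof. by apply: q_gt0 => //; rewrite setIid. Qed.

Let lam_setI (A : set (borel V)) : measurable A -> 0 < lam A -> 0 < leb (A `&` K).
Proof.
move=> mA; rewrite !lt_neqAle !measure_ge0 !andbT ![0 == _]eq_sym.
by apply: contra => /eqP h; apply/eqP/(q_eq0 Kx0 mA).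
Qed.

Let lam_fin (A : set (borel V)) : measurable A -> lam A = (fine (lam A))%:E.
Proof. exact: qE. Qed.

Let green_gt0 x (A : set (borel V)) : K x -> measurable A -> 0 < leb (A `&` K) -> 0 < green x A.
Proof.
move=> Kx mA lA; rewrite lt_neqAle integral_ge0 ?andbT; last by move=> t _; exact: measure_ge0.
rewrite eq_sym; apply/eqP => g0.
have mAK : measurable (A `&` K) by exact: measurableI.
have g0' : green x (A `&` K) = 0.
  apply/eqP; rewrite eq_le; apply/andP; split; last by apply: integral_ge0 => t _; exact: measure_ge0.
  rewrite -g0; apply: ge0_le_integral => //.
  - exact: (measurable_fun_pair1 (f := fun p => mlawK_kernel p (A `&` K)) x (measurable_kernel mlawK_kernel _ mAK)).
  - exact: (measurable_fun_pair1 (f := fun p => mlawK_kernel p A) x (measurable_kernel mlawK_kernel _ mA)).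
  - by move=> t _; apply: le_measure; rewrite ?inE//; exact: subIsetl.
have := occupation_gt0 Kx mAK (@subIsetr _ _ _) lA.
by rewrite (green_eq0 Kx mAK (@subIsetr _ _ _) g0') ltxx.
Qed.

Let psi_gt0 (A : set (borel V)) : measurable A -> 0 < leb (A `&` K) -> 0 < psi A.
Proof.
move=> mA lA; rewrite psiE//; apply: (@integral_gt0 _ _ _ lam setT K (green ^~ A)) => //.
- exact: measurable_green.
- by move=> y _; apply: integral_ge0 => t _; exact: measure_ge0.
- by move=> y Ky; exact: green_gt0.
Qed.

(** If [psi A > 0], the points from which [A] is visited form a set of positive [lam]-measure, hence
    one charged at time [t0] from every [x] in [K]. *)
Let psi_irreducible (A : set (borel V)) x : measurable A -> A `<=` K -> 0 < psi A -> K x ->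
  0 < \int[mp_P X (Some x)]_w occupation_time A w.
Proof.
move=> mA AK psiA Kx; have mt := mlaw_time Kx mA.
rewrite lt_neqAle; apply/andP; split; last first.
  by rewrite (occupation_timeE mSK)//; apply: integral_ge0 => t _; exact: measure_ge0.
rewrite eq_sym; apply/eqP; rewrite (occupation_timeE mSK)//.
move=> h; have {h} N0 : lebesgue_measure (`[0%R, +oo[ `&` [set t | 0 < lawX `|t|%R x A]) = 0.
  apply: (integral_eq0_null (mu := lebesgue_measure) _ _ _ h) => //.
  exact: measurable_funTS.
pose N := [set t : R | 0 < lawX `|t|%R x A].
have mN : measurable N by rewrite -[N]setTI; exact: emeasurable_fun_o_infty.
pose B := [set y : borel V | 0 < green y A].
have mB : measurable B.
  by rewrite -[B]setTI; apply: emeasurable_fun_o_infty => //; exact: measurable_green.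
have lamB : 0 < lam B.
  rewrite lt_neqAle measure_ge0 andbT eq_sym; apply/eqP => B0.
  move: psiA; rewrite psiE// null_integral_eq0 ?ltxx//.
  - exact: measurable_green.
  - by move=> y _; apply: integral_ge0 => t _; exact: measure_ge0.
  - by rewrite setTI.
have lB : 0 < lawX t0 x B by apply: law_t0_gt0 => //; exact: lam_setI.
have shiftE (t : R) : \int[lawX t0 x]_y mlawK `|t|%R y A = lawX (t0 + `|t|)%R x A.
  rewrite law_chapman_kolmogorov ?(ltW t0_gt0)//.
  apply: (eq_integral_full mK (law_setC mSK X t0 x)).
  - exact: (measurable_fun_pair2 (f := fun p => mlawK_kernel p A) t (measurable_kernel mlawK_kernel A mA)).
  - exact: measurable_kernel.
  - by move=> y Ky; rewrite mlawKE.
have mpK : measurable_fun setT (fun p : R * borel V => mlawK `|p.1|%R p.2 A).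
  exact: (measurable_kernel mlawK_kernel A mA).
have mshift : measurable_fun setT (fun t : R => lawX (t0 + `|t|)%R x A).
  rewrite (_ : (fun _ => _) = (fun t => \int[lawX t0 x]_y mlawK `|t|%R y A)).
    exact: (@measurable_fun_fubini_tonelli_F _ _ _ _ _ (kernel_at (lawX t0) x)
      (fun p : R * borel V => mlawK `|p.1|%R p.2 A) mpK (fun p => measure_ge0 _ _)).
  by apply/funext => t; rewrite shiftE.
(* If [A] is charged only at a null set of times, the same holds for the clock restarted at [t0];
   Tonelli then makes the mean of [green] at time [t0] vanish. *)
have I0 : \int[tau]_t lawX (t0 + `|t|)%R x A = 0.
  apply: null_integral_eq0 => //; rewrite setTI.
  have mS : measurable ([set t | 0 < lawX (t0 + `|t|)%R x A] : set R).
    by rewrite -[X in measurable X]setTI; exact: emeasurable_fun_o_infty.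
  apply/tau_null => //.
  have mI : measurable (`[0%R, +oo[ `&` N) by apply: measurableI => //; exact: measurable_itv.
  have sI : lebesgue_measure ((fun s : R => (s + t0)%R) @^-1` (`[0%R, +oo[ `&` N)) = 0.
    by rewrite lebesgue_measure_translation//; exact: N0.
  apply: (@subset_measure0 _ _ _ lebesgue_measure _ _ _ _ _ sI).
  - by apply: measurableI => //; exact: measurable_itv.
  - rewrite -[X in measurable X]setTI.
    by apply: measurable_funD => //; exact: measurable_cst.
  - move=> s /= [Ns]; rewrite in_itv/= andbT => s0.
    rewrite in_itv/= andbT addr_ge0 ?(ltW t0_gt0)//; split => //.
    by move: Ns; rewrite /N/= !ger0_norm ?addr_ge0 ?(ltW t0_gt0)// addrC.
move: lB; rewrite ltNge => /negP; apply.
rewrite measure_le0; apply/eqP; rewrite -[B]setTI; apply: integral_eq0_null => //.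
- exact: measurable_green.
- by move=> y _; apply: integral_ge0 => t _; exact: measure_ge0.
rewrite -I0; under [RHS]eq_integral do rewrite -shiftE.
exact: (esym (@fubini_tonelli _ _ _ _ _ tau (kernel_at (lawX t0) x)
  (fun p : R * borel V => mlawK `|p.1|%R p.2 A) mpK (fun p => measure_ge0 _ _))).
Qed.

(** When [psi A = 0], the resolvent of [A] vanishes at almost every point for [lam], in particular
    at some [y] in [K]. From that [y] the set [A] is never visited, so no irreducibility measure can
    charge it. *)
Lemma maximal_irreducibility_psi : maximal_irreducibility_measure X psi.
Proof.
split.
- split; last by move=> A mA AK psiA x Kx; exact: psi_irreducible.
    exists (fun=> K); first by rewrite bigcup_const.
    move=> _; split => //; rewrite psiE//; apply: le_lt_trans (ltry 1).
    apply: (@le_trans _ _ (\int[lam]_y 1)); last first.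
      by rewrite integral_cst// mul1e; exact: sprobability_setT.
    apply: ge0_le_integral => //; first by move=> y _; apply: integral_ge0 => t _; exact: measure_ge0.
      exact: measurable_green.
    move=> y _; apply: (@le_trans _ _ (\int[tau]_y 1)); last first.
      by rewrite integral_cst// mul1e; exact: sprobability_setT.
    apply: ge0_le_integral => //.
      exact: (measurable_fun_pair1 (f := fun p => mlawK_kernel p K) y (measurable_kernel mlawK_kernel K mK)).
    move=> t _; apply: le_trans (mlawK_le1 _ _); apply: le_measure; rewrite ?inE//.
  by apply: psi_gt0 => //; rewrite setIid.
- move=> nu [_ _ nu_irr] A mA AK psiA0.
  apply/eqP; rewrite -measure_le0 leNgt; apply/negP => nuA.
  have := psiE mA; rewrite psiA0 => /esym.
  have g0 (y : borel V) : [set: borel V] y -> 0 <= green y A.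
    by move=> _; apply: integral_ge0 => t _; exact: measure_ge0.
  move=> /(integral_eq0_null measurableT (measurable_green mA) g0); rewrite setTI => B0.
  have [y [Ky gy]] : exists y, K y /\ green y A = 0.
    apply: contrapT => nex; move: lam_gt0; rewrite ltNge => /negP; apply.
    rewrite -B0; apply: le_measure; rewrite ?inE//.
      rewrite -[X in measurable X]setTI.
      by apply: emeasurable_fun_o_infty => //; exact: measurable_green.
    move=> y Ky /=; rewrite lt_neqAle g0// andbT eq_sym; apply/eqP => gy.
    by apply: nex; exists y.
  by have := nu_irr A mA AK nuA y Ky; rewrite (green_eq0 Ky mA AK gy) ltxx.
Qed.

(** One step of length [t0] reaches the set [C] of the two-step minorization with a probability
    bounded below on [C' j], so [C' j] is small at time [3 * t0]. It has positive Lebesgue measure,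
    hence is charged at all times from [t0] on. *)
Lemma aperiodic_process : aperiodic X.
Proof.
split; first by exists leb; exact: irreducible_lebesgue.
have [C [D [c [[mC mD CK lC lD] [c0 twostep]]]]] : exists (C D : set (borel V)) (c : R),
    [/\ measurable C, measurable D, C `<=` K, 0 < lam C & 0 < lam D] /\ (0 < c)%R /\
    forall A, measurable A ->
      lam [set y | C y /\ kcomp_noparam (lawX t0) (lawX t0) y A < c%:E * lam (A `&` D)] = 0.
  apply: (@two_step_minorization _ _ _ lam (lawX t0) K) => //.
  - by apply: lt_le_trans lam_gt0 _; apply: le_measure; rewrite ?inE.
  - by move=> x A Kx mA lA; apply: law_t0_gt0 => //; exact: lam_setI.
have lebC : 0 < leb (C `&` K) by exact: lam_setI.
(* The lower bound is uniform on these sets, and they exhaust [K] because [q x C > 0] at each of its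
   points. *)
pose C' (j : nat) := [set x : borel V | j.+1%:R^-1%:E <= q x C] `&` k @^-1` `]-oo, j%:R%R] `&` K.
have mC' j : measurable (C' j).
  apply: measurableI => //; apply: measurableI.
    by rewrite -[X in measurable X]setTI; apply: emeasurable_fun_c_infty => //; exact: measurable_kernel.
  by rewrite -[X in measurable X]setTI; apply: mk => //; exact: measurable_itv.
have [j C'0] : exists j, 0 < leb (C' j).
  apply: contrapT => nex.
  have h : leb (\bigcup_j C' j) = 0.
    apply: measure_negligible; first exact: bigcup_measurable.
    apply: negligible_bigcup => i; apply/negligibleP => //.
    by apply/eqP; rewrite -measure_le0 leNgt; apply/negP => Ci; apply: nex; exists i.
  move: leb_gt0; rewrite ltNge -h => /negP; apply.
  apply: le_measure; rewrite ?inE//; first exact: bigcup_measurable.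
  move=> x Kx; have := q_gt0 Kx mC lebC; rewrite qE// lte_fin; set a := fine _ => a0.
  pose N1 := (Num.truncn a^-1); pose N2 := Num.truncn `|k x|%R.
  exists (maxn N1 N2).+1 => //; split => //=; rewrite ?in_itv/=; split.
    rewrite qE// lee_fin -/a -[leRHS]invrK lef_pV2 ?posrE ?invr_gt0//.
    apply: (le_trans (ltW (truncnS_gt _))); rewrite ler_nat.
    by rewrite ltnS leqW// leq_maxl.
  apply: (le_trans (ler_norm _)); apply: (le_trans (ltW (truncnS_gt _))).
  by rewrite ler_nat ltnS leq_maxr.
pose a : R := (j.+1%:R^-1)%R; have a0 : (0 < a)%R by rewrite invr_gt0.
(* Chosen so that [(1 + r) * a - j = a + 1]. *)
pose r : R := ((j%:R + 1) / a)%R.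
pose eta : R := (expR (- r) * ((1 + r) * a - j%:R))%R.
have eta0 : (0 < eta)%R.
  by rewrite mulr_gt0 ?expR_gt0// mulrDl mul1r divfK ?gt_eqF// addrCA addrAC subrr add0r addrC addr_gt0.
have lower (A : set (borel V)) x : C' j x -> measurable A ->
    (eta * c)%:E * lam (A `&` D) <= lawX (t0 + (t0 + t0)) x A.
  rewrite /C'/= in_itv/= => -[[qx kx] Kx] mA.
  have mAD : measurable (A `&` D) by exact: measurableI.
  pose N := [set y | C y /\ kcomp_noparam (lawX t0) (lawX t0) y A < c%:E * lam (A `&` D)].
  have mkc : measurable_fun setT (fun y => kcomp_noparam (lawX t0) (lawX t0) y A).
    exact: (measurable_kernel (mkcomp_noparam (lawX t0) (lawX t0)) A mA).
  have mN : measurable N.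
    apply: measurableI => //; rewrite -[X in measurable X]setTI lam_fin//.
    exact: emeasurable_fun_infty_o.
  have mCN : measurable (C `\` N) by exact: measurableD.
  (* The exceptional set of the minorization is null for [lam = q x0]; all [q x] share their null
     sets, so it can be removed from [C] without loss, for each [A] separately. *)
  have qN : q x N = 0 by apply/(q_eq0 Kx mN)/(q_eq0 Kx0 mN); exact: twostep.
  have qCN : q x (C `\` N) = q x C.
    apply/eqP; rewrite eq_le; apply/andP; split.
      by apply: le_measure; rewrite ?inE//; exact: subDsetl.
    rewrite -[leRHS]adde0 -qN; apply: le_trans (measureU2 _ mCN mN).
    by apply: le_measure; rewrite ?inE//; [exact: measurableU|move=> y Cy;
      have [?|?] := pselect (N y); [right|left]].
  have lCN : eta%:E <= lawX t0 x (C `\` N).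
    apply: le_trans (law_lower_bound r Kx mCN); rewrite lee_fin ler_pM2l ?expR_gt0//.
    rewrite lerB// ler_pM2l//; last first.
      by rewrite addr_gt0// divr_gt0// addr_gt0.
    by rewrite qCN -lee_fin -qE.
  rewrite law_chapman_kolmogorov ?addr_ge0 ?(ltW t0_gt0)//.
  apply: (@le_trans _ _ (\int[lawX t0 x]_(y in C `\` N) (c%:E * lam (A `&` D)))).
    have clam0 : 0 <= c%:E * lam (A `&` D) by apply: mule_ge0 => //; rewrite lee_fin ltW.
    rewrite integral_cst// EFinM -muleA muleC; apply: lee_wpmul2l; [exact: clam0|exact: lCN].
  apply: (@le_trans _ _ (\int[lawX t0 x]_(y in C `\` N) lawX (t0 + t0) y A)).
    apply: ge0_le_integral => //.
    - by move=> y _; rewrite mule_ge0// lee_fin ltW.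
    - by apply: measurable_funTS; exact: measurable_kernel.
    - move=> y [Cy /not_andP[//|/negP]]; rewrite -leNgt => /le_trans; apply.
      by rewrite law_chapman_kolmogorov ?(ltW t0_gt0)//; exact: CK.
  by apply: ge0_subset_integral => //; exact: measurable_kernel.
have [psi_irr psi_max] := maximal_irreducibility_psi.
exists (C' j); split.
- split => //; first exact: subIsetr.
    apply: contrapT => /set0P/negP/negPn/eqP C'e; move: C'0; rewrite C'e measure0 ltxx//.
  exists (t0 + (t0 + t0))%R, (mscale (NngNum (ltW (mulr_gt0 eta0 c0))) (mrestr lam mD)); split.
  + by rewrite !addr_gt0.
  + apply: mule_gt0; first by rewrite lte_fin; exact: mulr_gt0.
    suff : 0 < lam (D `&` K) by rewrite setIC.
    apply: lt_le_trans lD _; rewrite -[leRHS]adde0 -[X in _ + X]lamK.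
    apply: le_trans (measureU2 _ _ _); [|exact: measurableI|exact: measurableC].
    apply: le_measure; rewrite ?inE//; last by move=> y Dy; have [?|?] := pselect (K y); [left|right].
    by apply: measurableU; [exact: measurableI|exact: measurableC].
  + move=> x A C'x mA AK; rewrite mp_P_path_law//; [|by rewrite !addr_ge0 ?(ltW t0_gt0)|by case: C'x].
    exact: lower.
- split => //; first exact: subIsetr.
  by exists psi => //; apply: psi_gt0 => //; rewrite setIidl//; exact: subIsetr.
- exists t0 => t x t0t t_ge0 C'x.
  have [_ Kx] := C'x.
  rewrite mp_P_path_law//; [|exact: subIsetr].
  by apply: law_gt0_after => //; rewrite setIidl//; exact: subIsetr.
Qed.

End conclusion.

Lemma continuous_rVP (R : realType) n (f : 'rV[R]_n -> R) :
  (forall v e, 0 < e -> exists2 d : R, 0 < d & forall w, `|v - w| < d -> `|f v - f w| < e) ->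
  continuous f.
Proof.
move=> h v; apply/(@cvgrPdist_lt _ _ _ _ (nbhs_filter v)) => e e0.
have [d d0 hd] := h v e e0.
by apply/nbhs_ballP; exists d => //= w; rewrite -ball_normE; exact: hd.
Qed.

(** * Inner products and cones *)

Section inner_product_theory.
Context (R : realType) (n : nat) (ip : inner_product R n).
Local Notation V := 'rV[R]_n.
Implicit Types u v w x : V.

Lemma ipDr u v w : ip u (v + w) = ip u v + ip u w.
Proof. by have := ip_linear ip u 1 v w; rewrite scale1r mul1r. Qed.

Lemma ip0r u : ip u 0 = 0.
Proof. by apply: (addrI (ip u 0)); rewrite -ipDr !addr0. Qed.

Lemma ipZr a u v : ip u (a *: v) = a * ip u v.
Proof. by have := ip_linear ip u a v 0; rewrite !addr0 ip0r addr0. Qed.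

Lemma ipNr u v : ip u (- v) = - ip u v.
Proof. by rewrite -scaleN1r ipZr mulN1r. Qed.

Lemma ipBr u v w : ip u (v - w) = ip u v - ip u w.
Proof. by rewrite ipDr ipNr. Qed.

Lemma ip0l u : ip 0 u = 0. Proof. by rewrite ipC ip0r. Qed.

Lemma ipDl u v w : ip (u + v) w = ip u w + ip v w.
Proof. by rewrite ipC ipDr !(ipC _ w). Qed.

Lemma ipZl a u v : ip (a *: u) v = a * ip u v.
Proof. by rewrite ipC ipZr ipC. Qed.

Lemma ipNl u v : ip (- u) v = - ip u v.
Proof. by rewrite ipC ipNr ipC. Qed.

Lemma ipBl u v w : ip (u - v) w = ip u w - ip v w.
Proof. by rewrite ipDl ipNl. Qed.

Lemma ip_sumr u I (r : seq I) (P : pred I) (F : I -> V) :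
  ip u (\sum_(i <- r | P i) F i) = \sum_(i <- r | P i) ip u (F i).
Proof.
apply: (big_ind2 (fun x y => ip u x = y)) => //; first exact: ip0r.
by move=> x1 x2 y1 y2 <- <-; exact: ipDr.
Qed.

Lemma ip_suml u I (r : seq I) (P : pred I) (F : I -> V) :
  ip (\sum_(i <- r | P i) F i) u = \sum_(i <- r | P i) ip (F i) u.
Proof. by rewrite ipC ip_sumr; apply: eq_bigr => i _; rewrite ipC. Qed.

Lemma ip_coord u v : ip u v = \sum_i v ord0 i * ip u (delta_mx 0 i).
Proof.
by rewrite {1}(row_sum_delta v) ip_sumr; apply: eq_bigr => i _; rewrite ipZr.
Qed.

Lemma ip_ge0 u : 0 <= ip u u.
Proof.
have [->|/(ip_gt0 ip)/ltW//] := eqVneq u 0.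
by rewrite ip0r.
Qed.

Lemma ip_eq u v : (forall x, ip x u = ip x v) -> u = v.
Proof.
move=> h; apply/eqP; rewrite -subr_eq0; apply/negPn/negP => /(ip_gt0 ip).
by rewrite ipBr h subrr ltxx.
Qed.

Lemma ip_bound : exists2 C : R, 0 < C & forall u v, `|ip u v| <= C * `|u| * `|v|.
Proof.
pose C : R := \sum_i \sum_j `|ip (delta_mx 0 i) (delta_mx 0 j)|.
exists (C + 1); first by rewrite ltr_wpDl// sumr_ge0// => i _; rewrite sumr_ge0.
move=> u v; apply: (@le_trans _ _ (C * `|u| * `|v|)); last first.
  by rewrite -!mulrA ler_wpM2r ?mulr_ge0// lerDl.
rewrite ip_coord; apply: (le_trans (ler_norm_sum _ _ _)); rewrite /C !mulr_suml.
apply: ler_sum => i _.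
rewrite normrM mulrC; apply: ler_pM => //; last exact: rV_coord_le.
rewrite ipC ip_coord mulr_suml; apply: (le_trans (ler_norm_sum _ _ _)).
apply: ler_sum => j _; rewrite normrM mulrC; apply: ler_pM => //; exact: rV_coord_le.
Qed.

Lemma ip_continuous u : continuous (ip u : V -> R).
Proof.
have [C C0 hC] := ip_bound.
apply: continuous_rVP => v e e0.
have Cu : 0 < C * (`|u| + 1) by rewrite mulr_gt0// ltr_wpDl.
exists (e / (C * (`|u| + 1))); first by rewrite divr_gt0.
move=> w; rewrite ltr_pdivlMr// mulrC -ipBr; apply: le_lt_trans; apply: (le_trans (hC _ _)).
by rewrite ler_wpM2r// ler_wpM2l ?(ltW C0)// lerDl.
Qed.

Lemma ip_sqr_continuous : continuous (fun v => ip v v).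
Proof.
have [C C0 hC] := ip_bound.
apply: continuous_rVP => v e e0.
have Cv : 0 < C * (2 * `|v| + 1) by rewrite mulr_gt0// ltr_wpDl// mulr_ge0.
exists (Num.min 1 (e / (C * (2 * `|v| + 1)))); first by rewrite lt_min ltr01 divr_gt0.
move=> w; rewrite lt_min => /andP[vw]; rewrite ltr_pdivlMr// mulrC.
have -> : ip v v - ip w w = ip (v - w) (v + w).
  by rewrite ipBl !ipDr (ipC _ w v) opprD addrA addrK.
apply: le_lt_trans; apply: (le_trans (hC _ _)).
rewrite mulrAC ler_wpM2r// ler_wpM2l ?(ltW C0)//.
have -> : v + w = v + v - (v - w) by rewrite opprB -addrA [v + (w - v)]addrC subrK.
rewrite (le_trans (ler_normB _ _))// lerD ?(ltW vw)//.
by rewrite (le_trans (ler_normD _ _))// mulr_natl mulr2n.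
Qed.

Lemma measurable_ip u : measurable_fun setT (ip u : borel V -> R).
Proof. exact: (measurable_continuous_rV (@ip_continuous u)). Qed.

(** Positive definiteness makes the Gram matrix [G] of the coordinate basis invertible; [w] solves
    the resulting linear system. *)
Lemma riesz (f : V -> R) : scalar f -> exists w, forall x, f x = ip x w.
Proof.
move=> lf.
pose G : 'M[R]_n := \matrix_(i, j) ip (delta_mx 0 i) (delta_mx 0 j).
have ipG x w : ip x w = (x *m G *m w^T) 0 0.
  rewrite ip_coord mxE; apply: eq_bigr => j _.
  rewrite !mxE ipC ip_coord mulrC; congr (_ * _).
  by apply: eq_bigr => i _; rewrite !mxE ipC.
have Gu : G \in unitmx.
  rewrite -row_free_unit; apply: inj_row_free => v vG.
  apply/eqP/negPn/negP => /(ip_gt0 ip).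
  by rewrite ipG vG mul0mx mxE ltxx.
pose c : 'cV[R]_n := \col_i f (delta_mx 0 i).
exists (invmx G *m c)^T => x.
have f0 : f 0 = 0.
  by have := lf 0 0 0; rewrite scaler0 addr0 mul0r add0r => /esym h; have := lf 1 0 0; rewrite scaler0 addr0 mul1r => h1; apply: (addrI (f 0)); rewrite -h1 addr0.
have fD y z : f (y + z) = f y + f z by have := lf 1 y z; rewrite scale1r mul1r.
have fZ a y : f (a *: y) = a * f y by have := lf a y 0; rewrite !addr0 f0 addr0.
rewrite ipG trmxK !mulmxA mulmxK// mxE [in LHS](row_sum_delta x).
under [RHS]eq_bigr do rewrite mxE.
apply: (big_ind2 (fun y z => f y = z)) => //; first by move=> ? ? ? ? <- <-.
Qed.

Lemma adjointP (f : {linear V -> V}) x u : ip (f x) u = ip x (adjoint ip f u).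
Proof.
have [w hw] : exists w, forall x, ip (f x) u = ip x w.
  apply: (riesz (f := fun x => ip (f x) u)) => a y z.
  by rewrite linearP ipDl ipZl.
by have := @xgetPex _ 0 [set w | forall x, ip (f x) u = ip x w] (ex_intro _ w hw); apply.
Qed.

Lemma ip_coercive : exists2 c : R, 0 < c & forall v, c * `|v| ^+ 2 <= ip v v.
Proof.
pose S : set V := [set v | `|v| = 1].
(* The unit sphere is empty only in dimension 0. *)
have [S0|/set0P S0] := eqVneq S set0.
  exists 1 => // v; have [->|v0] := eqVneq v 0; first by rewrite normr0 expr0n mulr0 ip0r.
  exfalso; have : S (`|v|^-1 *: v) by rewrite /S/= normrZ normfV normr_id mulVf// normr_eq0.
  by rewrite S0.
have cS : compact S.
  apply: bounded_closed_compact.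
    by exists 1; split; [exact: num_real|move=> M M1 v /= ->; exact: ltW].
  rewrite (_ : S = (fun v : V => `|v|) @^-1` [set 1]) //.
  by apply: closed_comp; [move=> v _; exact: norm_continuous|exact: closed_eq].
have cont := ip_sqr_continuous.
have [m mS hm] := compact_EVT_min S0 cS (continuous_subspaceT cont).
move: mS; rewrite inE /S/= => m1.
exists (ip m m); first by apply: ip_gt0; rewrite -normr_eq0 m1 oner_eq0.
move=> v; have [->|v0] := eqVneq v 0; first by rewrite normr0 expr0n mulr0 ip0r.
have nv : `|v| != 0 by rewrite normr_eq0.
have /hm : (`|v|^-1 *: v) \in S by rewrite inE /S/= normrZ normfV normr_id mulVf.
rewrite ipZl ipZr mulrA -ler_pdivlMr ?exprn_gt0 ?normr_gt0//.
by move=> h; rewrite mulrC expr2 invfM.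
Qed.

End inner_product_theory.

Section cone_theory.
Context (R : realType) (n : nat) (ip : inner_product R n).
Local Notation V := 'rV[R]_n.
Variables (K : set V) (pK : proper_cone K).
Implicit Types u v w x y : V.
Local Notation dualK := (dual_cone ip K).

Lemma cone_sum I (r : seq I) (P : pred I) (F : I -> V) :
  (forall i, P i -> K (F i)) -> K (\sum_(i <- r | P i) F i).
Proof. by move=> h; apply: big_ind => //; [exact: cone0|exact: coneD]. Qed.

Lemma dual_cone0 : dualK 0. Proof. by move=> x _; rewrite ip0l. Qed.

Lemma dual_coneD u v : dualK u -> dualK v -> dualK (u + v).
Proof. by move=> du dv x Kx; rewrite ipDl addr_ge0 ?du ?dv. Qed.

Lemma dual_coneZ (a : R) u : 0 <= a -> dualK u -> dualK (a *: u).
Proof. by move=> a0 du x Kx; rewrite ipZl mulr_ge0 ?du. Qed.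

(** Write each basis vector as [x_i - y_i] with both terms in [K], and let [e] be the sum of all
    [x_i + y_i]. Then [|v| e + v] is the sum of [(|v| + v_i) x_i + (|v| - v_i) y_i], whose
    coefficients are nonnegative. *)
Lemma cone_order_unit : exists2 e, K e & forall v, K (`|v| *: e + v).
Proof.
have /choice[xy hxy] : forall i : 'I_n, exists xy : V * V,
    [/\ K xy.1, K xy.2 & delta_mx 0 i = xy.1 - xy.2].
  by move=> i; have [x [y hxy]] := cone_generating pK (delta_mx 0 i); exists (x, y).
exists (\sum_i ((xy i).1 + (xy i).2)).
  by apply: cone_sum => i _; have [? ? _] := hxy i; exact: coneD.
move=> v; rewrite {2}(row_sum_delta v) scaler_sumr -big_split/=.
apply: cone_sum => i _; have [K1 K2 ->] := hxy i.
rewrite scalerDr scalerBr addrACA -scalerDl -scalerBl.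
have := rV_coord_le v i; rewrite ler_norml => /andP[h1 h2].
by apply: (coneD pK); apply: (coneZ pK) => //; [rewrite -lerBlDl sub0r|rewrite subr_ge0].
Qed.

Lemma cone_interior_shift e : K e -> (forall v, K (`|v| *: e + v)) ->
  forall x (s : R), K x -> 0 < s -> K° (x + s *: e).
Proof.
move=> Ke he x s Kx s0; apply/nbhs_ballP; exists s => //= y; rewrite -ball_normE/= => ys.
have -> : y = x + ((s - `|y - (x + s *: e)|) *: e +
    (`|y - (x + s *: e)| *: e + (y - (x + s *: e)))).
  by rewrite [in RHS](addrA (_ *: e)) -scalerDl subrK addrA addrC subrK.
apply: (coneD pK) => //; apply: (coneD pK) => //; apply: (coneZ pK) => //.
by rewrite subr_ge0 distrC ltW.
Qed.

(** From any point of [K], a move along the order unit leads at once into the interior, so the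
    boundary never meets its own translates in that direction. *)
Lemma lebesgue_cone_boundary : lebesgue_rV R n (K `\` K°) = 0%E.
Proof.
have [e Ke he] := cone_order_unit.
apply: (lebesgue_rV_null_translates (e := e)).
  apply: measurableD; first exact: (closed_measurable_rV (cone_closed pK)).
  by apply: sub_sigma_algebra; exact: open_interior.
by move=> z s [Kz _] s0 [_]; apply; exact: cone_interior_shift.
Qed.

(** Let [p] be the point of [K] nearest to [-x] and [u = p + x]. Minimality gives [u] in the dual
    cone and [ip u p <= 0], so [ip u x >= ip u u]; and [u = 0] would put [-x] in [K]. *)
Lemma dual_cone_separates x : K x -> x != 0 -> exists2 u, dualK u & 0 < ip u x.
Proof.
move=> Kx x0.
have [c c0 hc] := ip_coercive ip.
pose f y := ip (y + x) (y + x).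
have cont : continuous f.
  have -> : f = (fun y => ip y y + (2 * ip x y + ip x x)).
    by apply/funext => y; rewrite /f ipDl !ipDr (ipC _ y x) mulr_natl mulr2n !addrA.
  move=> y; apply: (@continuousD R R V (fun y => ip y y) (fun y => 2 * ip x y + ip x x) y).
    exact: ip_sqr_continuous.
  apply: (@continuousD R R V (fun y => 2 * ip x y) (cst (ip x x)) y); last exact: cst_continuous.
  apply: (@continuousM R V (cst 2) (ip x) y); first exact: cst_continuous.
  exact: ip_continuous.
(* Beyond this radius coercivity gives [f y >= ip x x = f 0], so the minimum may be sought in a
   compact set. *)
pose M := `|x| + Num.sqrt (ip x x / c).
pose A : set V := K `&` [set y | `|y| <= M].
have A0 : A 0 by split; [exact: cone0|rewrite /= normr0 addr_ge0// sqrtr_ge0].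
have cA : compact A.
  apply: bounded_closed_compact.
    exists M; split; [exact: num_real|move=> M' M1 v [_ /= vM]].
    exact: le_trans vM (ltW M1).
  apply: closedI; first exact: cone_closed pK.
  rewrite (_ : [set y | _] = (fun v : V => `|v|) @^-1` [set t | t <= M]) //.
  by apply: closed_comp; [move=> v _; exact: norm_continuous|exact: closed_le].
have [p + hp] := compact_EVT_min (ex_intro _ 0 A0) cA (continuous_subspaceT cont).
rewrite inE => -[Kp _].
have {hp} hp y : K y -> f p <= f y.
  move=> Ky; have [yM|yM] := leP `|y| M; first by apply: hp; rewrite inE.
  have h0 : f p <= f 0 by apply: hp; rewrite inE.
  apply: (le_trans h0); rewrite /f add0r; apply: (le_trans _ (hc _)).
  rewrite mulrC -ler_pdivrMr//.
  have n0 : 0 <= ip x x / c by rewrite divr_ge0 ?ip_ge0 ?ltW.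
  rewrite -[leLHS](sqr_sqrtr n0) ler_sqr ?nnegrE ?sqrtr_ge0//.
  have : M - `|x| <= `|y| - `|x| by rewrite lerD2r ltW.
  rewrite /M addrAC subrr add0r => /le_trans; apply.
  by rewrite -(normrN x) (le_trans (lerB_dist _ _))// opprK.
pose u := p + x.
have fE y : f (p + y) = ip u u + (ip u y *+ 2 + ip y y).
  by rewrite /f addrAC -/u; move: u => w; rewrite ipDl !ipDr (ipC _ y w) mulr2n !addrA.
have du z : K z -> 0 <= ip u z.
  move=> Kz; rewrite leNgt; apply/negP => uz.
  (* A step short enough for the negative first-order term to outweigh the quadratic one. *)
  pose t := - ip u z / (ip z z + 1).
  have zz : 0 < ip z z + 1 by rewrite ltr_wpDl// ip_ge0.
  have t0 : 0 < t by rewrite divr_gt0// oppr_gt0.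
  have := hp (p + t *: z) (coneD pK Kp (coneZ pK (ltW t0) Kz)).
  rewrite fE -[f p]addr0 /f -/u lerD2l ipZr ipZl ipZr -mulrnAr -mulrDr pmulr_rge0//.
  have : t * (ip z z + 1) = - ip u z by rewrite divfK// gt_eqF.
  nra.
have up : ip u p <= 0.
  rewrite leNgt; apply/negP => up0.
  (* The variation towards the origin, [(1 - t) p], stays in [K] for [t <= 1]. *)
  pose t := Num.min 1 (ip u p / (ip p p + 1)).
  have pp : 0 < ip p p + 1 by rewrite ltr_wpDl// ip_ge0.
  have t0 : 0 < t by rewrite lt_min ltr01 divr_gt0.
  have t1 : t <= 1 by rewrite ge_min lexx.
  have t2 : t * (ip p p + 1) <= ip u p by rewrite -ler_pdivlMr// ge_min lexx orbT.
  have := hp (p + (- t) *: p).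
  have -> : p + - t *: p = (1 - t) *: p by rewrite scalerBl scale1r scaleNr.
  move=> /(_ (coneZ pK _ Kp)); rewrite subr_ge0 => /(_ t1); rewrite scalerBl scale1r -scaleNr.
  rewrite fE -[f p]addr0 /f -/u lerD2l ipZr ipZl ipZr.
  have : 0 <= ip p p by exact: ip_ge0.
  nra.
exists u => //.
have -> : ip u x = ip u u - ip u p by rewrite -ipBr /u [p + x]addrC addrK.
rewrite ltr_wpDr ?oppr_ge0//; apply: ip_gt0; apply/eqP => u0.
move/eqP: x0; apply; apply: (cone_proper pK Kx).
by have -> : - x = p by apply/eqP; rewrite eq_sym -addr_eq0 -/u u0.
Qed.

(** The unit slice of [K] is compact and covered by the open half-spaces of separating functionals.
    The sum of a finite subcover is positive on the slice, and [c] is its minimum there. *)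
Lemma dual_cone_coercive : exists u0 c, [/\ dualK u0, 0 < c & forall x, K x -> c * `|x| <= ip u0 x].
Proof.
pose S : set V := K `&` [set v | `|v| = 1].
have cS : compact S.
  apply: bounded_closed_compact.
    by exists 1; split; [exact: num_real|move=> M M1 v [_ /= ->]; exact: ltW].
  apply: closedI; first exact: cone_closed pK.
  rewrite (_ : [set v | _] = (fun v : V => `|v|) @^-1` [set 1]) //.
  by apply: closed_comp; [move=> v _; exact: norm_continuous|exact: closed_eq].
have [u0 du0 u0S] : exists2 u0, dualK u0 & forall x, S x -> 0 < ip u0 x.
  have := cS; rewrite compact_cover => /(_ V dualK (fun u => [set x | 0 < ip u x])).
  move=> [|x [Kx /= x1]|D' D'K SD'].
  - move=> u _; rewrite (_ : [set x | _] = ip u @^-1` [set t | 0 < t])//.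
    by apply: open_comp; [move=> v _; exact: ip_continuous|exact: open_gt].
  - have [|u du ux] := dual_cone_separates Kx; last by exists u.
    by rewrite -normr_eq0 x1 oner_eq0.
  - exists (\sum_(u <- finmap.enum_fset D') u).
      move=> x Kx; rewrite ip_suml big_seq sumr_ge0// => u /D'K /[!inE] du.
      exact: du.
    move=> x Sx; have [u uD ux] := SD' _ Sx.
    rewrite ip_suml (big_rem u)//= ltr_pwDl// big_seq sumr_ge0// => w /mem_rem /D'K /[!inE] dw.
    by apply: dw; case: Sx.
have [S0|/set0P S0] := eqVneq S set0.
  exists u0, 1; split => // x Kx; have [->|v0] := eqVneq x 0; first by rewrite normr0 mulr0 ip0r.
  exfalso; have : S (`|x|^-1 *: x).
    split; first by apply: coneZ => //; rewrite invr_ge0.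
    by rewrite /= normrZ normfV normr_id mulVf// normr_eq0.
  by rewrite S0.
have [m mS hm] := compact_EVT_min S0 cS (continuous_subspaceT (@ip_continuous _ _ ip u0)).
exists u0, (ip u0 m); split => //; first by apply: u0S; rewrite inE in mS.
move=> x Kx; have [->|x0] := eqVneq x 0; first by rewrite normr0 mulr0 ip0r.
have nx : `|x| != 0 by rewrite normr_eq0.
have /hm : (`|x|^-1 *: x) \in S.
  rewrite inE; split; first by apply: coneZ => //; rewrite invr_ge0.
  by rewrite /= normrZ normfV normr_id mulVf.
by rewrite ipZr mulrC ler_pdivlMr ?normr_gt0.
Qed.

(** Pairing [w] with [|w| e - w], a point of [K], gives [ip w w <= |w| * ip w e]. Norm bounds in the
    dual cone thus reduce to one scalar. *)
Lemma dual_cone_norm_le e : (forall v, K (`|v| *: e + v)) ->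
  exists2 C : R, 0 < C & forall w, dualK w -> `|w| <= C * ip w e.
Proof.
move=> he; have [c c0 hc] := ip_coercive ip.
exists c^-1; first by rewrite invr_gt0.
move=> w dw; rewrite mulrC ler_pdivlMr//.
have [->|w0] := eqVneq w 0; first by rewrite normr0 mul0r ip0l.
have w_gt0 : 0 < `|w| by rewrite normr_gt0.
rewrite -(ler_pM2l w_gt0) mulrA -expr2 mulrC; apply: (le_trans (hc w)).
by have := dw _ (he (- w)); rewrite ipDr ipZr ipNr normrN subr_ge0.
Qed.

End cone_theory.

(** * Integrals against cone-valued measures *)

Import HBNNSimple.

(** The integral is built from simple functions, whose level sets are measurable, so only values at
    measurable sets count. This relates the bare set functions in [is_cone_integral] to genuine
    measures. *)
Lemma eq_integral_set_function d (T : measurableType d) (R : realType)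
    (mu nu : set T -> \bar R) (D : set T) (f : T -> \bar R) :
  (forall A, measurable A -> mu A = nu A) ->
  (\int[mu]_(x in D) f x = \int[nu]_(x in D) f x)%E.
Proof.
move=> munu.
have E (g : T -> \bar R) :
    [set sintegral mu h | h in
      [set h : {nnsfun T >-> R} | (forall x, ((h x)%:E <= g x)%E)]] =
    [set sintegral nu h | h in
      [set h : {nnsfun T >-> R} | (forall x, ((h x)%:E <= g x)%E)]].
  have h1 (h : {nnsfun T >-> R}) :
      sintegral mu h = sintegral nu h.
    rewrite /sintegral; apply: eq_fsbigr => x _; congr (_ * _)%E; apply: munu.
    exact: (measurable_funPTI h (measurable_set1 x)).
  by apply/seteqP; split => _ [h hg <-]; exists h.
by rewrite /integral !E.
Qed.

Section cone_integration.
Context (R : realType) (n : nat) (ip : inner_product R n).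
Local Notation V := 'rV[R]_n.
Variables (K : set V) (pK : proper_cone K) (mu : cone_measure ip K).
Let mK : measurable (K : set (borel V)) := closed_measurable_rV (cone_closed pK).

(* The case distinction makes [slice x] a measure for all x, also outside K. *)
Definition slice (x : V) (A : set (borel V)) : \bar R :=
  if `[< K x /\ measurable A >] then (ip x (mu A))%:E else 0%E.

Lemma sliceE x (A : set (borel V)) : K x -> measurable A -> slice x A = (ip x (mu A))%:E.
Proof. by move=> Kx mA; rewrite /slice asboolT. Qed.

Let slice0 x : slice x set0 = 0%E.
Proof. by rewrite /slice cm0 ip0r; case: ifP. Qed.

Let slice_ge0 x A : (0 <= slice x A)%E.
Proof. by rewrite /slice; case: asboolP => // -[Kx mA]; rewrite lee_fin ipC; exact: cm_dual. Qed.

Let slice_additive x : semi_sigma_additive (slice x).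
Proof.
move=> F mF tF mUF; have [Kx|nKx] := pselect (K x); last first.
  rewrite (_ : (fun _ => _) = fun=> 0%E).
    by rewrite /slice asboolF; [exact: cvg_cst|move=> []].
  by apply/funext => k; rewrite big1// => i _; rewrite /slice asboolF// => -[].
rewrite sliceE// (_ : (fun _ => _) = fun k => (ip x (\sum_(0 <= i < k) mu (F i)))%:E); last first.
  by apply/funext => k; rewrite ip_sumr -sumEFin; apply: eq_bigr => i _; rewrite sliceE.
apply: cvg_EFin; first by apply: nearW.
exact: (cvg_comp _ _ (cm_sigma_additive (c := mu) mF tF) (@ip_continuous _ _ ip x _)).
Qed.

HB.instance Definition _ x := isMeasure.Build _ _ _ (slice x)
  (slice0 x) (slice_ge0 x) (@slice_additive x).

Let slice_fin x : fin_num_fun (slice x).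
Proof. by move=> A mA; rewrite /slice; case: ifP. Qed.

HB.instance Definition _ x := Measure_isFinite.Build _ _ _ (slice x) (slice_fin x).

Lemma slice_integral x D (f : borel V -> \bar R) : K x ->
  (\int[fun A : set (borel V) => (ip x (mu A))%:E]_(xi in D) f xi = \int[slice x]_(xi in D) f xi)%E.
Proof. by move=> Kx; apply: eq_integral_set_function => A mA; rewrite sliceE. Qed.

Lemma sliceD x y D (f : borel V -> \bar R) : K x -> K y -> measurable D ->
  measurable_fun D f -> (forall xi, D xi -> (0 <= f xi)%E) ->
  (\int[slice (x + y)]_(xi in D) f xi = \int[slice x]_(xi in D) f xi + \int[slice y]_(xi in D) f xi)%E.
Proof.
move=> Kx Ky mD mf f0; rewrite -ge0_integral_measure_add//.
apply: eq_measure_integral => A mA _.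
by rewrite /measure_add/= /msum !big_ord_recl big_ord0/= !sliceE//; [rewrite ipDl adde0|exact: coneD].
Qed.

Lemma sliceZ (a : R) x D (f : borel V -> \bar R) : 0 <= a -> K x -> measurable D ->
  measurable_fun D f -> (forall xi, D xi -> (0 <= f xi)%E) ->
  (\int[slice (a *: x)]_(xi in D) f xi = a%:E * \int[slice x]_(xi in D) f xi)%E.
Proof.
move=> a0 Kx mD mf f0.
rewrite -(ge0_integral_mscale (slice x) mD (NngNum a0) mf f0).
apply: eq_measure_integral => A mA _.
rewrite /= /mscale sliceE//; last exact: coneZ.
rewrite ipZl EFinM; exact: (congr1 (fun z => (a%:E * z)%E) (esym (sliceE Kx mA))).
Qed.

(** Since [K] generates [V], [I] extends to differences; additivity makes the value independent of
    the chosen decomposition, and the Riesz representation supplies [w]. *)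
Lemma cone_linear_extension (I : V -> R) :
  (forall x y, K x -> K y -> I (x + y) = I x + I y) ->
  (forall (a : R) x, 0 <= a -> K x -> I (a *: x) = a * I x) ->
  exists w, forall x, K x -> I x = ip x w.
Proof.
move=> ID IZ.
have /choice[pq hpq] : forall v, exists xy : V * V, [/\ K xy.1, K xy.2 & v = xy.1 - xy.2].
  by move=> v; have [x [y hxy]] := cone_generating pK v; exists (x, y).
pose L v := I (pq v).1 - I (pq v).2.
have LE x y v : K x -> K y -> v = x - y -> L v = I x - I y.
  move=> Kx Ky vE; have [K1 K2 vE'] := hpq v; apply/eqP.
  rewrite /L subr_eq addrAC eq_sym subr_eq eq_sym -!ID//; apply/eqP; congr I.
  by apply/eqP; rewrite -subr_eq addrAC eq_sym -subr_eq -vE -vE'.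
have lL : scalar L.
  move=> a v w; have [K1 K2 vE] := hpq v; have [K3 K4 wE] := hpq w.
  have [a0|/ltW a0] := leP 0 a.
    rewrite (LE (a *: (pq v).1 + (pq w).1) (a *: (pq v).2 + (pq w).2)).
    - rewrite !ID ?IZ//; [|exact: coneZ|exact: coneZ].
      by rewrite opprD addrACA -mulrBr.
    - by apply: coneD => //; exact: coneZ.
    - by apply: coneD => //; exact: coneZ.
    - by rewrite {1}vE {1}wE scalerBr opprD addrACA.
  have na0 : 0 <= - a by rewrite oppr_ge0.
  rewrite (LE ((- a) *: (pq v).2 + (pq w).1) ((- a) *: (pq v).1 + (pq w).2)).
  - rewrite !ID ?IZ//; [|exact: coneZ|exact: coneZ].
    by rewrite opprD addrACA -mulrBr /L; congr (_ + _); rewrite mulNr -mulrN opprB.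
  - by apply: coneD => //; exact: coneZ.
  - by apply: coneD => //; exact: coneZ.
  - rewrite {1}vE {1}wE opprD addrACA -scalerBr; congr (_ + _).
    by rewrite scaleNr -scalerN opprB.
have [w hw] := riesz ip lL.
exists w => x Kx; rewrite -hw (LE x 0) ?subr0//; last exact: cone0.
have := IZ 0 0 (lexx _) (cone0 pK); rewrite scaler0 mul0r => ->.
by rewrite subr0.
Qed.

Lemma slice_bounded_fin x (f : borel V -> R) : K x -> measurable_fun setT f ->
  (forall xi, K xi -> 0 <= f xi <= 1) ->
  (\int[slice x]_(xi in K) (f xi)%:E = (fine (\int[slice x]_(xi in K) (f xi)%:E))%:E)%E.
Proof.
move=> Kx mf f01; rewrite fineK// ge0_fin_numE; last first.
  by apply: integral_ge0 => xi /f01 /andP[? _]; rewrite lee_fin.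
apply: (@le_lt_trans _ _ (\int[slice x]_(xi in K) 1%E)%E).
  apply: ge0_le_integral => //.
  - by move=> xi /f01 /andP[? _]; rewrite lee_fin.
  - by apply: measurable_funTS; exact/measurable_EFinP.
  - by move=> xi /f01 /andP[_ ?]; rewrite lee_fin.
by rewrite integral_cst// mul1e ltey_eq; apply/orP; left; exact: slice_fin.
Qed.

(** Guarantees that the default value in [cone_integral] is not taken for functions with values in
    [0, 1] on [K]. *)
Lemma exists_cone_integral (f : borel V -> R) : measurable_fun setT f ->
  (forall xi, K xi -> 0 <= f xi <= 1) ->
  exists w, forall x, K x -> (\int[slice x]_(xi in K) (f xi)%:E = (ip x w)%:E)%E.
Proof.
move=> mf f01.
have mf' : measurable_fun (K : set (borel V)) (fun xi => (f xi)%:E).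
  by apply: measurable_funTS; exact/measurable_EFinP.
have f0 xi : K xi -> (0 <= (f xi)%:E)%E by move=> /f01 /andP[? _]; rewrite lee_fin.
have [w hw] : exists w, forall x, K x -> fine (\int[slice x]_(xi in K) (f xi)%:E)%E = ip x w.
  apply: cone_linear_extension => [x y Kx Ky|a x a0 Kx]; apply: EFin_inj.
    rewrite -slice_bounded_fin//; last exact: coneD.
    by rewrite sliceD// EFinD -!slice_bounded_fin.
  rewrite -slice_bounded_fin//; last exact: coneZ.
  by rewrite sliceZ// EFinM -slice_bounded_fin.
by exists w => x Kx; rewrite slice_bounded_fin// hw.
Qed.

End cone_integration.

Lemma expRN_dist (R : realType) (a b : R) : 0 <= a -> 0 <= b ->
  `|expR (- a) - expR (- b)| <= Num.min 1 `|a - b|.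
Proof.
wlog ab : a b / a <= b => [h|] a0 b0.
  have [ab|/ltW ba] := leP a b; first exact: h.
  by rewrite distrC (distrC a); exact: h.
have hab : expR (- b) <= expR (- a) by rewrite ler_expR lerN2.
rewrite ger0_norm ?subr_ge0// distrC ger0_norm ?subr_ge0// le_min; apply/andP; split.
  rewrite lerBlDr (le_trans (_ : _ <= 1))// ?lerDl ?expR_ge0//.
  by rewrite -expR0 ler_expR oppr_le0.
have -> : expR (- b) = expR (- a) * expR (a - b) by rewrite -expRD addrA addNr add0r.
have h1 : 1 + (a - b) <= expR (a - b) by exact: expR_ge1Dx.
have ea : expR (- a) <= 1 by rewrite -expR0 ler_expR oppr_le0.
have ea0 : 0 <= expR (- a) by exact: expR_ge0.
have e1 : expR (a - b) <= 1 by rewrite -expR0 ler_expR subr_le0.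
nra.
Qed.

Section exponential_integrals.
Context (R : realType) (n : nat) (ip : inner_product R n).
Local Notation V := 'rV[R]_n.
Variables (K : set V) (mK : measurable (K : set (borel V))).
Variables (m : {measure set (borel V) -> \bar R}) (m_fin : (m K < +oo)%E).
Local Notation dualK := (dual_cone ip K).
Local Notation e_ v := (fun xi : borel V => expR (- ip v xi)).

Lemma measurable_expip v : measurable_fun setT (e_ v).
Proof.
by apply: measurableT_comp; [exact: measurable_expR|apply: measurable_funN; exact: measurable_ip].
Qed.

Lemma expip01 v xi : dualK v -> K xi -> 0 <= expR (- ip v xi) <= 1.
Proof.
by move=> dv Kxi; rewrite expR_ge0/= -expR0 ler_expR oppr_le0; exact: dv.
Qed.

Lemma bounded_integrable (f : borel V -> R) (M : R) : measurable_fun setT f ->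
  (forall xi, K xi -> `|f xi| <= M) -> m.-integrable K (EFin \o f).
Proof.
move=> mf fM; apply: measurable_bounded_integrable => //.
  exact: measurable_funTS.
by exists M; split; [exact: num_real|move=> M' MM' xi Kxi; exact: le_trans (fM _ Kxi) (ltW MM')].
Qed.

Lemma expip_integrable v : dualK v -> m.-integrable K (EFin \o e_ v).
Proof.
move=> dv; apply: (@bounded_integrable _ 1); first exact: measurable_expip.
by move=> xi Kxi; have /andP[? ?] := expip01 dv Kxi; rewrite ger0_norm.
Qed.

Lemma expip_sum_integral (s : seq (R * V)) : (forall p, p \in s -> dualK p.2) ->
  m.-integrable K (EFin \o (fun xi => \sum_(p <- s) p.1 * expR (- ip p.2 xi))) /\
  \int[m]_(xi in K) (\sum_(p <- s) p.1 * expR (- ip p.2 xi)) =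
  \sum_(p <- s) p.1 * \int[m]_(xi in K) expR (- ip p.2 xi).
Proof.
elim: s => [_|p s IH ds].
  split; last first.
    by rewrite big_nil; under eq_Rintegral do rewrite big_nil; rewrite Rintegral_cst// mul0r.
  rewrite (_ : _ \o _ = cst 0%E); first exact: integrable0.
  by apply/funext => xi /=; rewrite big_nil.
have [|IH1 IH2] := IH; first by move=> q qs; apply: ds; rewrite inE qs orbT.
have ip1 : m.-integrable K (EFin \o (fun xi => p.1 * expR (- ip p.2 xi))).
  rewrite (_ : _ \o _ = fun xi => (p.1%:E * (expR (- ip p.2 xi))%:E)%E)//.
  by apply: integrableZl => //; apply: expip_integrable; apply: ds; rewrite inE eqxx.
split.
  rewrite (_ : _ \o _ = fun xi => ((EFin \o (fun xi : V => (p.1 * expR (- ip p.2 xi))%R)) xi +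
     (EFin \o (fun xi : V => (\sum_(p <- s) p.1 * expR (- ip p.2 xi))%R)) xi)%E).
    exact: integrableD.
  by apply/funext => xi /=; rewrite big_cons EFinD.
under eq_Rintegral do rewrite big_cons.
rewrite RintegralD// IH2 big_cons RintegralZl//.
by apply: expip_integrable; apply: ds; rewrite inE eqxx.
Qed.

Lemma expip_sum_ge0 (s : seq (R * V)) : (forall p, p \in s -> dualK p.2) ->
  (forall xi, K xi -> 0 <= \sum_(p <- s) p.1 * expR (- ip p.2 xi)) ->
  0 <= \sum_(p <- s) p.1 * \int[m]_(xi in K) expR (- ip p.2 xi).
Proof. by move=> ds s0; have [_ <-] := expip_sum_integral ds; exact: Rintegral_ge0. Qed.

(** The difference of the exponentials is at most [min 1 (C d |xi|)], which tends to 0 pointwise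
    with [d] and is dominated by 1. *)
Lemma expip_modulus (e : R) : 0 < e -> exists2 d : R, 0 < d &
  forall v w, dualK v -> dualK w -> `|v - w| <= d ->
  \int[m]_(xi in K) `|expR (- ip v xi) - expR (- ip w xi)| <= e.
Proof.
move=> e0; have [C C0 hC] := ip_bound ip.
pose f (j : nat) (xi : borel V) : R := Num.min 1 (C * j.+1%:R^-1 * `|xi : V|).
have mf j : measurable_fun setT (f j).
  apply: measurable_continuous_rV => xi.
  apply: (@continuous_min R V (cst 1) (fun xi : V => C * j.+1%:R^-1 * `|xi|) xi); first exact: cst_continuous.
  apply: (@continuousM R V (cst (C * j.+1%:R^-1)) (fun xi : V => `|xi|) xi); first exact: cst_continuous.
  exact: norm_continuous.
have f01 j xi : 0 <= f j xi <= 1.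
  by rewrite /f le_min ler01/= ge_min lexx/= !mulr_ge0 ?invr_ge0 ?(ltW C0).
have [_ _] : [/\ m.-integrable K (fun=> 0%E),
    (\int[m]_(xi in K) `|(f j xi)%:E - 0| @[j --> \oo] --> 0)%E &
    (\int[m]_(xi in K) (f j xi)%:E @[j --> \oo] --> \int[m]_(xi in K) 0)%E].
  apply: (@dominated_convergence _ _ _ m K mK (fun j xi => (f j xi)%:E) (fun=> 0%E) (fun=> 1%E)).
  - by move=> j; apply: measurable_funTS; apply/measurable_EFinP.
  - exact: measurable_cst.
  - apply: aeW => xi _; apply: cvg_EFin; first exact: nearW.
    apply: (@squeeze_cvgr _ _ _ _ (fun=> 0) (fun j => C * `|xi : V| * j.+1%:R^-1)).
    + apply: nearW => j; have /andP[-> _] := f01 j xi.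
      by rewrite /= /f ge_min mulrAC lexx orbT.
    + exact: cvg_cst.
    + rewrite -[X in _ --> X](mulr0 (C * `|xi : V|)).
      by apply: cvgM; [exact: cvg_cst|exact: cvg_harmonic].
  - by apply: (@bounded_integrable (cst 1) 1) => // xi _ /=; rewrite normr1.
  - by apply: aeW => xi j _; have /andP[? ?] := f01 j xi; rewrite /= ger0_norm.
rewrite integral0 => h.
have [j hj] : exists j, (\int[m]_(xi in K) (f j xi)%:E < e%:E)%E.
  have : \forall j \near \oo, (\int[m]_(xi in K) (f j xi)%:E < e%:E)%E.
    by have := h [set y | (y < e%:E)%E]; apply; apply: open_ereal_lt'; rewrite lte_fin.
  by case=> j _ /(_ j (leqnn _)); exists j.
exists j.+1%:R^-1; first by rewrite invr_gt0.
move=> v w dv dw vw.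
have fint : m.-integrable K (EFin \o f j).
  by apply: (@bounded_integrable _ 1) => // xi _; have /andP[? ?] := f01 j xi; rewrite ger0_norm.
apply: (@le_trans _ _ (\int[m]_(xi in K) f j xi)).
  apply: le_Rintegral => //.
    apply: (@bounded_integrable _ 1).
      apply: measurableT_comp; first exact: normr_measurable.
      by apply: measurable_funB; exact: measurable_expip.
    move=> xi Kxi; rewrite normr_id; apply: (le_trans (expRN_dist (dv _ Kxi) (dw _ Kxi))).
    by rewrite ge_min lexx.
  move=> xi Kxi; apply: (le_trans (expRN_dist (dv _ Kxi) (dw _ Kxi))).
  rewrite le_min ge_min lexx/= ge_min; apply/orP; right.
  rewrite -ipBl; apply: (le_trans (hC _ _)).
  by rewrite ler_wpM2r// ler_wpM2l// ltW.
rewrite -lee_fin /Rintegral fineK; first exact: ltW.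
by apply: integrable_fin_num.
Qed.

End exponential_integrals.

Lemma linear_norm_le (R : realType) n (f : 'rV[R]_n -> R) : scalar f ->
  forall v, `|f v| <= (\sum_i `|f (delta_mx 0 i)|) * `|v|.
Proof.
move=> lf v.
have f0 : f 0 = 0.
  have := lf 1 0 0; rewrite scaler0 addr0 mul1r => h1.
  by apply: (addrI (f 0)); rewrite -h1 addr0.
have fD y z : f (y + z) = f y + f z by have := lf 1 y z; rewrite scale1r mul1r.
have fZ a y : f (a *: y) = a * f y by have := lf a y 0; rewrite !addr0 f0 addr0.
rewrite mulr_suml {1}(row_sum_delta v) (big_morph f fD f0).
apply: (le_trans (ler_norm_sum _ _ _)); apply: ler_sum => i _.
by rewrite fZ normrM mulrC ler_wpM2l// rV_coord_le.
Qed.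

(** * The drift of the Laplace exponent *)

Section drift.
Context (R : realType) (n : nat) (ip : inner_product R n).
Local Notation V := 'rV[R]_n.
Variables (K : set V) (pK : proper_cone K) (par : affine_params ip K).
Hypotheses (adm : admissible par) (c0 : par_c par = 0) (gamma0 : par_gamma par = 0).
Hypothesis (m_fin : (par_m par K < +oo)%E).
Let mK : measurable (K : set (borel V)) := closed_measurable_rV (cone_closed pK).
Local Notation dualK := (dual_cone ip K).
Local Notation m := (par_m par).
Local Notation mu := (par_mu par).

Definition diffusion_drift (v x : V) : R :=
  ip (par_b par) v - 2^-1 * ip (par_Q par v v) x + ip (par_B par x) v.

Definition jump_rate (x : V) : R := fine (m K) + ip (mu K) x.

Definition jump_part (v : V) : V := cone_integral mu K (fun xi => expR (- ip v xi)).

(** Multiplied by [e_v(x)], it is the integral of [e_v(x + xi)] against [m(dxi) + <mu(dxi), x>], the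
    gain term of the jumps. *)
Definition jump_drift (v x : V) : R :=
  \int[m]_(xi in K) expR (- ip v xi) + ip (jump_part v) x.

(** The generator of the process sends [e_v] to [- drift v x * e_v(x)]. *)
Definition drift (v x : V) : R := Fmap par v + ip (Rmap par v) x.

Lemma jump_partE v x : dualK v -> K x ->
  (\int[slice mu x]_(xi in K) (expR (- ip v xi))%:E)%E = (ip (jump_part v) x)%:E.
Proof.
move=> dv Kx.
have [w hw] := exists_cone_integral pK mu (measurable_expip ip v) (fun xi => expip01 dv (xi := xi)).
have hw' : is_cone_integral mu K (fun xi => expR (- ip v xi)) w.
  by move=> y Ky; rewrite slice_integral// hw.
by rewrite -(slice_integral mu)// (xgetPex 0 (ex_intro _ w hw'))// ipC.
Qed.

Lemma slice_total x : K x -> slice mu x K = (ip (mu K) x)%:E.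
Proof. by move=> Kx; rewrite sliceE// ipC. Qed.

Let slice_lty x : K x -> (slice mu x K < +oo)%E.
Proof. by move=> Kx; rewrite slice_total// ltry. Qed.

Lemma jump_partR v x : dualK v -> K x ->
  \int[slice mu x]_(xi in K) expR (- ip v xi) = ip (jump_part v) x.
Proof. by move=> dv Kx; rewrite /Rintegral jump_partE. Qed.

(** The integrand is nonpositive, hence the integral is found as a difference of two that exist;
    vectors are compared by pairing with [K], which spans [V]. *)
Lemma cone_integral_expM1 v : dualK v ->
  cone_integral mu K (fun xi => expR (- ip v xi) - 1) = jump_part v - mu K.
Proof.
move=> dv.
have h : is_cone_integral mu K (fun xi => expR (- ip v xi) - 1) (jump_part v - mu K).
  move=> x Kx; rewrite slice_integral//.
  have i1 := expip_integrable mK (slice_lty Kx) dv.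
  have i2 : (slice mu x).-integrable K (fun=> 1%E).
    by apply: (@bounded_integrable _ _ _ mK _ (slice_lty Kx) (cst 1) 1) => // xi _ /=; rewrite normr1.
  rewrite (_ : (fun xi => _) = (fun xi => ((EFin \o (fun xi => expR (- ip v xi))) xi - 1%E)%E))//.
  rewrite integralB//=.
  have -> : (\int[slice mu x]_(xi in K) 1 = (ip (mu K) x)%:E)%E.
    by rewrite integral_cst// mul1e; exact: slice_total.
  by rewrite jump_partE// -EFinB -ipBl ipC.
have := xgetPex 0 (ex_intro _ _ h); rewrite -/(cone_integral _ _ _) => h'.
apply: (@ip_eq _ _ ip) => y; have [x1 [x2 [K1 K2 ->]]] := cone_generating pK y.
rewrite !ipBl; congr (_ - _).
  by apply: EFin_inj; rewrite -h'// h.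
by apply: EFin_inj; rewrite -h'// h.
Qed.

(** The [-1] in the two jump integrals collects into the total rate, and what remains is the gain
    term. *)
Lemma driftE v x : dualK v ->
  drift v x = diffusion_drift v x + jump_rate x - jump_drift v x.
Proof.
move=> dv; rewrite /drift /Fmap /Rmap c0 gamma0 !addr0 cone_integral_expM1//.
have i2 : m.-integrable K (EFin \o (fun=> 1)).
  by apply: (@bounded_integrable _ _ _ mK _ m_fin (cst 1) 1) => // xi _ /=; rewrite normr1.
rewrite RintegralB//; last exact: expip_integrable.
rewrite Rintegral_cst// mul1r /diffusion_drift /jump_rate /jump_drift.
rewrite !(ipBl, ipDl, ipNl, ipZl) (adjointP ip (par_B par) x) (ipC _ x).
by ring.
Qed.

Lemma jump_part_ge0 v x : dualK v -> K x -> 0 <= ip (jump_part v) x.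
Proof.
by move=> dv Kx; rewrite -jump_partR//; apply: Rintegral_ge0 => xi _; exact: expR_ge0.
Qed.

Lemma jump_part_le v x : dualK v -> K x -> ip (jump_part v) x <= ip (mu K) x.
Proof.
move=> dv Kx; rewrite -jump_partR// -[leRHS]mul1r.
have -> : ip (mu K) x = fine (slice mu x K) by rewrite slice_total.
rewrite -(Rintegral_cst (slice mu x) mK).
apply: le_Rintegral => //; first exact: (expip_integrable mK (slice_lty Kx)).
  by apply: (@bounded_integrable _ _ _ mK _ (slice_lty Kx) (cst 1) 1) => // xi _ /=; rewrite normr1.
by move=> xi Kxi; have /andP[] := expip01 dv Kxi.
Qed.

Lemma mexp_le v : dualK v -> 0 <= \int[m]_(xi in K) expR (- ip v xi) <= fine (m K).
Proof.
move=> dv; apply/andP; split; first by apply: Rintegral_ge0 => xi _; exact: expR_ge0.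
rewrite -[leRHS]mul1r -(Rintegral_cst m mK).
apply: le_Rintegral => //; first exact: (expip_integrable mK m_fin).
  by apply: (@bounded_integrable _ _ _ mK _ m_fin (cst 1) 1) => // xi _ /=; rewrite normr1.
by move=> xi Kxi; have /andP[] := expip01 dv Kxi.
Qed.

Lemma jump_drift_ge0 v x : dualK v -> K x -> 0 <= jump_drift v x.
Proof.
move=> dv Kx; rewrite addr_ge0// ?jump_part_ge0//.
by have /andP[] := mexp_le dv.
Qed.

Lemma jump_drift_le v x : dualK v -> K x -> jump_drift v x <= jump_rate x.
Proof.
move=> dv Kx; rewrite lerD// ?jump_part_le//.
by have /andP[] := mexp_le dv.
Qed.

(** [jump_drift] integrates against two positive measures, so it preserves nonnegativity of
    exponential sums. This is why dropping the jumps yields a lower bound. *)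
Lemma jump_drift_sum_ge0 x (s : seq (R * V)) : K x -> (forall p, p \in s -> dualK p.2) ->
  (forall xi, K xi -> 0 <= \sum_(p <- s) p.1 * expR (- ip p.2 xi)) ->
  0 <= \sum_(p <- s) p.1 * jump_drift p.2 x.
Proof.
move=> Kx ds s0.
have -> : \sum_(p <- s) p.1 * jump_drift p.2 x =
   \sum_(p <- s) p.1 * \int[m]_(xi in K) expR (- ip p.2 xi) +
   \sum_(p <- s) p.1 * \int[slice mu x]_(xi in K) expR (- ip p.2 xi).
  rewrite -big_split/= big_seq [RHS]big_seq; apply: eq_bigr => p ps.
  by rewrite -mulrDr jump_partR//; exact: ds.
by apply: addr_ge0; apply: expip_sum_ge0 => //; exact: slice_lty.
Qed.

Variable e : V.
Hypotheses (Ke : K e) (he : forall v, K (`|v| *: e + v)).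

(** [|x| e - x] lies in [K], so the slice at [x] is dominated by [|x|] times the slice at [e]. *)
Lemma slice_le x (f : borel V -> \bar R) : K x -> measurable_fun (K : set (borel V)) f ->
  (forall xi, K xi -> (0 <= f xi)%E) ->
  (\int[slice mu x]_(xi in K) f xi <= `|x|%:E * \int[slice mu e]_(xi in K) f xi)%E.
Proof.
move=> Kx mf f0; rewrite -sliceZ//.
have Kx' : K (`|x| *: e - x) by have := he (- x); rewrite normrN.
rewrite -(subrK x (`|x| *: e)) sliceD// leeDr//.
exact: integral_ge0.
Qed.

(** Two moduli suffice for all [x]: one for [m], and one for the slice at [e], which [slice_le]
    scales by [|x|]. *)
Lemma jump_drift_modulus (eps : R) : 0 < eps -> exists2 d : R, 0 < d &
  forall v w x, dualK v -> dualK w -> K x -> `|v - w| <= d ->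
  `|jump_drift v x - jump_drift w x| <= eps * (1 + `|x|).
Proof.
move=> eps0.
have [d1 d10 h1] := expip_modulus ip mK m_fin eps0.
have [d2 d20 h2] := expip_modulus ip mK (slice_lty Ke) eps0.
exists (Num.min d1 d2); first by rewrite lt_min d10.
move=> v w x dv dw Kx; rewrite le_min => /andP[vw1 vw2].
have mb : measurable_fun setT (fun xi : borel V => expR (- ip v xi) - expR (- ip w xi)).
  by apply: measurable_funB; exact: measurable_expip.
have bb xi : K xi -> `|expR (- ip v xi) - expR (- ip w xi)| <= 1.
  move=> Kxi; apply: (le_trans (expRN_dist (dv _ Kxi) (dw _ Kxi))).
  by rewrite ge_min lexx.
have mn : measurable_fun setT (fun xi : borel V => `|expR (- ip v xi) - expR (- ip w xi)|).
  by apply: measurableT_comp => //; exact: normr_measurable.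
have ni y : K y -> (slice mu y).-integrable K
    (EFin \o (fun xi : borel V => `|expR (- ip v xi) - expR (- ip w xi)|)).
  move=> Ky; apply: (@bounded_integrable _ _ _ mK _ (slice_lty Ky) _ 1) => // xi Kxi.
  by rewrite normr_id; exact: bb.
rewrite /jump_drift opprD addrACA -ipBl mulrDr mulr1.
apply: (le_trans (ler_normD _ _)); apply: lerD.
  rewrite -RintegralB//; [|exact: expip_integrable|exact: expip_integrable].
  apply: le_trans (h1 v w dv dw vw1); apply: le_normr_Rintegral => //.
  exact: (@bounded_integrable _ _ _ mK _ m_fin _ 1).
rewrite ipBl -(jump_partR dv Kx) -(jump_partR dw Kx).
rewrite -(RintegralB mK (expip_integrable mK (slice_lty Kx) dv) (expip_integrable mK (slice_lty Kx) dw)).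
apply: (@le_trans _ _ (\int[slice mu x]_(xi in K) `|expR (- ip v xi) - expR (- ip w xi)|)).
  apply: le_normr_Rintegral => //.
  exact: (@bounded_integrable _ _ _ mK _ (slice_lty Kx) _ 1).
apply: (@le_trans _ _ (`|x| * \int[slice mu e]_(xi in K) `|expR (- ip v xi) - expR (- ip w xi)|)).
  rewrite -lee_fin EFinM /Rintegral !fineK; [|exact: integrable_fin_num (ni _ _)..].
  apply: slice_le => //; first by apply: measurable_funTS; exact/measurable_EFinP.
by rewrite mulrC ler_wpM2r//; exact: h2.
Qed.

Lemma Q_bound : exists2 C : R, 0 <= C & forall u v x, `|ip (par_Q par u v) x| <= C * `|u| * `|v| * `|x|.
Proof.
have [c1 c10 hc1] := ip_bound ip.
have lQ u x : scalar (fun v => ip (par_Q par u v) x).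
  by move=> a v w; rewrite (adm_Q_linear adm) ipDl ipZl.
pose S (i j k : 'I_n) : R := `|ip (par_Q par (delta_mx 0 i) (delta_mx 0 j)) (delta_mx 0 k)|.
exists (\sum_k \sum_j \sum_i S i j k).
  by do 3 (apply: sumr_ge0 => ? _); exact: normr_ge0.
move=> u v x.
apply: (le_trans (linear_norm_le (f := ip (par_Q par u v)) (ip_linear ip _) x)).
rewrite ler_wpM2r// !mulr_suml; apply: ler_sum => k _.
apply: (le_trans (linear_norm_le (lQ u _) v)).
rewrite ler_wpM2r// !mulr_suml; apply: ler_sum => j _.
rewrite (adm_QC adm); apply: (le_trans (linear_norm_le (lQ _ _) u)).
rewrite ler_wpM2r//; apply: ler_sum => i _.
by rewrite (adm_QC adm).
Qed.

Lemma B_bound : exists2 C : R, 0 <= C & forall x v, `|ip (par_B par x) v| <= C * `|x| * `|v|.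
Proof.
exists (\sum_i \sum_j `|ip (par_B par (delta_mx 0 j)) (delta_mx 0 i)|).
  by do 2 (apply: sumr_ge0 => ? _); exact: normr_ge0.
move=> x v; apply: (le_trans (linear_norm_le (f := ip (par_B par x)) (ip_linear ip _) v)).
rewrite ler_wpM2r// !mulr_suml; apply: ler_sum => i _.
apply: linear_norm_le (fun y => ip (par_B par y) (delta_mx 0 i)) _ _.
by move=> a y z; rewrite linearP ipDl ipZl.
Qed.

Lemma diffusion_drift_lipschitz (rho : R) : exists2 C : R, 0 <= C &
  forall v w x, `|v| <= rho -> `|w| <= rho ->
  `|diffusion_drift v x - diffusion_drift w x| <= C * `|v - w| * (1 + `|x|).
Proof.
have [C1 C10 hQ] := Q_bound; have [C2 C20 hB] := B_bound; have [C3 C30 hip] := ip_bound ip.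
have rho' : 0 <= `|rho| by [].
exists (C3 * `|par_b par| + C1 * `|rho| + C2).
  by rewrite !addr_ge0// ?mulr_ge0// ltW.
move=> v w x vr wr.
have QE : ip (par_Q par v v) x - ip (par_Q par w w) x = ip (par_Q par (v - w) (v + w)) x.
  have QD u y z : par_Q par u (y + z) = par_Q par u y + par_Q par u z.
    by have := adm_Q_linear adm u 1 y z; rewrite !scale1r.
  have QB u y z : par_Q par u (y - z) = par_Q par u y - par_Q par u z.
    by rewrite -[- z]scaleN1r addrC (adm_Q_linear adm) scaleN1r addrC.
  rewrite QD (adm_QC adm _ v) (adm_QC adm _ w) !QB (adm_QC adm w v).
  by rewrite addrA subrK ipBl.
have -> : diffusion_drift v x - diffusion_drift w x =
    ip (par_b par) (v - w) - 2^-1 * ip (par_Q par (v - w) (v + w)) x + ip (par_B par x) (v - w).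
  rewrite /diffusion_drift -QE (ipBr ip (par_b par)) (ipBr ip (par_B par x)).
  move: (ip (par_b par) v) (ip (par_b par) w).
  move: (ip (par_B par x) v) (ip (par_B par x) w).
  move: (ip (par_Q par v v) x) (ip (par_Q par w w) x) => a b c d f g.
  ring.
have h1 := hip (par_b par) (v - w); have h2 := hQ (v - w) (v + w) x; have h3 := hB x (v - w).
have h4 : `|v + w| <= 2 * `|rho|.
  rewrite (le_trans (ler_normD _ _))// mulr_natl mulr2n lerD//; exact: le_trans (ler_norm _).
have h5 : `|ip (par_Q par (v - w) (v + w)) x| <= C1 * `|v - w| * (2 * `|rho|) * `|x|.
  by apply: (le_trans h2); rewrite ler_wpM2r// ler_wpM2l// mulr_ge0.
apply: (le_trans (ler_normD _ _)); apply: (le_trans (lerD (ler_normB _ _) h3)).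
rewrite normrM ger0_norm ?invr_ge0//.
have : 2^-1 * `|ip (par_Q par (v - w) (v + w)) x| <= C1 * `|v - w| * `|rho| * `|x|.
  by rewrite ler_pdivrMl// mulrC (le_trans h5)// le_eqVlt; apply/orP; left; apply/eqP; ring.
have := normr_ge0 (v - w); have := normr_ge0 x; have := normr_ge0 (par_b par).
move: h1; move: `|v - w| `|x| `|par_b par| `|rho| rho' => a b d r r0 h1 d0 b0 a0 h6.
have : 0 <= C3 * d * a * b by rewrite !mulr_ge0// ltW.
have : 0 <= C1 * a * r by rewrite !mulr_ge0.
have : 0 <= C2 * a by rewrite !mulr_ge0.
by move: h1 h6; lra.
Qed.

Lemma jump_rate_le : exists2 C : R, 0 < C & forall x, K x -> jump_rate x <= C * (1 + `|x|).
Proof.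
have [C1 C10 hip] := ip_bound ip.
exists (fine (m K) + C1 * `|mu K| + 1).
  by rewrite ltr_wpDl// addr_ge0 ?fine_ge0// mulr_ge0// ltW.
move=> x Kx; have h1 := le_trans (ler_norm _) (hip (mu K) x).
have : 0 <= fine (m K) by rewrite fine_ge0.
have := normr_ge0 (mu K); have := normr_ge0 x; rewrite /jump_rate.
by nra.
Qed.

Lemma jump_rate_ge0 x : K x -> 0 <= jump_rate x.
Proof.
by move=> Kx; rewrite addr_ge0 ?fine_ge0//; exact: (cm_dual _ mK).
Qed.

Lemma drift_bound (rho : R) : exists2 C : R, 0 < C &
  forall v x, dualK v -> K x -> `|v| <= rho -> `|drift v x| <= C * (1 + `|x|).
Proof.
have [C1 C10 h1] := diffusion_drift_lipschitz `|rho|; have [C2 C20 h2] := jump_rate_le.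
exists (C1 * `|rho| + C2); first by rewrite ltr_wpDl// mulr_ge0.
move=> v x dv Kx vr; rewrite driftE//.
have vr' : `|v| <= `|rho| by exact: le_trans (ler_norm _).
have := h1 v 0 x vr'; rewrite normr0 subr0 => /(_ (normr_ge0 _)).
have -> : diffusion_drift 0 x = 0.
  rewrite /diffusion_drift !ip0r.
  have [C _ /(_ 0 0 x)] := Q_bound; rewrite normr0 mulr0 mul0r normr_le0 => /eqP ->.
  by rewrite mulr0 subr0 addr0.
rewrite subr0 => h3.
have j0 := jump_drift_ge0 dv Kx; have j1 := jump_drift_le dv Kx.
rewrite -addrA (le_trans (ler_normD _ _))// mulrDl lerD//.
  by apply: (le_trans h3); rewrite ler_wpM2r ?addr_ge0// ler_wpM2l.
by rewrite ger0_norm ?subr_ge0// (le_trans _ (h2 x Kx))// gerBl.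
Qed.

Lemma drift_modulus (rho eps : R) : 0 < eps -> exists2 d : R, 0 < d &
  forall v w x, dualK v -> dualK w -> K x -> `|v| <= rho -> `|w| <= rho -> `|v - w| <= d ->
  `|drift v x - drift w x| <= eps * (1 + `|x|).
Proof.
move=> eps0; have e2 : 0 < eps / 2 by rewrite divr_gt0.
have [C1 C10 h1] := diffusion_drift_lipschitz rho; have [d d0 h2] := jump_drift_modulus e2.
have C11 : 0 < C1 + 1 by rewrite ltr_wpDl.
exists (Num.min d (eps / 2 / (C1 + 1))); first by rewrite lt_min d0 divr_gt0.
move=> v w x dv dw Kx vr wr; rewrite le_min => /andP[vw1]; rewrite ler_pdivlMr// => vw2.
rewrite !driftE//.
have E (a b p q r : R) : a + b - p - (q + b - r) = (a - q) - (p - r) by ring.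
rewrite E.
apply: (le_trans (ler_normB _ _)).
have h3 := h1 v w x vr wr; have h4 := h2 v w x dv dw Kx vw1.
have : C1 * `|v - w| * (1 + `|x|) <= eps / 2 * (1 + `|x|).
  rewrite ler_wpM2r ?addr_ge0//; apply: le_trans vw2.
  by rewrite mulrC ler_wpM2l// lerDl.
by lra.
Qed.

(** The quadratic term enters with a negative sign because [Q(v, v)] is in the dual cone, and so
    does the gain term of the jumps. Only a linear bound remains, which prevents blow-up of the
    Riccati flow. *)
Lemma drift_order_unit v : dualK v ->
  drift v e - drift v 0 <= `|par_B par e| * ip v e + ip (mu K) e.
Proof.
move=> dv; rewrite !driftE// /diffusion_drift /jump_rate /jump_drift !ip0r linear0 ip0l mulr0 subr0 !addr0.
have h1 : 0 <= ip (par_Q par v v) e by exact: (adm_Q_dual adm).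
have h2 : ip (par_B par e) v <= `|par_B par e| * ip v e.
  by have := dv _ (he (- par_B par e)); rewrite normrN ipDr ipZr ipNr subr_ge0 (ipC _ v (par_B par e)).
have h3 := jump_part_ge0 dv Ke.
by lra.
Qed.

End drift.

(** * The Riccati flow *)

Section halfline_derivative.
Context (R : realType).
Implicit Types f g : R -> R.

(* On the half-line the derivative is two-sided at positive times and right-sided at 0. *)
Definition halfline_derivative f g := forall t : R, 0 <= t ->
  h^-1 * (f (t + h) - f t) @[h --> within [set h | 0 <= t + h] ((0 : R)^')] --> g t.

Variables (f g : R -> R) (fg : halfline_derivative f g).

Lemma halfline_derivativeP (t eps : R) : 0 <= t -> 0 < eps -> exists2 d : R, 0 < d &
  forall h, `|h| < d -> h != 0 -> 0 <= t + h -> `|h^-1 * (f (t + h) - f t) - g t| < eps.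
Proof.
move=> t0 e0; have := fg t0 => /cvgrPdist_lt /(_ _ e0).
rewrite /within/= => -[d /= d0 hd].
exists d => // h hd' h0 th; rewrite distrC; apply: hd => //.
by rewrite /= sub0r normrN.
Qed.

Lemma halfline_lipschitz_at (t : R) : 0 <= t -> exists d C : R, [/\ 0 < d, 0 <= C &
  forall h, `|h| < d -> 0 <= t + h -> `|f (t + h) - f t| <= C * `|h|].
Proof.
move=> t0; have [d d0 hd] := halfline_derivativeP t0 ltr01.
have g1 : 0 <= `|g t| + 1 by rewrite addr_ge0.
exists d, (`|g t| + 1); split => //.
move=> h hd' th; have [->|h0] := eqVneq h 0; first by rewrite addr0 subrr normr0 mulr0.
have h1 := hd h hd' h0 th.
have hn : 0 < `|h| by rewrite normr_gt0.
rewrite -ler_pdivrMr// mulrC -normfV -normrM.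
rewrite -(subrK (g t) (h^-1 * _)) (le_trans (ler_normD _ _))// addrC lerD2l.
exact: ltW.
Qed.

Lemma halfline_continuous_at (t eps : R) : 0 <= t -> 0 < eps -> exists2 d : R, 0 < d &
  forall y, `|t - y| < d -> 0 <= y -> `|f t - f y| < eps.
Proof.
move=> t0 e0; have [d [C [d0 C0 hd]]] := halfline_lipschitz_at t0.
have C1 : 0 < C + 1 by rewrite ltr_wpDl.
exists (Num.min d (eps / (C + 1))); first by rewrite lt_min d0 divr_gt0.
move=> y; rewrite lt_min => /andP[yd]; rewrite ltr_pdivlMr// => ye y0.
have := hd (y - t); rewrite (distrC y t) [t + _]addrC subrK => /(_ yd y0) h.
rewrite distrC; apply: (le_lt_trans h); apply: le_lt_trans ye.
by rewrite mulrC ler_wpM2l// lerDl.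
Qed.

Lemma halfline_cvg_right (t : R) : 0 <= t -> f y @[y --> t^'+] --> f t.
Proof.
move=> t0; apply/cvgrPdist_lt => eps e0; have [d d0 hd] := halfline_continuous_at t0 e0.
exists d => //= y yd ty; apply: hd => //; exact: ltW (le_lt_trans t0 ty).
Qed.

Lemma halfline_cvg (t : R) : 0 < t -> {for t, continuous f}.
Proof.
move=> t0; apply/cvgrPdist_lt => eps e0; have [d d0 hd] := halfline_continuous_at (ltW t0) e0.
exists (Num.min d t); first by rewrite /= lt_min d0.
move=> y /=; rewrite lt_min => /andP[yd ty]; apply: hd => //.
by move: ty; rewrite ltr_norml => /andP[_]; rewrite gtrBl => /ltW.
Qed.

Lemma halfline_continuous (s t : R) : 0 <= s -> s < t -> {within `[s, t], continuous f}.
Proof.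
move=> s0 st; apply/continuous_within_itvP => //; split.
- by move=> x; rewrite in_itv/= => /andP[sx _]; apply: halfline_cvg; exact: le_lt_trans sx.
- exact: halfline_cvg_right.
- by apply: cvg_at_left_filter; apply: halfline_cvg; exact: le_lt_trans st.
Qed.

Lemma halfline_is_derive (t : R) : 0 < t -> is_derive t 1 f (g t).
Proof.
move=> t0.
have h : h^-1 *: (f (h *: 1 + t) - f t) @[h --> (0 : R)^'] --> g t.
  apply/cvgrPdist_lt => eps e0.
  have [d d0 hd] := halfline_derivativeP (ltW t0) e0.
  exists (Num.min d t); first by rewrite /= lt_min d0.
  move=> h /=; rewrite sub0r normrN lt_min => /andP[h1 h2] h0.
  rewrite distrC [h *: 1]mulr1 [h + t]addrC; apply: hd => //.
  by move: h2; rewrite ltr_norml => /andP[h2 _]; rewrite -lerBlDl sub0r ltW.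
split; first by apply/cvg_ex; exists (g t).
exact: (cvg_lim _ h).
Qed.

Lemma halfline_mvt (s t : R) : 0 <= s -> s < t ->
  exists c, s < c < t /\ f t - f s = (t - s) * g c.
Proof.
move=> s0 st.
have [|c + ->] := @MVT R f g s t st _ (halfline_continuous s0 st).
  by move=> x; rewrite in_itv/= => /andP[sx _]; apply: halfline_is_derive; exact: le_lt_trans sx.
by rewrite in_itv/= => hc; exists c; rewrite mulrC.
Qed.

(** The function [exp(-a t) f(t) - b t] has nonpositive derivative at positive times; the mean value
    theorem compares it with its value at 0. *)
Lemma halfline_gronwall (a b : R) : 0 <= a -> 0 <= b ->
  (forall t, 0 <= t -> g t <= a * f t + b) ->
  forall t, 0 <= t -> f t <= expR (a * t) * (f 0 + b * t).
Proof.
move=> a0 b0 hg t; rewrite le_eqVlt => /predU1P[<-|t0]; first by rewrite !mulr0 expR0 mul1r addr0.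
pose z : R -> R := (fun s => expR (- a * s)) * f - (fun s => b * s).
pose dz (s : R) : R := expR (- a * s) * (g s - a * f s) - b.
have z_der (s : R) : 0 < s -> is_derive s 1 z (dz s).
  move=> s0; have d1 := halfline_is_derive s0.
  have d2 : is_derive s 1 (fun s => expR (- a * s)) (expR (- a * s) * (- a)).
    apply: (@is_derive1_comp R expR (fun s => - a * s)).
    by apply: is_derive_eq; rewrite [LHS]mulr1.
  apply: is_derive_eq.
  change (expR (- a * s) * g s + f s * (expR (- a * s) * - a) - b * 1 = dz s).
  by rewrite /dz; ring.
have z_cont : {within `[0, t], continuous z}.
  apply/continuous_within_itvP => //.
  have cz x : 0 < x -> {for x, continuous z}.
    by move=> x0; apply/differentiable_continuous/derivable1_diffP; exact: (@ex_derive _ _ _ _ _ _ _ (z_der x x0)).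
  split.
  - by move=> x; rewrite in_itv/= => /andP[x0 _]; exact: cz.
  - have cl (k : R) : (k * y) @[y --> (0 : R)^'+] --> k * 0.
      by apply: cvgM; [exact: cvg_cst|exact: cvg_at_right_filter].
    apply: cvgB; last exact: cl.
    apply: cvgM; last exact: halfline_cvg_right.
    by apply: continuous_cvg; [exact: continuous_expR|exact: cl].
  - by apply: cvg_at_left_filter; exact: cz.
have [|c + hc] := @MVT R z dz 0 t t0 _ z_cont.
  by move=> s; rewrite in_itv/= => /andP[s0 _]; exact: z_der.
rewrite in_itv/= => /andP[c0 ct].
have dz0 : dz c <= 0.
  rewrite subr_le0 (le_trans (_ : _ <= expR (- a * c) * b))//.
    by rewrite ler_wpM2l ?expR_ge0// lerBlDl; apply: hg; exact: ltW.
  by rewrite ler_piMl// -expR0 ler_expR mulNr oppr_le0 mulr_ge0// ltW.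
have : z t <= z 0 by rewrite -subr_le0 hc mulr_le0_ge0// subr0 ltW.
rewrite /z/= !fctE mulr0 expR0 mul1r mulr0 subr0 lerBlDr => h.
have : expR (a * t) * (expR (- a * t) * f t) <= expR (a * t) * (f 0 + b * t).
  by rewrite ler_wpM2l ?expR_ge0.
by rewrite mulrA -expRD mulNr subrr expR0 mul1r.
Qed.

End halfline_derivative.

Lemma affine_bounded_below (R : realType) (a b : R) :
  (forall l : R, 0 <= l -> 0 <= a + l * b) -> 0 <= b.
Proof.
move=> h; rewrite leNgt; apply/negP => b0.
have l0 : 0 <= (`|a| + 1) / - b by apply: divr_ge0; [exact: addr_ge0|rewrite oppr_ge0 ltW].
have := h _ l0.
rewrite invrN mulrN mulNr divfK ?lt_eqF// leNgt => /negP; apply.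
by rewrite opprD addrA subr_lt0 (le_lt_trans _ ltr01)// subr_le0 ler_norm.
Qed.

Section affine_flow.
Context (R : realType) (n : nat) (ip : inner_product R n).
Local Notation V := 'rV[R]_n.
Variables (K : set V) (pK : proper_cone K) (par : affine_params ip K).
Hypotheses (adm : admissible par) (c0 : par_c par = 0) (gamma0 : par_gamma par = 0).
Hypothesis (m_fin : (par_m par K < +oo)%E).
Local Notation dualK := (dual_cone ip K).
Variables (phi : R -> V -> R) (psi : R -> V -> V).
Hypothesis psi_dual : forall t u, 0 <= t -> dualK u -> dualK (psi t u).
Hypothesis flow0 : forall u, dualK u -> phi 0 u = 0 /\ psi 0 u = u.
Hypothesis phi_der : forall (t : R) u, 0 <= t -> dualK u ->
  h^-1 * (phi (t + h) u - phi t u)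
    @[h --> within [set h | 0 <= t + h] ((0 : R)^')] --> Fmap par (psi t u).
Hypothesis psi_der : forall (t : R) u, 0 <= t -> dualK u ->
  h^-1 *: (psi (t + h) u - psi t u)
    @[h --> within [set h | 0 <= t + h] ((0 : R)^')] --> Rmap par (psi t u).

Definition laplace_exponent (t : R) (u x : V) : R := phi t u + ip (psi t u) x.
Local Notation alpha := laplace_exponent.

Lemma laplace_exponent_der u x : dualK u ->
  halfline_derivative (fun t => alpha t u x) (fun t => drift par (psi t u) x).
Proof.
move=> du t t0.
rewrite (_ : (fun h => _) = fun h => h^-1 * (phi (t + h) u - phi t u) +
    ip x (h^-1 *: (psi (t + h) u - psi t u))); last first.
  apply/funext => h; rewrite /alpha ipZr ipBr !(ipC ip x); ring.
rewrite /drift (ipC ip _ x); apply: cvgD; first exact: phi_der.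
exact: (cvg_comp _ _ (psi_der t0 du) (@ip_continuous _ _ ip x _)).
Qed.

Lemma laplace_exponent0 u x : dualK u -> alpha 0 u x = ip u x.
Proof. by move=> du; rewrite /alpha; have [-> ->] := flow0 du; rewrite add0r. Qed.

(** Pairing with a fixed [x] makes the vector flow scalar, which the mean value theorem needs; the
    intermediate time depends on [x]. *)
Lemma laplace_exponent_mvt u x (s t : R) : dualK u -> 0 <= s -> s < t ->
  exists c, s < c < t /\ alpha t u x - alpha s u x = (t - s) * drift par (psi c u) x.
Proof. by move=> du s0 st; exact: (halfline_mvt (@laplace_exponent_der u x du)). Qed.

Lemma psi_ip t u x : ip (psi t u) x = alpha t u x - alpha t u 0.
Proof. by rewrite /alpha ip0r addr0 addrC addKr. Qed.

Variable e : V.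
Hypotheses (Ke : K e) (he : forall v, K (`|v| *: e + v)).

Lemma flow_order_bound u (t : R) : dualK u -> 0 <= t ->
  ip (psi t u) e <= expR (`|par_B par e| * t) * (ip u e + ip (par_mu par K) e * t).
Proof.
move=> du t0.
have hd : halfline_derivative (fun t => ip (psi t u) e) (fun t => drift par (psi t u) e - drift par (psi t u) 0).
  move=> s s0; have h1 := @laplace_exponent_der u e du s s0; have h2 := @laplace_exponent_der u 0 du s s0.
  rewrite (_ : (fun h => _) = (fun h => h^-1 * (alpha (s + h) u e - alpha s u e) - h^-1 * (alpha (s + h) u 0 - alpha s u 0))).
    exact: cvgB.
  by apply/funext => h; rewrite !psi_ip; ring.
have := halfline_gronwall hd (normr_ge0 _) (cm_dual _ (closed_measurable_rV (cone_closed pK)) Ke) _ t0.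
have [_ ->] := flow0 du; apply => s s0.
by apply: drift_order_unit => //; exact: psi_dual.
Qed.

(** The Gronwall bound controls the pairing with the order unit, and this pairing controls the norm
    in the dual cone. *)
Lemma flow_bound (rho T : R) : exists2 rho' : R, 0 < rho' &
  forall u t, dualK u -> `|u| <= rho -> 0 <= t -> t <= T -> `|psi t u| <= rho'.
Proof.
have [C C0 hC] := dual_cone_norm_le ip he; have [C1 C10 hip] := ip_bound ip.
have k0 : 0 <= ip (par_mu par K) e by exact: (cm_dual _ (closed_measurable_rV (cone_closed pK)) Ke).
exists (C * (expR (`|par_B par e| * `|T|) * (C1 * `|rho| * `|e| + ip (par_mu par K) e * `|T|)) + 1).
  by rewrite ltr_wpDl// !mulr_ge0 ?expR_ge0 ?(ltW C0)// addr_ge0// !mulr_ge0// ltW.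
move=> u t du ur t0 tT; have tT' : t <= `|T| by exact: le_trans (ler_norm _).
rewrite (le_trans (hC _ (psi_dual t0 du)))// ler_wpDr// ler_wpM2l ?(ltW C0)//.
apply: (le_trans (flow_order_bound du t0)).
apply: ler_pM; rewrite ?expR_ge0//.
- by rewrite addr_ge0 ?mulr_ge0//; exact: du.
- by rewrite ler_expR ler_wpM2l.
- apply: lerD; last by rewrite ler_wpM2l.
  apply: (le_trans (ler_norm _)); apply: (le_trans (hip _ _)).
  by rewrite ler_wpM2r// ler_wpM2l ?(ltW C10)// (le_trans ur)// ler_norm.
Qed.

(** Scalar increments are bounded along each [x] in [K]. The norm of the increment [d] is recovered
    from two test points of [K], namely [e] and [e + d / |d|]. *)
Lemma flow_lipschitz (rho T : R) : exists2 L : R, 0 < L &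
  forall u s t, dualK u -> `|u| <= rho -> 0 <= s -> s <= t -> t <= T ->
    `|psi t u - psi s u| <= L * (t - s).
Proof.
have [rho' rho'0 hrho] := flow_bound rho T.
have [C C0 hC] := drift_bound pK adm c0 gamma0 m_fin rho'.
have [k k0 hk] := ip_coercive ip.
(* From [(2 + |y|) + (2 + |e|)] with [|y| <= |e| + 1]. *)
exists (C * (5 + 2 * `|e|) / k).
  by rewrite divr_gt0// mulr_gt0// ltr_wpDr// mulr_ge0.
move=> u s t du ur s0; rewrite le_eqVlt => /predU1P[<-|st tT].
  by rewrite !subrr normr0 mulr0.
pose d := psi t u - psi s u; rewrite -/d.
have [->|d0] := eqVneq d 0.
  by rewrite normr0 mulr_ge0 ?subr_ge0 ?(ltW st)// divr_ge0 ?(ltW k0)// mulr_ge0 ?(ltW C0)// addr_ge0// mulr_ge0.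
have dn : 0 < `|d| by rewrite normr_gt0.
have inc x : K x -> `|alpha t u x - alpha s u x| <= (t - s) * (C * (1 + `|x|)).
  move=> Kx; have [c [/andP[sc ct] ->]] := laplace_exponent_mvt x du s0 st.
  have c_ge0 : 0 <= c by exact: le_trans (ltW sc).
  rewrite normrM ger0_norm ?subr_ge0 ?(ltW st)// ler_wpM2l ?subr_ge0 ?(ltW st)//.
  by apply: hC => //; [exact: psi_dual|apply: hrho => //; exact: le_trans (ltW ct) tT].
have dip x : K x -> `|ip d x| <= (t - s) * (C * (2 + `|x|)).
  move=> Kx; have := inc 0 (cone0 pK); rewrite normr0 addr0 => h0; have h1 := inc x Kx.
  have -> : ip d x = (alpha t u x - alpha s u x) - (alpha t u 0 - alpha s u 0).
    by rewrite /d ipBl !psi_ip; ring.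
  apply: (le_trans (ler_normB _ _)); apply: (le_trans (lerD h1 h0)).
  by rewrite le_eqVlt; apply/orP; left; apply/eqP; ring.
pose y := e + `|d|^-1 *: d.
have ny : `|(`|d|^-1 *: d)| = 1 by rewrite normrZ normfV normr_id mulVf// gt_eqF.
have Ky : K y by have := he (`|d|^-1 *: d); rewrite ny scale1r.
have yn : `|y| <= `|e| + 1 by rewrite (le_trans (ler_normD _ _))// ny.
have dd : ip d d = `|d| * (ip d y - ip d e).
  by rewrite /y ipDr addrC addKr ipZr mulrA divff ?mul1r// gt_eqF.
have := hk d; rewrite dd expr2 mulrCA ler_pM2l// => h1.
rewrite mulrAC ler_pdivlMr// mulrC; apply: (le_trans h1).
have h2 := le_trans (ler_norm _) (dip y Ky).
have h3 : - ip d e <= (t - s) * (C * (2 + `|e|)).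
  by apply: le_trans (dip e Ke); rewrite -normrN ler_norm.
apply: (le_trans (lerD h2 h3)).
have h4 : 0 <= (t - s) * C by rewrite mulr_ge0 ?subr_ge0 ?ltW.
have -> : (t - s) * (C * (2 + `|y|)) + (t - s) * (C * (2 + `|e|)) = (t - s) * C * (4 + `|y| + `|e|) by ring.
have -> : C * (5 + 2 * `|e|) * (t - s) = (t - s) * C * (5 + 2 * `|e|) by ring.
by rewrite ler_wpM2l//; move: yn; lra.
Qed.

End affine_flow.

Section laplace.
Context (R : realType) (n : nat) (ip : inner_product R n).
Local Notation V := 'rV[R]_n.
Local Notation E := (one_point_compactification V).
Variables (K : set V) (pK : proper_cone K) (X : markov_process K).
Variables (mK : measurable (Some @` K : set (borel E))) (phi : R -> V -> R) (psi : R -> V -> V).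
Local Notation dualK := (dual_cone ip K).
Local Notation alpha := (laplace_exponent ip phi psi).
Hypothesis laplaceX : forall (t : R) u x, 0 <= t -> dualK u -> K x ->
  (\int[mp_p X t (Some x)]_(xi in Some @` K)
     (oapp (fun y => expR (- ip u y)) 0 xi)%:E)%E
  = (expR (- phi t u - ip (psi t u) x))%:E.

Lemma law_exp (t : R) u x : 0 <= t -> dualK u -> K x ->
  (\int[law mK X t x]_y (expR (- ip u y))%:E)%E = (expR (- alpha t u x))%:E.
Proof.
move=> t0 du Kx; rewrite law_integral; last 2 first.
- by move=> y; rewrite lee_fin expR_ge0.
- by apply/measurable_EFinP; exact: measurable_expip.
rewrite opprD; have <- := laplaceX t0 du Kx; by apply: eq_integral => xi /[!inE] -[z _ <-].
Qed.

Lemma le_law_exp (t : R) (f g : V -> R) x : measurable_fun setT (f : borel V -> R) ->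
  measurable_fun setT (g : borel V -> R) ->
  (forall y, K y -> 0 <= f y <= g y) -> (forall y, 0 <= g y) -> (forall y, 0 <= f y) ->
  (\int[law mK X t x]_y (f y)%:E <= \int[law mK X t x]_y (g y)%:E)%E.
Proof.
move=> mf mg fg g0 f0; apply: ae_ge0_le_integral => //.
- by move=> y _; rewrite lee_fin.
- exact/measurable_EFinP.
- by move=> y _; rewrite lee_fin.
- exact/measurable_EFinP.
exists (~` K); split; [|exact: law_setC|].
  by apply: measurableC; exact: (closed_measurable_rV (cone_closed pK)).
by move=> y /=; apply: contra_not => Ky _; rewrite lee_fin; have /andP[] := fg y Ky.
Qed.

(** A larger exponent gives a smaller exponential on [K], hence a larger Laplace exponent. Dividing
    this inequality at [l x] by [l] as [l] grows leaves the [psi] part. *)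
Lemma psi_mono (t : R) u v : 0 <= t -> dualK u -> dualK v -> dualK (v - u) ->
  dualK (psi t v - psi t u).
Proof.
move=> t0 du dv duv x Kx; rewrite ipBl.
have h y : K y -> alpha t u y <= alpha t v y.
  move=> Ky; rewrite -lerN2 -ler_expR -lee_fin.
  have <- := law_exp t0 du Ky; have <- := law_exp t0 dv Ky.
  apply: le_law_exp; [exact: measurable_expip|exact: measurable_expip|..] => z; rewrite ?expR_ge0//.
  by move=> Kz; rewrite ler_expR lerN2 -subr_ge0 -ipBl; exact: duv.
apply: (@affine_bounded_below _ (phi t v - phi t u)) => l l0.
have := h (l *: x) (coneZ pK l0 Kx); rewrite /laplace_exponent !ipZr -subr_ge0.
by move=> /le_trans; apply; rewrite le_eqVlt; apply/orP; left; apply/eqP; ring.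
Qed.

Lemma laplace_exponent_ge0 (t : R) u x : 0 <= t -> dualK u -> K x -> 0 <= alpha t u x.
Proof.
move=> t0 du Kx; rewrite -oppr_le0 -ler_expR expR0 -lee_fin.
have <- := law_exp t0 du Kx.
apply: le_trans (law_le1 mK X t x).
rewrite -[leRHS]mul1e -integral_cst//=.
apply: (@le_law_exp t _ (cst 1) x); [exact: measurable_expip|exact: measurable_cst|..] => z.
- exact: expip01.
- exact: ler01.
- exact: expR_ge0.
Qed.

(** Laplace transforms are at most 1, so the exponent is nonnegative along each ray of [K], and
    therefore so is its slope. *)
Lemma psi_dual (t : R) u : 0 <= t -> dualK u -> dualK (psi t u).
Proof.
move=> t0 du x Kx; apply: (@affine_bounded_below _ (phi t u)) => l l0.
by have := laplace_exponent_ge0 t0 du (coneZ pK l0 Kx); rewrite /laplace_exponent ipZr.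
Qed.

(** The total mass is the Laplace transform at exponent 0, and the affine formula writes it as an
    exponential. *)
Lemma law_gt0 (t : R) x : 0 <= t -> K x -> (0 < law mK X t x setT)%E.
Proof.
move=> t0 Kx; have := law_exp t0 (@dual_cone0 _ _ ip K) Kx.
under eq_integral do rewrite ip0l oppr0 expR0.
by rewrite integral_cst// mul1e => ->; rewrite lte_fin expR_gt0.
Qed.

End laplace.

Lemma expR_taylor1 (R : realType) (z b : R) : `|z| <= b ->
  `|expR z - 1 - z| <= b ^+ 2 * expR b.
Proof.
move=> zb; have h1 := expR_ge1Dx z.
have h2 : expR z - 1 <= z * expR z.
  have := expR_ge1Dx (- z); rewrite -(ler_pM2l (expR_gt0 z)) -expRD subrr expR0; lra.
have h3 : 1 - expR z <= - z by lra.
have b0 : 0 <= b by exact: le_trans zb.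
have zb' : z <= b by exact: le_trans (ler_norm _) zb.
have zb2 : - b <= z by move: zb; rewrite ler_norml => /andP[].
have eb : expR z <= expR b by rewrite ler_expR.
have eb1 : 1 <= expR b by rewrite -expR0 ler_expR.
have ez := expR_gt0 z.
rewrite ger0_norm; last by lra.
have [z0|z0] := leP 0 z.
  have : z * (z * expR z) <= b * (b * expR b).
    by apply: ler_pM => //; [rewrite mulr_ge0 ?expR_ge0|apply: ler_pM => //; exact: expR_ge0].
  have : z * (expR z - 1) <= z * (z * expR z) by rewrite ler_wpM2l.
  rewrite expr2 -mulrA; lra.
have : (- z) * (1 - expR z) <= (- z) * (- z) by rewrite ler_wpM2l// oppr_ge0 ltW.
have : (- z) * (- z) <= b * b by apply: ler_pM; lra.
have : b * b <= b * b * expR b by rewrite ler_peMr// mulr_ge0.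
rewrite expr2; lra.
Qed.

(** First-order expansion in [h] around [A]. The factor [exp(-A)] stays in the error, since it must
    later absorb the growth of [B1] and [B2] in the space variable. *)
Lemma expR_compare (R : realType) (A h g1 g2 J B1 B2 : R) : 0 <= h ->
  `|g1| <= B1 -> `|g2| <= B1 -> `|g2 - g1 - J| <= B2 ->
  `|expR (- (A + h * g1)) - expR (- (A + h * g2)) - h * (expR (- A) * J)| <=
  h * expR (- A) * (B2 + 2 * h * B1 ^+ 2 * expR (h * B1)).
Proof.
move=> h0 hg1 hg2 hJ.
have E1 g : `|g| <= B1 -> `|expR (- (h * g)) - 1 + h * g| <= (h * B1) ^+ 2 * expR (h * B1).
  move=> hg; rewrite -[X in _ + X]opprK; apply: expR_taylor1.
  by rewrite normrN normrM ger0_norm// ler_wpM2l.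
have -> : expR (- (A + h * g1)) - expR (- (A + h * g2)) - h * (expR (- A) * J) =
   expR (- A) * ((expR (- (h * g1)) - 1 + h * g1) - (expR (- (h * g2)) - 1 + h * g2) + h * (g2 - g1 - J)).
  by rewrite !opprD !expRD; ring.
rewrite normrM (ger0_norm (expR_ge0 _)) [h * expR (- A)]mulrC -[leRHS]mulrA.
rewrite ler_wpM2l ?expR_ge0//.
apply: (le_trans (ler_normD _ _)); rewrite [leRHS]mulrDr [leRHS]addrC lerD//; last first.
  by rewrite normrM ger0_norm// ler_wpM2l.
apply: (le_trans (ler_normB _ _)); apply: (le_trans (lerD (E1 _ hg1) (E1 _ hg2))).
by rewrite le_eqVlt; apply/orP; left; apply/eqP; ring.
Qed.

Lemma expR_dominates_square (R : realType) (c : R) : 0 < c -> exists2 D : R, 0 < D &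
  forall y, 0 <= y -> (1 + y) ^+ 2 <= D * expR (c * y).
Proof.
move=> c0; pose k := Num.min 1 (c / 2); have k0 : 0 < k by rewrite lt_min ltr01 divr_gt0.
exists (k ^+ 2)^-1; first by rewrite invr_gt0 exprn_gt0.
move=> y y0; rewrite mulrC ler_pdivlMr ?exprn_gt0// -exprMn.
have -> : expR (c * y) = expR (c / 2 * y) ^+ 2 by rewrite expr2 -expRD; congr expR; field.
rewrite ler_sqr ?nnegrE ?expR_ge0 ?mulr_ge0 ?addr_ge0 ?(ltW k0)//.
apply: le_trans (expR_ge1Dx _).
have k1 : k <= 1 by rewrite ge_min lexx.
have k2 : k <= c / 2 by rewrite ge_min lexx orbT.
have : k * y <= c / 2 * y by rewrite ler_wpM2r.
lra.
Qed.

Lemma integral_full d (T : measurableType d) (R : realType)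
    (mu : {measure set T -> \bar R}) (K : set T) (f : T -> \bar R) :
  measurable K -> mu (~` K) = 0%E -> measurable_fun setT f -> (forall x, 0 <= f x)%E ->
  (\int[mu]_x f x = \int[mu]_(x in K) f x)%E.
Proof.
move=> mK K0 mf f0; rewrite -[in LHS](setUv K) ge0_integral_setU//=; last 3 first.
- exact: measurableC.
- exact: measurable_funTS.
- exact/disj_setPCl.
rewrite [X in (_ + X)%E](_ : _ = 0%E) ?adde0//.
apply: null_integral_eq0 => //.
- exact: measurableC.
- exact: measurable_funTS.
- apply: subset_measure0 K0; [|exact: measurableC|exact: subIsetl].
  by apply: emeasurable_fun_o_infty; [exact: measurableC|exact: measurable_funTS].
Qed.

(** * Comparison of the two flows *)

(** Since [A >= c y / 2], the factor [exp(-A)] is at most the square of [G = exp(- c y / 4)]. One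
    copy of [G] absorbs the polynomial in [1 + y], the other [exp(h C (1 + y))], as
    [h C <= c / 4]. *)
Lemma short_step_estimate (R : realType) (A y c C D h eps : R) :
  0 <= y -> 0 < C -> 0 < D -> 0 < h -> 0 < eps -> 0 < c ->
  c / 2 * y <= A -> h * C <= c / 4 -> h * (4 * C ^+ 2 * expR (c / 4) * D) <= eps ->
  (1 + y) ^+ 2 <= D * expR (c / 4 * y) ->
  h * expR (- A) * (2 * (eps / (4 * D)) * (1 + y) +
    2 * h * (C * (1 + y)) ^+ 2 * expR (h * (C * (1 + y)))) <= eps * h.
Proof.
move=> y0 C0 D0 h0 eps0 c_gt0 cA hC hF hD.
set N := 1 + y in hD *; have N1 : 1 <= N by rewrite lerDl.
pose G := expR (- (c / 4 * y)); have G0 : 0 < G by exact: expR_gt0.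
have NG : N ^+ 2 * G <= D.
  by rewrite /G expRN ler_pdivrMr ?expR_gt0.
have G1 : G <= 1 by rewrite -expR0 ler_expR oppr_le0 !mulr_ge0// ltW.
have EA : expR (- A) <= G * G.
  by rewrite -expRD ler_expR -opprD lerN2; apply: le_trans cA; rewrite le_eqVlt; apply/orP; left; apply/eqP; field.
have EB : G * expR (h * (C * N)) <= expR (c / 4).
  rewrite -expRD ler_expR addrC lerBlDr.
  have -> : c / 4 + c / 4 * y = c / 4 * N by rewrite /N; ring.
  by rewrite mulrA ler_wpM2r// (le_trans ler01).
have A0 := expR_gt0 (- A).
have N0 : 0 < N by exact: lt_le_trans N1.
have P1 : expR (- A) * N <= D.
  apply: (@le_trans _ _ (G * N ^+ 2)); last by rewrite mulrC.
  apply: ler_pM; [exact: ltW|exact: ltW| |by rewrite expr2 ler_peMr// ltW].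
  by apply: (le_trans EA); rewrite ler_piMr// ltW.
have P2 : expR (- A) * (N ^+ 2 * expR (h * (C * N))) <= D * expR (c / 4).
  apply: (@le_trans _ _ ((G * G) * (N ^+ 2 * expR (h * (C * N))))).
    by rewrite ler_wpM2r// mulr_ge0 ?expR_ge0 ?sqr_ge0.
  have -> : (G * G) * (N ^+ 2 * expR (h * (C * N))) = (N ^+ 2 * G) * (G * expR (h * (C * N))) by ring.
  by apply: ler_pM => //; rewrite mulr_ge0 ?expR_ge0 ?sqr_ge0 ?(ltW G0).
have P3 : expR (- A) * (2 * (eps / (4 * D)) * N) <= eps / 2.
  have -> : eps / 2 = 2 * (eps / (4 * D)) * D by field; rewrite gt_eqF.
  by rewrite mulrCA ler_wpM2l// mulr_ge0// divr_ge0 ?(ltW eps0)// mulr_ge0// ltW.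
have P4 : expR (- A) * (2 * h * (C * N) ^+ 2 * expR (h * (C * N))) <= eps / 2.
  have -> : expR (- A) * (2 * h * (C * N) ^+ 2 * expR (h * (C * N))) =
    2 * h * C ^+ 2 * (expR (- A) * (N ^+ 2 * expR (h * (C * N)))) by ring.
  apply: (@le_trans _ _ (2 * h * C ^+ 2 * (D * expR (c / 4)))).
    by rewrite ler_wpM2l// mulr_ge0 ?sqr_ge0// mulr_ge0// ltW.
  by move: hF; lra.
rewrite -mulrA [eps * h]mulrC ler_pM2l// mulrDr.
by move: P3 P4; lra.
Qed.

Record riccati_flow (R : realType) n (ip : inner_product R n) (K : set 'rV[R]_n)
    (par : affine_params ip K) (phi : R -> 'rV[R]_n -> R) (psi : R -> 'rV[R]_n -> 'rV[R]_n) : Prop :=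
  RiccatiFlow {
  flow_phi_ge0 : forall t u, 0 <= t -> dual_cone ip K u -> 0 <= phi t u ;
  flow_psi_dual : forall t u, 0 <= t -> dual_cone ip K u -> dual_cone ip K (psi t u) ;
  flow_psi_mono : forall t u v, 0 <= t -> dual_cone ip K u -> dual_cone ip K v ->
    dual_cone ip K (v - u) -> dual_cone ip K (psi t v - psi t u) ;
  flow_init : forall u, dual_cone ip K u -> phi 0 u = 0 /\ psi 0 u = u ;
  flow_phi_der : forall (t : R) u, 0 <= t -> dual_cone ip K u ->
    h^-1 * (phi (t + h) u - phi t u)
      @[h --> within [set h | 0 <= t + h] ((0 : R)^')] --> Fmap par (psi t u) ;
  flow_psi_der : forall (t : R) u, 0 <= t -> dual_cone ip K u ->
    h^-1 *: (psi (t + h) u - psi t u)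
      @[h --> within [set h | 0 <= t + h] ((0 : R)^')] --> Rmap par (psi t u) }.

Section two_flows.
Context (R : realType) (n : nat) (ip : inner_product R n).
Local Notation V := 'rV[R]_n.
Variables (K : set V) (pK : proper_cone K) (par par' : affine_params ip K).
Hypotheses (adm : admissible par) (c0 : par_c par = 0) (gamma0 : par_gamma par = 0).
Hypothesis (m_fin : (par_m par K < +oo)%E).
Hypotheses (adm' : admissible par') (c0' : par_c par' = 0) (gamma0' : par_gamma par' = 0).
Hypotheses (hQ' : forall u v, par_Q par' u v = par_Q par u v)
  (hB' : forall x, par_B par' x = par_B par x) (hb' : par_b par' = par_b par).
Hypotheses (m0' : par_m par' K = 0%E) (mu0' : par_mu par' K = 0).
Local Notation dualK := (dual_cone ip K).
Variables (phi phi' : R -> V -> R) (psi psi' : R -> V -> V).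
Hypotheses (fl : riccati_flow par phi psi) (fl' : riccati_flow par' phi' psi').
Local Notation alpha := (laplace_exponent ip phi psi).
Local Notation alpha' := (laplace_exponent ip phi' psi').
Variables (e u0 : V) (c : R).
Hypotheses (Ke : K e) (he : forall v, K (`|v| *: e + v)).
Hypotheses (du0 : dualK u0) (c_gt0 : 0 < c) (hc : forall x, K x -> c * `|x| <= ip u0 x).

Let m_fin' : (par_m par' K < +oo)%E. Proof. by rewrite m0' ltry. Qed.

Lemma drift_no_jump v x : dualK v -> K x -> drift par' v x = diffusion_drift par v x.
Proof.
move=> dv Kx; rewrite driftE//.
have r0 : jump_rate par' x = 0 by rewrite /jump_rate m0' mu0' ip0l addr0.
have j0 := jump_drift_ge0 pK m_fin' dv Kx; have j1 := jump_drift_le pK m_fin' dv Kx.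
rewrite r0 in j1 *; have -> : jump_drift par' v x = 0 by apply/eqP; rewrite eq_le j0 j1.
by rewrite addr0 subr0 /diffusion_drift hQ' hB' hb'.
Qed.

(** At time 0 the flow from [u0] is [u0], with pairing at least [c |x|]; by Lipschitz continuity at
    most half is lost for short times, and monotonicity extends the bound to all exponents above
    [u0]. *)
Lemma decay_time : exists2 t0 : R, 0 < t0 & forall s u x, 0 <= s -> s <= t0 -> dualK u ->
  dualK (u - u0) -> K x -> c / 2 * `|x| <= ip (psi s u) x.
Proof.
have [L L0 hL] := flow_lipschitz pK adm c0 gamma0 m_fin (flow_psi_dual fl) (flow_init fl)
  (flow_phi_der fl) (flow_psi_der fl) Ke he `|u0| 1.
have [C C0 hC] := ip_bound ip.
have CL : 0 < 2 * C * L by rewrite !mulr_gt0.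
exists (Num.min 1 (c / (2 * C * L))); first by rewrite lt_min ltr01 divr_gt0.
move=> s u x s0; rewrite le_min => /andP[s1]; rewrite ler_pdivlMr// => s2 du duu Kx.
apply: (@le_trans _ _ (ip (psi s u0) x)); last first.
  by rewrite -subr_ge0 -ipBl; exact: (flow_psi_mono fl s0 du0 du duu).
have := hL u0 0 s du0 (lexx _) (lexx _) s0 s1; have [_ ->] := flow_init fl du0; rewrite subr0 => h1.
have h2 : `|ip (psi s u0 - u0) x| <= c / 2 * `|x|.
  apply: (le_trans (hC _ _)); rewrite ler_wpM2r//.
  apply: (le_trans (ler_wpM2l (ltW C0) h1)).
  by rewrite ler_pdivlMr//; move: s2; lra.
have h3 := hc Kx; have -> : ip (psi s u0) x = ip u0 x + ip (psi s u0 - u0) x by rewrite -ipDl addrC subrK.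
move: h2; rewrite ler_norml => /andP[h4 _].
have : c * `|x| = c / 2 * `|x| + c / 2 * `|x| by field.
lra.
Qed.

Variable t0 : R.
Hypotheses (t0_gt0 : 0 < t0) (decay : forall s u x, 0 <= s -> s <= t0 -> dualK u ->
  dualK (u - u0) -> K x -> c / 2 * `|x| <= ip (psi s u) x).

(* The exponent of [P'_h (exp(- h kappa) P_s e_u)], with kappa the jump rate of X. *)
Definition killed_exponent (s h : R) (u x : V) : R :=
  phi s u + h * fine (par_m par K) + alpha' h (psi s u + h *: par_mu par K) x.

(** Over a step [h], both exponents move away from [alpha s u x] by [h] times a rate taken at an
    intermediate point. The rates differ by nearly [jump_drift], and decay makes the error uniform
    in [x]. *)
Lemma short_step_exp u (eps : R) : dualK u -> dualK (u - u0) -> 0 < eps ->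
  exists2 h0 : R, 0 < h0 & forall s h x, 0 <= s -> 0 < h -> h <= h0 -> s + h <= t0 -> K x ->
  `|expR (- alpha (s + h) u x) - expR (- killed_exponent s h u x)
    - h * (expR (- alpha s u x) * jump_drift par (psi s u) x)| <= eps * h.
Proof.
move=> du duu eps0.
have muK : dualK (par_mu par K) by exact: (cm_dual _ (closed_measurable_rV (cone_closed pK))).
pose mK := `|par_mu par K|; have mK0 : 0 <= mK by exact: normr_ge0.
have [rho1 rho10 hrho1] := flow_bound pK adm c0 gamma0 m_fin (flow_psi_dual fl) (flow_init fl)
  (flow_phi_der fl) (flow_psi_der fl) Ke he `|u| t0.
have [L1 L10 hL1] := flow_lipschitz pK adm c0 gamma0 m_fin (flow_psi_dual fl) (flow_init fl)
  (flow_phi_der fl) (flow_psi_der fl) Ke he `|u| t0.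
(* The second flow starts at [w = psi s u + h mu(K)], of norm at most [rho1 + mK] when [h <= 1], and
   runs for a time at most 1. *)
have [rho2 rho20 hrho2] := flow_bound pK adm' c0' gamma0' m_fin' (flow_psi_dual fl') (flow_init fl')
  (flow_phi_der fl') (flow_psi_der fl') Ke he (rho1 + mK) 1.
have [L2 L20 hL2] := flow_lipschitz pK adm' c0' gamma0' m_fin' (flow_psi_dual fl') (flow_init fl')
  (flow_phi_der fl') (flow_psi_der fl') Ke he (rho1 + mK) 1.
pose rho := Num.max rho1 rho2.
have [C1 C10 hC1] := drift_bound pK adm c0 gamma0 m_fin rho.
have [C2 C20 hC2] := drift_bound pK adm' c0' gamma0' m_fin' rho.
have [C3 C30 hC3] := jump_rate_le par.
pose C := C1 + C2 + C3; have C0 : 0 < C by rewrite !addr_gt0.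
have c4 : 0 < c / 4 by rewrite divr_gt0.
have [D D0 hD] := expR_dominates_square c4.
pose eps1 := eps / (4 * D); have eps10 : 0 < eps1 by rewrite divr_gt0// mulr_gt0.
have [d1 d10 hd1] := drift_modulus pK adm c0 gamma0 m_fin Ke he rho eps10.
have [d2 d20 hd2] := drift_modulus pK adm' c0' gamma0' m_fin' Ke he rho eps10.
pose F := expR (c / 4); have F0 : 0 < F by exact: expR_gt0.
have L2m : 0 < L2 + mK by rewrite ltr_wpDr.
(* The conditions on [h], in order: bounded starting points, decay beating the exponential error,
   intermediate points within the moduli [d1] and [d2], and a small quadratic error. *)
exists (Num.min (Num.min 1 (c / 4 / C)) (Num.min (Num.min (d1 / L1) (d2 / (L2 + mK)))
   (eps / (4 * C ^+ 2 * F * D)))).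
  rewrite !lt_min ltr01 !divr_gt0//=.
  by rewrite !mulr_gt0// exprn_gt0.
move=> s h x s0 h0; rewrite !le_min => /andP[/andP[h1 hC] /andP[/andP[hd1' hd2'] hF]] sh Kx.
rewrite ler_pdivlMr// in hC; rewrite ler_pdivlMr// in hd1'; rewrite ler_pdivlMr// in hd2'.
rewrite ler_pdivlMr in hF; last by rewrite !mulr_gt0// exprn_gt0.
have st0 : s <= t0 by apply: le_trans sh; rewrite lerDl ltW.
have sh0 : 0 <= s + h by rewrite addr_ge0// ltW.
pose v := psi s u; have dv : dualK v by exact: (flow_psi_dual fl).
have vr1 : `|v| <= rho1 by exact: hrho1.
pose w := v + h *: par_mu par K.
have dw : dualK w by apply: dual_coneD => //; apply: dual_coneZ => //; exact: ltW.
have wv : `|w - v| <= h * mK by rewrite /w addrC addKr normrZ gtr0_norm.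
have wr : `|w| <= rho1 + mK.
  by rewrite (le_trans (ler_normD _ _))// lerD// normrZ gtr0_norm// ler_piMl.
pose N := 1 + `|x|; have N0 : 0 <= N by rewrite addr_ge0.
have vr : `|v| <= rho by rewrite le_max vr1.
have [a [/andP[sa ash] Ea]] : exists a, s < a < s + h /\
    alpha (s + h) u x - alpha s u x = (s + h - s) * drift par (psi a u) x.
  apply: (laplace_exponent_mvt (flow_phi_der fl) (flow_psi_der fl)) => //.
  by rewrite ltrDl.
have [b [/andP[b0 bh] Eb]] : exists b, 0 < b < h /\
    alpha' h w x - alpha' 0 w x = (h - 0) * drift par' (psi' b w) x.
  exact: (laplace_exponent_mvt (flow_phi_der fl') (flow_psi_der fl')).
rewrite (addrC s) addrK in Ea; rewrite subr0 (laplace_exponent0 (flow_init fl'))// in Eb.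
have a0 : 0 <= a by exact: le_trans (ltW sa).
pose g1 := drift par (psi a u) x.
pose g2 := jump_rate par x + drift par' (psi' b w) x.
have va : `|psi a u - v| <= d1.
  apply: (le_trans (hL1 u s a du (lexx _) s0 (ltW sa) (le_trans (ltW ash) sh))).
  apply: le_trans hd1'; rewrite mulrC ler_wpM2r ?(ltW L10)//.
  by rewrite lerBlDl ltW.
have ar : `|psi a u| <= rho.
  by rewrite le_max hrho1//; exact: le_trans (ltW ash) sh.
have b1 : b <= 1 by exact: le_trans (ltW bh) h1.
have vb : `|psi' b w - v| <= d2.
  rewrite -(subrKA w); apply: (le_trans (ler_normD _ _)).
  have := hL2 w 0 b dw wr (lexx _) (ltW b0) b1; have [_ ->] := flow_init fl' dw; rewrite subr0 => hb.
  apply: le_trans hd2'; rewrite mulrDr; apply: lerD => //.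
  by apply: (le_trans hb); rewrite mulrC ler_wpM2r ?(ltW L20)// ltW.
have br : `|psi' b w| <= rho.
  by rewrite le_max (hrho2 w b dw wr (ltW b0) b1) orbT.
have da : dualK (psi a u) by exact: (flow_psi_dual fl).
have db : dualK (psi' b w) by apply: (flow_psi_dual fl') => //; exact: ltW.
have hg1 : `|g1| <= C * N.
  apply: (le_trans (hC1 _ x da Kx ar)); rewrite ler_wpM2r//.
  by rewrite /C -addrA lerDl addr_ge0 ?ltW.
have hg2 : `|g2| <= C * N.
  apply: (le_trans (ler_normD _ _)); have h2 := hC2 _ x db Kx br; have h3 := hC3 x Kx.
  rewrite (ger0_norm (jump_rate_ge0 pK par Kx)).
  apply: (le_trans (lerD h3 h2)); rewrite -mulrDl ler_wpM2r//.
  by rewrite /C [leLHS]addrC -addrA lerDr ltW.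
(* With both drifts evaluated at [v] the left side would be exactly 0, by [driftE] and
   [drift_no_jump]; only the two moduli remain. *)
have hJ : `|g2 - g1 - jump_drift par v x| <= 2 * eps1 * N.
  have i1 := hd1 (psi a u) v x da dv Kx ar vr va.
  have i2 := hd2 (psi' b w) v x db dv Kx br vr vb.
  have -> : g2 - g1 - jump_drift par v x =
     (drift par' (psi' b w) x - drift par' v x) - (drift par (psi a u) x - drift par v x).
    have ev := driftE pK c0 gamma0 m_fin x dv; have ev' := drift_no_jump dv Kx.
    rewrite ev ev' /g1 /g2.
    move: (jump_rate par x) (drift _ _ _) (drift _ _ _) (jump_drift _ _ _) (diffusion_drift _ _ _) => *; ring.
  apply: (le_trans (ler_normB _ _)); apply: (le_trans (lerD i2 i1)).
  by rewrite -/N; lra.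
have E1 : alpha (s + h) u x = alpha s u x + h * g1 by rewrite /g1 -Ea [s + h]addrC [RHS]addrC subrK.
have E2 : killed_exponent s h u x = alpha s u x + h * g2.
  rewrite /killed_exponent -/w -[alpha' h w x](subrK (ip w x)) Eb /g2 /jump_rate /w.
  by rewrite {1}/laplace_exponent -/v ipDl ipZl; ring.
rewrite E1 E2 -/v; apply: (le_trans (expR_compare _ (ltW h0) hg1 hg2 hJ)).
apply: (@short_step_estimate _ _ _ c) => //; last exact: hD.
rewrite /laplace_exponent ler_wpDl//; first exact: (flow_phi_ge0 fl).
exact: decay.
Qed.

Implicit Types s : seq (R * V).

Definition exp_sum s (x : V) : R := \sum_(p <- s) p.1 * expR (- ip p.2 x).

Definition flow_sum (ph : R -> V -> R) (ps : R -> V -> V) (t : R) s (x : V) : R :=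
  \sum_(p <- s) p.1 * expR (- laplace_exponent ip ph ps t p.2 x).

Definition above_u0 s := forall p, p \in s -> dualK p.2 /\ dualK (p.2 - u0).

Lemma short_step_sum s (eps : R) : above_u0 s -> 0 < eps ->
  exists2 h0 : R, 0 < h0 & forall a h x, 0 <= a -> 0 < h -> h <= h0 -> a + h <= t0 -> K x ->
  `|flow_sum phi psi (a + h) s x - \sum_(p <- s) p.1 * expR (- killed_exponent a h p.2 x)
    - h * (\sum_(p <- s) p.1 * expR (- alpha a p.2 x) * jump_drift par (psi a p.2) x)| <= eps * h.
Proof.
elim: s eps => [|p s IH] eps hs eps0.
  exists 1 => // a h x _ h0 _ _ _; rewrite /flow_sum !big_nil mulr0 !subr0 normr0.
  by rewrite mulr_ge0// ltW.
have [dp dpu] := hs p (mem_head _ _).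
have hs' : above_u0 s by move=> q qs; apply: hs; rewrite inE qs orbT.
have e1 : 0 < eps / 2 by rewrite divr_gt0.
have [h1 h10 H1] := IH _ hs' e1.
have p1 : 0 < `|p.1| + 1 by rewrite ltr_wpDl.
have e2 : 0 < eps / 2 / (`|p.1| + 1) by rewrite !divr_gt0.
have [h2 h20 H2] := short_step_exp dp dpu e2.
exists (Num.min h1 h2); first by rewrite lt_min h10.
move=> a h x a0 h0; rewrite le_min => /andP[hh1 hh2] ah Kx.
have {H1} := H1 a h x a0 h0 hh1 ah Kx; have {H2} := H2 a h x a0 h0 hh2 ah Kx.
rewrite /flow_sum !big_cons.
move: (\sum_(p <- s) _) (\sum_(p <- s) _) (\sum_(p <- s) _) => A3 A2 A1.
move: (expR (- alpha (a + h) p.2 x)) (expR (- killed_exponent a h p.2 x)) (expR (- alpha a p.2 x)) => B1 B2 B3.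
move: (jump_drift _ _ _) => J H2 H1.
have -> : p.1 * B1 + A1 - (p.1 * B2 + A2) - h * (p.1 * B3 * J + A3) =
  p.1 * (B1 - B2 - h * (B3 * J)) + (A1 - A2 - h * A3) by ring.
apply: (le_trans (ler_normD _ _)); rewrite [eps]splitr mulrDl lerD//.
rewrite normrM; apply: (@le_trans _ _ ((`|p.1| + 1) * (eps / 2 / (`|p.1| + 1) * h))).
  by apply: ler_pM => //; rewrite lerDl.
by rewrite mulrA mulrCA divff ?mulr1// gt_eqF.
Qed.

Local Notation E := (one_point_compactification V).
Variables (mSK : measurable (Some @` K : set (borel E))) (X X' : markov_process K).
Hypothesis law_expX : forall (t : R) u x, 0 <= t -> dualK u -> K x ->
  (\int[law mSK X t x]_y (expR (- ip u y))%:E)%E = (expR (- alpha t u x))%:E.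
Hypothesis law_expX' : forall (t : R) u x, 0 <= t -> dualK u -> K x ->
  (\int[law mSK X' t x]_y (expR (- ip u y))%:E)%E = (expR (- alpha' t u x))%:E.
Let mK : measurable (K : set (borel V)) := closed_measurable_rV (cone_closed pK).

Lemma law_restrict (Y : markov_process K) (t : R) (x : V) (f : borel V -> \bar R) :
  measurable_fun setT f -> (forall y, 0 <= f y)%E ->
  (\int[law mSK Y t x]_y f y = \int[law mSK Y t x]_(y in K) f y)%E.
Proof.
exact: (integral_full mK (law_setC mSK Y t x)).
Qed.

Lemma law_lty (Y : markov_process K) (t : R) (x : V) : (law mSK Y t x K < +oo)%E.
Proof.
apply: le_lt_trans (ltry 1); apply: le_trans (law_le1 mSK Y t x).
by apply: le_measure; rewrite ?inE.
Qed.

Lemma law_le1K (Y : markov_process K) (t : R) (x : V) : fine (law mSK Y t x K) <= 1.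
Proof.
rewrite -lee_fin fineK; last by rewrite ge0_fin_numE//; exact: law_lty.
by apply: le_trans (law_le1 mSK Y t x); apply: le_measure; rewrite ?inE.
Qed.

Let law_exp_sum_of (Y : markov_process K) ph ps (t : R) s x :
  (forall u, dualK u -> (\int[law mSK Y t x]_y (expR (- ip u y))%:E)%E
     = (expR (- laplace_exponent ip ph ps t u x))%:E) ->
  (forall p, p \in s -> dualK p.2) ->
  \int[law mSK Y t x]_(y in K) exp_sum s y = flow_sum ph ps t s x.
Proof.
move=> lawY ds; have [_ ->] := expip_sum_integral mK (law_lty Y t x) ds.
rewrite /flow_sum big_seq [RHS]big_seq; apply: eq_bigr => p ps_p; congr (_ * _).
rewrite /Rintegral -law_restrict; first by rewrite lawY//; exact: ds.
  by apply/measurable_EFinP; exact: measurable_expip.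
by move=> y; rewrite lee_fin expR_ge0.
Qed.

Lemma law_exp_sum (t : R) s x : 0 <= t -> (forall p, p \in s -> dualK p.2) -> K x ->
  \int[law mSK X t x]_(y in K) exp_sum s y = flow_sum phi psi t s x.
Proof. by move=> t_ge0 ds Kx; apply: law_exp_sum_of => // u du; exact: law_expX. Qed.

Lemma law_exp_sum' (t : R) s x : 0 <= t -> (forall p, p \in s -> dualK p.2) -> K x ->
  \int[law mSK X' t x]_(y in K) exp_sum s y = flow_sum phi' psi' t s x.
Proof. by move=> t_ge0 ds Kx; apply: law_exp_sum_of => // u du; exact: law_expX'. Qed.

Lemma flow_sum_ge0 (t : R) s x : 0 <= t -> (forall p, p \in s -> dualK p.2) ->
  (forall y, K y -> 0 <= exp_sum s y) -> K x -> 0 <= flow_sum phi psi t s x.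
Proof. by move=> t_ge0 ds s0 Kx; rewrite -law_exp_sum//; exact: Rintegral_ge0. Qed.

Lemma flow_sum01' (t : R) s x : 0 <= t -> (forall p, p \in s -> dualK p.2) ->
  (forall y, K y -> 0 <= exp_sum s y <= 1) -> K x -> 0 <= flow_sum phi' psi' t s x <= 1.
Proof.
move=> t_ge0 ds s0 Kx; rewrite -law_exp_sum'//; apply/andP; split.
  by apply: Rintegral_ge0 => y /s0 /andP[].
apply: le_trans (law_le1K X' t x); rewrite -[leRHS]mul1r -(Rintegral_cst (law mSK X' t x) mK).
apply: le_Rintegral => //.
- by have [] := expip_sum_integral mK (law_lty X' t x) ds.
- by apply: (@bounded_integrable _ _ _ mK _ (law_lty X' t x) (cst 1) 1) => // y _ /=; rewrite normr1.
- by move=> y /s0 /andP[].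
Qed.

Lemma short_step s (eps : R) : above_u0 s -> (forall y, K y -> 0 <= exp_sum s y) -> 0 < eps ->
  exists2 h0 : R, 0 < h0 & forall a h x, 0 <= a -> 0 < h -> h <= h0 -> a + h <= t0 -> K x ->
  \sum_(p <- s) p.1 * expR (- killed_exponent a h p.2 x) - eps * h <= flow_sum phi psi (a + h) s x.
Proof.
move=> hs s0 eps0; have [h0 h00 H] := short_step_sum hs eps0.
exists h0 => // a h x a0 h_gt0 hh ah Kx; have := H a h x a0 h_gt0 hh ah Kx.
have ds p : p \in s -> dualK p.2 by move=> /hs[].
have J0 : 0 <= \sum_(p <- s) p.1 * expR (- alpha a p.2 x) * jump_drift par (psi a p.2) x.
  (* At [xi], this weighted sum of exponentials is [P_a g] evaluated at [x + xi], again a point of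
     [K]. *)
  have := @jump_drift_sum_ge0 _ _ ip K pK par m_fin x
     [seq (p.1 * expR (- alpha a p.2 x), psi a p.2) | p <- s] Kx.
  rewrite big_map; apply.
    by move=> _ /mapP[p ps ->]; apply: (flow_psi_dual fl) => //; exact: ds.
  move=> xi Kxi; rewrite big_map.
  have := flow_sum_ge0 a0 ds s0 (coneD pK Kx Kxi).
  rewrite /flow_sum; congr (_ <= _); apply: eq_bigr => p _.
  by rewrite -mulrA -expRD /laplace_exponent ipDr addrA opprD.
rewrite ler_norml => /andP[h1 _].
have : 0 <= h * \sum_(p <- s) p.1 * expR (- alpha a p.2 x) * jump_drift par (psi a p.2) x.
  by rewrite mulr_ge0// ltW.
by move: h1; lra.
Qed.

(** The rate is affine, so [exp(- h kappa)] times an exponential is again one, with exponent shifted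
    by [h mu(K)]. *)
Lemma killed_sumE s (a h : R) x : 0 <= a -> 0 < h -> (forall p, p \in s -> dualK p.2) -> K x ->
  let g y := expR (- (h * jump_rate par y)) * flow_sum phi psi a s y in
  (law mSK X' h x).-integrable K (EFin \o g) /\
  \int[law mSK X' h x]_(y in K) g y = \sum_(p <- s) p.1 * expR (- killed_exponent a h p.2 x).
Proof.
move=> a0 h0 ds Kx g.
pose s' := [seq (p.1 * expR (- (phi a p.2 + h * fine (par_m par K))), psi a p.2 + h *: par_mu par K) | p <- s].
have muK : dualK (par_mu par K) by exact: (cm_dual _ mK).
have ds' p : p \in s' -> dualK p.2.
  move=> /mapP[q qs ->]; apply: dual_coneD; last by apply: dual_coneZ => //; exact: ltW.
  by apply: (flow_psi_dual fl) => //; exact: ds.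
have gE : g = exp_sum s'.
  apply/funext => y; rewrite /g /exp_sum big_map /flow_sum mulr_sumr; apply: eq_bigr => p _ /=.
  rewrite mulrCA -mulrA -!expRD; congr (_ * expR _).
  by rewrite /laplace_exponent /jump_rate ipDl ipZl; ring.
rewrite gE; split; first by have [] := expip_sum_integral mK (law_lty X' h x) ds'.
rewrite law_exp_sum'//; last exact: ltW.
rewrite /flow_sum big_map; apply: eq_bigr => p _ /=.
by rewrite -mulrA -expRD /killed_exponent; congr (_ * expR _); rewrite -opprD.
Qed.

Lemma flow_sum_semigroup s (a h : R) x : 0 <= a -> 0 <= h -> (forall p, p \in s -> dualK p.2) -> K x ->
  (law mSK X' h x).-integrable K (EFin \o flow_sum phi' psi' a s) /\
  \int[law mSK X' h x]_(y in K) flow_sum phi' psi' a s y = flow_sum phi' psi' (a + h) s x.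
Proof.
move=> a0 h0 ds Kx.
pose s' := [seq (p.1 * expR (- phi' a p.2), psi' a p.2) | p <- s].
have ds' p : p \in s' -> dualK p.2.
  by move=> /mapP[q qs ->]; apply: (flow_psi_dual fl') => //; exact: ds.
have gE : flow_sum phi' psi' a s = exp_sum s'.
  apply/funext => y; rewrite /exp_sum big_map; apply: eq_bigr => p _ /=.
  by rewrite -mulrA -expRD /laplace_exponent opprD.
rewrite gE; split; first by have [] := expip_sum_integral mK (law_lty X' h x) ds'.
rewrite law_exp_sum'// /flow_sum big_map big_seq [RHS]big_seq; apply: eq_bigr => p ps /=.
rewrite -mulrA; congr (_ * _); apply: EFin_inj.
have dp := ds p ps.
rewrite -law_expX' ?addr_ge0// addrC law_integral_chapman_kolmogorov//; last first.
  by apply/measurable_EFinP; exact: measurable_expip.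
have m1 : measurable_fun setT (fun y : borel V => (\int[law mSK X' a y]_z (expR (- ip p.2 z))%:E)%E).
  apply: measurable_fun_integral_kernel => //.
    by move=> U mU; exact: measurable_kernel.
  by apply/measurable_EFinP; exact: measurable_expip.
rewrite law_restrict//; last first.
  by move=> y; apply: integral_ge0 => z _; rewrite lee_fin expR_ge0.
transitivity (\int[law mSK X' h x]_(y in K) (expR (- phi' a p.2) * expR (- ip (psi' a p.2) y))%:E)%E.
  under eq_integral do rewrite EFinM.
  rewrite ge0_integralZl//; last by apply/measurable_funTS/measurable_EFinP; exact: measurable_expip.
  rewrite -law_restrict//; last by apply/measurable_EFinP; exact: measurable_expip.
  by rewrite law_expX'//; exact: (flow_psi_dual fl').
apply: eq_integral => y /[!inE] Ky.
by rewrite law_expX'// -expRD /laplace_exponent opprD.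
Qed.

(** A bound linear in [l] controls the slope at [l = 0], which is the first moment. The quadratic
    term has the favourable sign and disappears; the others are linear in the flow. *)
Lemma laplace_exponent_moment : exists2 C2 : R, 0 <= C2 & forall h l x, 0 <= h -> h <= 1 -> 0 <= l -> K x ->
  alpha' h (l *: u0) x <= l * (ip u0 x + C2 * h * (1 + ip u0 x)).
Proof.
have [Cn Cn0 hCn] := dual_cone_norm_le ip he; have [Ci Ci0 hCi] := ip_bound ip.
have [CB CB0 hCB] := B_bound par.
pose M1 := Cn * (expR `|par_B par' e| * ip u0 e).
have ue : 0 <= ip u0 e by exact: du0.
have M10 : 0 <= M1 by rewrite mulr_ge0 ?(ltW Cn0)// mulr_ge0 ?expR_ge0.
pose M2 := Ci * `|par_b par| + CB.
have M20 : 0 <= M2 by rewrite addr_ge0// mulr_ge0// ltW.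
exists (M1 * M2 * (1 + c^-1)).
  by apply: mulr_ge0; [exact: mulr_ge0|apply: addr_ge0 => //; rewrite invr_ge0 ltW].
move=> h l x h0 h1 l0 Kx.
have dlu : dualK (l *: u0) by exact: dual_coneZ.
have ux : 0 <= ip u0 x by exact: du0.
move: h0; rewrite le_eqVlt => /predU1P[<-|h0].
  by rewrite (laplace_exponent0 (flow_init fl'))// ipZl mulr0 mul0r addr0.
have [b [/andP[b0 bh]]] := laplace_exponent_mvt (flow_phi_der fl') (flow_psi_der fl') x dlu (lexx _) h0.
rewrite (laplace_exponent0 (flow_init fl'))// subr0 ipZl => /eqP; rewrite subr_eq => /eqP ->.
have dv : dualK (psi' b (l *: u0)) by apply: (flow_psi_dual fl') => //; exact: ltW.
(* Without jumps the Gronwall bound is homogeneous in the starting exponent, whence the factor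
   [l]. *)
have nv : `|psi' b (l *: u0)| <= l * M1.
  apply: (le_trans (hCn _ dv)); rewrite /M1 mulrCA ler_wpM2l ?(ltW Cn0)//.
  have := flow_order_bound pK adm' c0' gamma0' m_fin' (flow_psi_dual fl') (flow_init fl')
    (flow_phi_der fl') (flow_psi_der fl') Ke he dlu (ltW b0).
  rewrite mu0' ip0l mul0r addr0 ipZl mulrCA => /le_trans; apply.
  by rewrite ler_wpM2l// ler_wpM2r// ler_expR ler_piMr// (le_trans (ltW bh)).
have xu : 1 + `|x| <= (1 + c^-1) * (1 + ip u0 x).
  have : `|x| <= c^-1 * ip u0 x by rewrite -ler_pdivrMl ?invr_gt0// invrK; exact: hc.
  have : 0 < c^-1 by rewrite invr_gt0.
  nra.
have dd : drift par' (psi' b (l *: u0)) x <= l * (M1 * M2 * (1 + `|x|)).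
  rewrite drift_no_jump// /diffusion_drift.
  have q0 : 0 <= ip (par_Q par (psi' b (l *: u0)) (psi' b (l *: u0))) x by exact: (adm_Q_dual adm).
  have i1 := le_trans (ler_norm _) (hCi (par_b par) (psi' b (l *: u0))).
  have i2 := le_trans (ler_norm _) (hCB x (psi' b (l *: u0))).
  have i3 : Ci * `|par_b par| * `|psi' b (l *: u0)| <= Ci * `|par_b par| * (l * M1).
    by rewrite ler_wpM2l// mulr_ge0// ltW.
  have i4 : CB * `|x| * `|psi' b (l *: u0)| <= CB * `|x| * (l * M1).
    by rewrite ler_wpM2l// mulr_ge0.
  have i5 : 0 <= Ci * `|par_b par| * (l * M1) * `|x|.
    by rewrite mulr_ge0// mulr_ge0 ?mulr_ge0// ltW.
  have i6 : 0 <= CB * (l * M1) by rewrite mulr_ge0// mulr_ge0.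
  have -> : l * (M1 * M2 * (1 + `|x|)) = Ci * `|par_b par| * (l * M1) +
    CB * `|x| * (l * M1) + Ci * `|par_b par| * (l * M1) * `|x| + CB * (l * M1).
    by rewrite /M2; ring.
  by move: i1 i2 i3 i4 i5 i6 q0; lra.
rewrite [leRHS]mulrDr [leLHS]addrC lerD2l.
apply: (@le_trans _ _ (h * (l * (M1 * M2 * (1 + `|x|))))).
  by rewrite ler_wpM2l// ltW.
have -> : l * (M1 * M2 * (1 + c^-1) * h * (1 + ip u0 x)) =
  h * (l * (M1 * M2 * ((1 + c^-1) * (1 + ip u0 x)))) by ring.
by rewrite ler_wpM2l ?(ltW h0)// ler_wpM2l// ler_wpM2l// mulr_ge0.
Qed.

(** The integral of [(1 - exp(- l <u0, y>)) / l] is at most [alpha' / l], bounded independently of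
    [l]; [l = 1 / (j + 1)] and monotone convergence reach the moment. *)
Lemma weight_moment : exists2 C2 : R, 0 <= C2 & forall h x, 0 <= h -> h <= 1 -> K x ->
  (\int[law mSK X' h x]_(y in K) (1 + ip u0 y)%:E <= ((1 + C2 * h) * (1 + ip u0 x))%:E)%E.
Proof.
have [C2 C20 hC2] := laplace_exponent_moment; exists C2 => // h x h0 h1 Kx.
have mu0 := measurable_ip ip u0.
have u0K y : K y -> 0 <= ip u0 y by move=> Ky; exact: du0.
(* A rational minorant on [K] of [(1 - exp(- l z)) / l], visibly increasing in [j]; absolute values
   keep the denominator positive off [K]. *)
pose f (j : nat) (y : borel V) : R := `|ip u0 y| / (1 + `|ip u0 y| * j.+1%:R^-1).
pose L := ip u0 x + C2 * h * (1 + ip u0 x).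
have mexp j : measurable_fun setT (fun y : borel V => expR (- ip (j.+1%:R^-1 *: u0) y)).
  exact: measurable_expip.
have fle j y : K y -> f j y <= j.+1%:R * (1 - expR (- ip (j.+1%:R^-1 *: u0) y)).
  move=> Ky; have z0 := u0K y Ky; rewrite /f ger0_norm// ipZl; move: (ip u0 y) z0 => z z0.
  have w0 : 0 <= j.+1%:R^-1 * z by rewrite mulr_ge0// invr_ge0.
  have w1 : 0 < 1 + j.+1%:R^-1 * z by rewrite ltr_pwDl.
  rewrite [z * j.+1%:R^-1]mulrC ler_pdivrMr//.
  have e1 : expR (- (j.+1%:R^-1 * z)) * (1 + j.+1%:R^-1 * z) <= 1.
    by rewrite expRN mulrC ler_pdivrMr ?expR_gt0// mul1r; exact: expR_ge1Dx.
  have -> : j.+1%:R * (1 - expR (- (j.+1%:R^-1 * z))) * (1 + j.+1%:R^-1 * z) =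
    j.+1%:R * (1 + j.+1%:R^-1 * z - expR (- (j.+1%:R^-1 * z)) * (1 + j.+1%:R^-1 * z)) by ring.
  have {1}-> : z = j.+1%:R * (j.+1%:R^-1 * z) by rewrite mulrA divff ?mul1r.
  have P (p q : R) : q <= 1 -> p <= 1 + p - q by lra.
  by rewrite ler_wpM2l//; exact: P.
have f0 j y : K y -> 0 <= f j y.
  by move=> _; rewrite divr_ge0// addr_ge0// mulr_ge0// invr_ge0.
have mf j : measurable_fun (K : set (borel V)) (fun y => (f j y)%:E).
  apply: measurable_funTS; apply/measurable_EFinP; apply: measurable_continuous_rV => y.
  have cn : {for y, continuous (fun y : V => `|ip u0 y|)}.
    apply: (@continuous_comp V R R (ip u0) (fun t : R => `|t|)); first exact: ip_continuous.
    exact: norm_continuous.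
  apply: (@continuousM R V (fun y : V => `|ip u0 y|) (fun y : V => (1 + `|ip u0 y| * j.+1%:R^-1)^-1) y) => //.
  apply: (@continuousV R V (fun y : V => 1 + `|ip u0 y| * j.+1%:R^-1) y).
    by rewrite gt_eqF// ltr_pwDl// mulr_ge0// invr_ge0.
  apply: (@continuousD R R V (cst 1) (fun y : V => `|ip u0 y| * j.+1%:R^-1) y); first exact: cst_continuous.
  by apply: (@continuousM R V (fun y : V => `|ip u0 y|) (cst j.+1%:R^-1) y) => //; exact: cst_continuous.
have int_f j : (\int[law mSK X' h x]_(y in K) (f j y)%:E <= L%:E)%E.
  have dj : dualK (j.+1%:R^-1 *: u0) by apply: dual_coneZ => //; rewrite invr_ge0.
  apply: (@le_trans _ _ (\int[law mSK X' h x]_(y in K) (j.+1%:R * (1 - expR (- ip (j.+1%:R^-1 *: u0) y)))%:E)%E).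
    apply: ge0_le_integral => //.
    - by move=> y Ky; rewrite lee_fin f0.
    - apply: measurable_funTS; apply/measurable_EFinP.
      by apply: measurable_funM => //; apply: measurable_funB.
    - by move=> y Ky; rewrite lee_fin; exact: fle.
  have i1 : (law mSK X' h x).-integrable K (EFin \o cst (1 : R)).
    by apply: (@bounded_integrable _ _ _ mK _ (law_lty X' h x) (cst 1) 1) => // y _ /=; rewrite normr1.
  have i2 := expip_integrable mK (law_lty X' h x) dj.
  have i3 : (law mSK X' h x).-integrable K (EFin \o (fun y : borel V => 1 - expR (- ip (j.+1%:R^-1 *: u0) y))).
    exact: (integrableB mK i1 i2).
  have i4 : (law mSK X' h x).-integrable K (EFin \o (fun y : borel V => j.+1%:R * (1 - expR (- ip (j.+1%:R^-1 *: u0) y)))).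
    exact: (integrableZl mK j.+1%:R i3).
  rewrite -[leLHS]fineK; last exact: integrable_fin_num i4.
  rewrite lee_fin -/(Rintegral _ _ _) RintegralZl// RintegralB// Rintegral_cst// mul1r.
  have -> : \int[law mSK X' h x]_(y in K) expR (- ip (j.+1%:R^-1 *: u0) y) = expR (- alpha' h (j.+1%:R^-1 *: u0) x).
    rewrite /Rintegral -law_restrict; first by rewrite law_expX'.
      by apply/measurable_EFinP; exact: measurable_expip.
    by move=> y; rewrite lee_fin expR_ge0.
  have j0 : 0 <= j.+1%:R^-1 :> R by rewrite invr_ge0.
  have := hC2 h _ x h0 h1 j0 Kx; rewrite -/L -ler_pdivrMl ?invr_gt0// invrK.
  apply: le_trans; rewrite ler_wpM2l//.
  have := expR_ge1Dx (- alpha' h (j.+1%:R^-1 *: u0) x); have := law_le1K X' h x; lra.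
have cf y : K y -> (f j y)%:E @[j --> \oo] --> (ip u0 y)%:E.
  move=> Ky; apply: cvg_EFin; first exact: nearW.
  rewrite /f/= /comp/= ger0_norm ?u0K//.
  have E1 : ip u0 y = ip u0 y / (1 + ip u0 y * 0) by rewrite mulr0 addr0 divr1.
  rewrite [X in _ --> X]E1; apply: cvgM; first exact: cvg_cst.
  apply: cvgV; first by rewrite mulr0 addr0 oner_neq0.
  apply: cvgD; first exact: cvg_cst.
  by apply: cvgM; [exact: cvg_cst|exact: cvg_harmonic].
have ndf y : K y -> {homo (fun j => (f j y)%:E) : i j / (i <= j)%N >-> (i <= j)%E}.
  move=> /u0K z0 i j ij; rewrite lee_fin /f ler_wpM2l//.
  have pos k : 0 < 1 + `|ip u0 y| * k.+1%:R^-1 by rewrite ltr_pwDl// divr_ge0.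
  by rewrite lef_pV2 ?posrE// lerD2l ler_wpM2l// lef_pV2 ?posrE// ler_nat.
have lim_f : (\int[law mSK X' h x]_(y in K) (ip u0 y)%:E <= L%:E)%E.
  have := @cvg_monotone_convergence _ _ _ (law mSK X' h x) K mK (fun j y => (f j y)%:E) mf
    (fun j y Ky => f0 j y Ky) ndf.
  have -> : (\int[law mSK X' h x]_(y in K) limn (fun j => (f j y)%:E) =
    \int[law mSK X' h x]_(y in K) (ip u0 y)%:E)%E.
    by apply: eq_integral => y /[!inE] Ky; apply: cvg_lim => //; exact: cf.
  by apply: cvge_le; apply: nearW => j; exact: int_f.
under eq_integral do rewrite EFinD.
rewrite ge0_integralD//; last by apply: measurable_funTS; apply/measurable_EFinP.
rewrite integral_cst// mul1e.
have -> : (1 + C2 * h) * (1 + ip u0 x) = 1 + L by rewrite /L; ring.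
rewrite EFinD leeD//; apply: le_trans (law_le1 mSK X' h x).
by apply: le_measure; rewrite ?inE.
Qed.

Lemma weight_ge1 y : K y -> 1 <= 1 + ip u0 y.
Proof. by move=> Ky; rewrite lerDl; exact: du0. Qed.

(** A discrete form of the tangent-line bound. Each killing step costs at most [h C1] times the
    weight [1 + ip u0 y], whose mean grows by a factor at most [1 + C2 h] per step. *)
Lemma iterated_lower_bound : exists C1 C2 : R, [/\ 0 <= C1, 0 <= C2 &
  forall s (eps : R), above_u0 s -> (forall y, K y -> 0 <= exp_sum s y <= 1) -> 0 < eps ->
  exists2 h0 : R, 0 < h0 &
  forall (N : nat) h x r, 0 < h -> h <= h0 -> N%:R * h <= t0 -> K x ->
  expR (- r) * ((1 + r) * flow_sum phi' psi' (N%:R * h) s x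
     - N%:R * h * C1 * (1 + C2 * h) ^+ N * (1 + ip u0 x)) - N%:R * h * eps
  <= flow_sum phi psi (N%:R * h) s x].
Proof.
have [C3 C30 hC3] := jump_rate_le par.
have [C2 C20 hC2] := weight_moment.
pose C1 := C3 * (1 + c^-1).
have C10 : 0 <= C1 by rewrite mulr_ge0 ?(ltW C30)// addr_ge0// invr_ge0 ltW.
have rateW y : K y -> jump_rate par y <= C1 * (1 + ip u0 y).
  move=> Ky; apply: (le_trans (hC3 y Ky)); rewrite /C1 -mulrA ler_wpM2l ?(ltW C30)//.
  have : `|y| <= c^-1 * ip u0 y by rewrite -ler_pdivrMl ?invr_gt0// invrK; exact: hc.
  have : 0 < c^-1 by rewrite invr_gt0.
  have := du0 Ky; nra.
exists C1, C2; split => // s eps hs s01 eps0.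
(* The induction runs over all r: the factor exp(- h kappa(y)) turns the bound at r - h kappa(y)
   into one at r. *)
have ds p : p \in s -> dualK p.2 by move=> /hs[].
have [h1 h10 hstep] := short_step hs (fun y Ky => (andP (s01 y Ky)).1) eps0.
exists (Num.min 1 h1); first by rewrite lt_min ltr01.
move=> N h x r h0; rewrite le_min => /andP[hle1 hh1].
elim: N x r => [|N IH] x r Nh Kx.
  (* For [N = 0] the claim reduces to [exp(-r) * (1 + r) <= 1]. *)
  rewrite !mul0r !subr0 /flow_sum.
  have E1 : \sum_(p <- s) p.1 * expR (- alpha' 0 p.2 x) = exp_sum s x.
    rewrite /exp_sum big_seq [RHS]big_seq; apply: eq_bigr => p ps.
    by rewrite (laplace_exponent0 (flow_init fl'))//; exact: ds.
  have E2 : \sum_(p <- s) p.1 * expR (- alpha 0 p.2 x) = exp_sum s x.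
    rewrite /exp_sum big_seq [RHS]big_seq; apply: eq_bigr => p ps.
    by rewrite (laplace_exponent0 (flow_init fl))//; exact: ds.
  rewrite E1 E2 mulrA ler_piMl//; first by have /andP[] := s01 x Kx.
  by rewrite expRN mulrC ler_pdivrMr ?expR_gt0// mul1r; exact: expR_ge1Dx.
have NSE : N.+1%:R * h = N%:R * h + h by rewrite -natr1 mulrDl mul1r.
rewrite NSE in Nh *.
have Nh0 : 0 <= N%:R * h by rewrite mulr_ge0// ltW.
have Nht : N%:R * h <= t0 by apply: le_trans Nh; rewrite lerDl ltW.
have := hstep (N%:R * h) h x Nh0 h0 hh1 Nh Kx.
have [ig <-] := killed_sumE Nh0 h0 ds Kx.
have [if' E'] := flow_sum_semigroup Nh0 (ltW h0) ds Kx.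
apply: le_trans.
pose a := N%:R * h * C1 * (1 + C2 * h) ^+ N.
have C2h : 1 <= 1 + C2 * h by rewrite lerDl mulr_ge0// ltW.
have a0 : 0 <= a by apply: mulr_ge0; [exact: mulr_ge0|apply: exprn_ge0; exact: le_trans ler01 C2h].
have iW : (law mSK X' h x).-integrable K (EFin \o (fun y : borel V => 1 + ip u0 y)).
  apply/integrableP; split.
    apply: measurable_funTS; apply/measurable_EFinP; apply: measurable_funD => //.
    exact: measurable_ip.
  apply: le_lt_trans (ltry ((1 + C2 * h) * (1 + ip u0 x))).
  apply: le_trans (hC2 h x (ltW h0) hle1 Kx).
  rewrite le_eqVlt; apply/orP; left; apply/eqP; apply: eq_integral => y /[!inE] Ky.
  by rewrite gee0_abs// lee_fin (le_trans ler01)// weight_ge1.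
have WR : \int[law mSK X' h x]_(y in K) (1 + ip u0 y) <= (1 + C2 * h) * (1 + ip u0 x).
  rewrite -lee_fin /Rintegral fineK; first exact: hC2 (ltW h0) hle1 Kx.
  exact: integrable_fin_num iW.
pose F (y : borel V) : R := expR (- r) * ((1 + r) * flow_sum phi' psi' (N%:R * h) s y
   - (h * C1 + a) * (1 + ip u0 y)) - N%:R * h * eps.
have F1 : (law mSK X' h x).-integrable K (EFin \o (fun y : borel V => (1 + r) * flow_sum phi' psi' (N%:R * h) s y)).
  exact: (integrableZl mK (1 + r) if').
have F2 : (law mSK X' h x).-integrable K (EFin \o (fun y : borel V => (h * C1 + a) * (1 + ip u0 y))).
  exact: (integrableZl mK (h * C1 + a) iW).
have F3 : (law mSK X' h x).-integrable K (EFin \o (fun y : borel V => (1 + r) * flow_sum phi' psi' (N%:R * h) s y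
   - (h * C1 + a) * (1 + ip u0 y))).
  exact: (integrableB mK F1 F2).
have F4 : (law mSK X' h x).-integrable K (EFin \o (fun y : borel V => expR (- r) * ((1 + r) * flow_sum phi' psi' (N%:R * h) s y
   - (h * C1 + a) * (1 + ip u0 y)))).
  exact: (integrableZl mK (expR (- r)) F3).
have F5 : (law mSK X' h x).-integrable K (EFin \o cst (N%:R * h * eps)).
  by apply: (@bounded_integrable _ _ _ mK _ (law_lty X' h x) (cst (N%:R * h * eps)) `|N%:R * h * eps|).
have FE : \int[law mSK X' h x]_(y in K) F y = expR (- r) * ((1 + r) * flow_sum phi' psi' (N%:R * h + h) s x
   - (h * C1 + a) * \int[law mSK X' h x]_(y in K) (1 + ip u0 y)) - N%:R * h * eps * fine (law mSK X' h x K).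
  rewrite (RintegralB mK F4 F5) (RintegralZl _ mK F3) (RintegralB mK F1 F2).
  by rewrite (RintegralZl _ mK if') (RintegralZl _ mK iW) E' Rintegral_cst.
have iF : (law mSK X' h x).-integrable K (EFin \o F).
  exact: (integrableB mK F4 F5).
have Fle : \int[law mSK X' h x]_(y in K) F y <=
  \int[law mSK X' h x]_(y in K) (expR (- (h * jump_rate par y)) * flow_sum phi psi (N%:R * h) s y).
  apply: le_Rintegral => // y Ky.
  have k0 := jump_rate_ge0 pK par Ky; have k1 := rateW y Ky.
  have W1 := weight_ge1 Ky.
  have := IH y (r - h * jump_rate par y) Nht Ky; rewrite -/a.
  have /andP[f0 f1] := flow_sum01' Nh0 ds s01 Ky.
  rewrite /F; set G := flow_sum phi psi _ s y; set G' := flow_sum phi' psi' _ s y in f0 f1 *.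
  set k := jump_rate par y in k0 k1 *; set W := 1 + ip u0 y in W1 k1 *.
  have ek0 : 0 <= expR (- (h * k)) by exact: expR_ge0.
  move=> /(ler_wpM2l ek0); apply: le_trans.
  rewrite [leRHS]mulrBr [X in _ <= X - _]mulrA -expRD opprB addrA addNr add0r.
  have ek1 : expR (- (h * k)) <= 1 by rewrite -expR0 ler_expR oppr_le0 mulr_ge0// ltW.
  apply: lerB.
    rewrite ler_wpM2l ?expR_ge0//.
    (* Here [g <= 1] enters: lowering [r] by [h k] loses at most [h k], itself bounded by the affine
       weight. *)
    have : h * k * G' <= h * k * 1 by rewrite ler_wpM2l// mulr_ge0// ltW.
    have : h * k <= h * (C1 * W) by rewrite ler_wpM2l// ltW.
    nra.
  by rewrite ler_piMl// !mulr_ge0// ltW.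
apply: le_trans (lerB Fle (lexx (eps * h))).
rewrite FE.
have m1 := law_le1K X' h x.
have er := expR_gt0 (- r).
have W1 := weight_ge1 Kx; have W0 : 0 <= 1 + ip u0 x by exact: le_trans W1.
have hC10 : 0 <= h * C1 by apply: mulr_ge0; [exact: ltW|exact: C10].
have C2N : 1 <= (1 + C2 * h) ^+ N.+1 by rewrite exprn_ege1// C2h.
have aE : (h * C1 + a) * (1 + C2 * h) <= (N%:R * h + h) * C1 * (1 + C2 * h) ^+ N.+1.
  have -> : (N%:R * h + h) * C1 * (1 + C2 * h) ^+ N.+1 = h * C1 * (1 + C2 * h) ^+ N.+1 + a * (1 + C2 * h).
    by rewrite /a exprSr; ring.
  rewrite [leLHS]mulrDl lerD2r; apply: ler_wpM2l => //.
  by rewrite exprS ler_peMr ?exprn_ege1// (le_trans ler01).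
have ha0 : 0 <= h * C1 + a by exact: addr_ge0.
rewrite -addrA -opprD; apply: lerB.
  rewrite ler_wpM2l ?(ltW er)// lerB//.
  apply: (le_trans (ler_wpM2l ha0 WR)); rewrite mulrA.
  exact: ler_wpM2r.
rewrite mulrDl [h * eps]mulrC lerD2r ler_piMr// mulr_ge0 ?(ltW eps0)//.
Qed.

(** Take [h = t0 / N] with [N] large. The factor [(1 + C2 t0 / N) ^ N] stays below [exp(C2 t0)], and
    the accumulated error is [t0 * (eps / t0)] with [eps] arbitrary. *)
Lemma lower_bound_t0 : exists C1 C2 : R, [/\ 0 <= C1, 0 <= C2 & forall s x r, above_u0 s ->
  (forall y, K y -> 0 <= exp_sum s y <= 1) -> K x ->
  expR (- r) * ((1 + r) * flow_sum phi' psi' t0 s x - t0 * C1 * expR (C2 * t0) * (1 + ip u0 x))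
    <= flow_sum phi psi t0 s x].
Proof.
have [C1 [C2 [C10 C20 H]]] := iterated_lower_bound; exists C1, C2; split=> // s x r hs s01 Kx.
apply/ler_addgt0Pr => eps eps0.
have e0 : 0 < eps / t0 by rewrite divr_gt0.
have [h0 h00 {}H] := H s (eps / t0) hs s01 e0.
pose N := (Num.truncn (t0 / h0)).+1.
have N0 : 0 < N%:R :> R by [].
have Nt : N%:R * (t0 / N%:R) = t0 by rewrite mulrC divfK// gt_eqF.
have hh : t0 / N%:R <= h0.
  rewrite ler_pdivrMr// mulrC -ler_pdivrMr//; apply: ltW; exact: truncnS_gt.
have h1 : 0 < t0 / N%:R by rewrite divr_gt0.
have := H N (t0 / N%:R) x r h1 hh; rewrite Nt => /(_ (lexx _) Kx).
rewrite [t0 * (eps / t0)]mulrC divfK ?gt_eqF// lerBlDr; apply: le_trans.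
apply: ler_wpM2l; first exact: expR_ge0.
rewrite lerD2l lerN2; apply: ler_wpM2r; first by rewrite (le_trans ler01)// weight_ge1.
apply: ler_wpM2l; first by apply: mulr_ge0 => //; exact: ltW.
have -> : C2 * t0 = N%:R * (C2 * (t0 / N%:R)) by rewrite mulrCA Nt.
rewrite expRM_natl; apply: lerXn2r; rewrite ?nnegrE ?expR_ge0//; last exact: expR_ge1Dx.
by apply: addr_ge0 => //; apply: mulr_ge0 => //; exact: ltW.
Qed.

End two_flows.

(** * Exponential sums approximate Borel sets *)

Lemma bernoulli_le (R : realType) (t : R) (M : nat) : 0 <= t -> t <= 1 ->
  1 - M%:R * t <= (1 - t) ^+ M.
Proof.
move=> t0 t1; elim: M => [|M IH]; first by rewrite mul0r subr0.
have M0 : 0 <= M%:R :> R by [].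
have h : (1 - t) * (1 - M%:R * t) <= (1 - t) * (1 - t) ^+ M by rewrite ler_wpM2l// subr_ge0.
rewrite exprS; apply: le_trans h; rewrite -natr1.
have -> : (1 - t) * (1 - M%:R * t) = 1 - (M%:R + 1) * t + M%:R * t * t by ring.
by rewrite lerDl; apply: mulr_ge0 => //; exact: mulr_ge0.
Qed.

Lemma cvg_natmul_expr (R : realType) (z : R) : 0 <= z -> z < 1 ->
  N%:R * z ^+ N @[N --> \oo] --> (0 : R).
Proof.
rewrite le_eqVlt => /predU1P[<- _|z0 z1].
  apply: cvg_near_cst; apply: nearW => -[|N]; first by rewrite mul0r.
  by rewrite exprS mul0r mulr0.
(* [w = z (1 + h)] is halfway between [z] and 1; [N h <= (1 + h) ^ N] trades the factor [N] for the
   larger ratio. *)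
pose w := (1 + z) / 2; pose h := w / z - 1.
have w0 : 0 < w by rewrite /w; lra.
have w1 : w < 1 by rewrite /w; lra.
have h0 : 0 < h by rewrite subr_gt0 ltr_pdivlMr// mul1r /w; lra.
apply: (@squeeze_cvgr _ _ _ _ (fun=> 0) (fun N => h^-1 * w ^+ N)).
- apply: nearW => N; rewrite mulr_ge0 ?exprn_ge0 ?(ltW z0)//=.
  rewrite mulrC ler_pdivlMl// mulrCA.
  have {1}-> : w = z * (1 + h) by rewrite /h addrC subrK mulrC divfK// gt_eqF.
  rewrite exprMn ler_wpM2l ?exprn_ge0 ?(ltW z0)//.
  have : forall M : nat, M%:R * h <= (1 + h) ^+ M.
    elim=> [|M IH]; first by rewrite mul0r expr0.
    rewrite exprS -natr1 mulrDl mul1r [leRHS]mulrDl mul1r lerD//.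
    by rewrite ler_peMr ?(ltW h0)// exprn_ege1// lerDl ltW.
  by move=> /(_ N); rewrite mulrC.
- exact: cvg_cst.
- rewrite -[X in _ --> X](mulr0 h^-1); apply: cvgM; first exact: cvg_cst.
  by apply: cvg_expr; rewrite gtr0_norm.
Qed.

(* With M = N / b^N, the product M y^N tends to 0 if y < b and is at least N if y >= b. *)
Definition threshold_power (R : realType) (b y : R) (N : nat) : R :=
  (1 - y ^+ N) ^+ (Num.truncn (N%:R / b ^+ N)).+1.

(** Below [b], Bernoulli's inequality bounds the power from below; otherwise [1 - t <= exp(-t)]
    bounds it by [exp(-N)]. *)
Lemma cvg_threshold_power (R : realType) (b y : R) : 0 < b -> b <= 1 -> 0 <= y -> y <= 1 ->
  threshold_power b y N @[N --> \oo] --> (if y < b then 1 else 0 : R).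
Proof.
move=> b0 b1 y0 y1; rewrite /threshold_power.
have yN0 N : 0 <= y ^+ N by exact: exprn_ge0.
have yN1 N : y ^+ N <= 1 by exact: exprn_ile1.
have bN0 N : 0 < b ^+ N by exact: exprn_gt0.
pose M N := (Num.truncn (N%:R / b ^+ N)).+1.
have MN N : N%:R / b ^+ N <= (M N)%:R by apply: ltW; exact: truncnS_gt.
case: ltP => yb.
  have yb1 : y / b < 1 by rewrite ltr_pdivrMr// mul1r.
  have yb0 : 0 <= y / b by rewrite divr_ge0// ltW.
  apply: (@squeeze_cvgr _ _ _ _ (fun N => 1 - (N%:R * (y / b) ^+ N + y ^+ N)) (fun=> 1)).
  - apply: nearW => N; apply/andP; split; last by rewrite exprn_ile1// ?subr_ge0// lerBlDr lerDl.
    apply: le_trans (bernoulli_le _ (yN0 N) (yN1 N)).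
    rewrite lerD2l lerN2.
    have : (M N)%:R <= N%:R / b ^+ N + 1.
      rewrite /M -natr1 lerD2r truncn_le//.
      by rewrite divr_ge0// ltW.
    move=> /(ler_wpM2r (yN0 N)) /le_trans; apply.
    by rewrite mulrDl mul1r expr_div_n mulrAC mulrA.
  - rewrite -[X in _ --> X]subr0; apply: cvgB; first exact: cvg_cst.
    rewrite -[X in _ --> X]addr0; apply: cvgD; first exact: cvg_natmul_expr.
    by apply: cvg_expr; rewrite ger0_norm//; exact: lt_le_trans yb b1.
  - exact: cvg_cst.
apply: (@squeeze_cvgr _ _ _ _ (fun=> 0) (fun N => expR (- 1) ^+ N)).
- apply: nearW => N; rewrite exprn_ge0 ?subr_ge0//=.
  apply: (@le_trans _ _ (expR (- y ^+ N) ^+ M N)).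
    by apply: lerXn2r; rewrite ?nnegrE ?subr_ge0 ?expR_ge0//; exact: expR_ge1Dx.
  rewrite -!expRM_natl ler_expR !mulrN lerN2 mulr1.
  apply: (@le_trans _ _ ((M N)%:R * b ^+ N)); first by rewrite -ler_pdivrMr.
  by rewrite ler_wpM2l// lerXn2r// ?nnegrE// ltW.
- exact: cvg_cst.
- by apply: cvg_expr; rewrite ger0_norm ?expR_ge0// -expR0 ltr_expR ltrN10.
Qed.

Section exp_sum_density.
Context (R : realType) (n : nat) (ip : inner_product R n).
Local Notation V := 'rV[R]_n.
Variables (K : set V) (mK : measurable (K : set (borel V))).
Variables (m : {measure set (borel V) -> \bar R}) (m_fin : (m K < +oo)%E).
Variables (u0 : V) (c : R) (c_gt0 : 0 < c).
Hypotheses (du0 : dual_cone ip K u0) (hc : forall x, K x -> c * `|x| <= ip u0 x).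
Local Notation dualK := (dual_cone ip K).
Implicit Types (s : seq (R * V)) (f g : borel V -> R).

Lemma measurable_exp_sum s : measurable_fun setT (exp_sum ip s : borel V -> R).
Proof.
apply: measurable_sum => p; apply: measurable_funM => //; exact: measurable_expip.
Qed.

Definition dual_exponents s := forall p, p \in s -> dualK p.2.

(** The approximating sums must themselves stay in [0, 1] on [K]: the comparison of the processes
    holds only for such sums, and products preserve this. *)
Definition approximable f := [/\ measurable_fun setT f, forall y, K y -> 0 <= f y <= 1 &
  forall eps : R, 0 < eps -> exists s, [/\ dual_exponents s,
    forall y, K y -> 0 <= exp_sum ip s y <= 1 &
    (\int[m]_(y in K) `|f y - exp_sum ip s y|%:E <= eps%:E)%E]].

Let mL1 f g : measurable_fun setT f -> measurable_fun setT g ->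
  measurable_fun (K : set (borel V)) (fun y => `|f y - g y|%:E).
Proof.
move=> mf mg; apply: measurable_funTS; apply/measurable_EFinP.
by apply: measurableT_comp; [exact: normr_measurable|exact: measurable_funB].
Qed.

Lemma approximable_exp v : dualK v -> approximable (fun y => expR (- ip v y)).
Proof.
move=> dv; split; first exact: measurable_expip.
  by move=> y Ky; exact: expip01 dv Ky.
move=> eps eps0; exists [:: (1, v)].
have E y : exp_sum ip [:: (1, v)] y = expR (- ip v y) by rewrite /exp_sum big_seq1 mul1r.
split; first by move=> p; rewrite inE => /eqP ->.
  by move=> y Ky; rewrite E; exact: expip01 dv Ky.
by under eq_integral do rewrite E subrr normr0; rewrite integral0 lee_fin ltW.
Qed.

Lemma approximable_compl f : approximable f -> approximable (fun y => 1 - f y).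
Proof.
move=> [mf f01 af]; split; first exact: measurable_funB.
  by move=> y /f01/andP[f0 f1]; rewrite subr_ge0 f1 lerBlDr lerDl.
move=> eps /af[s [ds s01 hs]].
exists ((1, 0) :: [seq (- p.1, p.2) | p <- s]).
have E y : exp_sum ip ((1, 0) :: [seq (- p.1, p.2) | p <- s]) y = 1 - exp_sum ip s y.
  rewrite /exp_sum big_cons big_map /= ip0l oppr0 expR0 mulr1; congr (_ + _).
  by rewrite -sumrN; apply: eq_bigr => p _; rewrite mulNr.
split.
- move=> p; rewrite inE => /predU1P[-> /=|/mapP[q qs ->]]; first exact: dual_cone0.
  exact: (ds q qs).
- by move=> y /s01/andP[s0 s1]; rewrite E subr_ge0 s1 lerBlDr lerDl.
- suff -> : (\int[m]_(y in K) `|1 - f y - exp_sum ip ((1, 0%R) :: [seq (- p.1, p.2) | p <- s]) y|%:E)%E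
    = (\int[m]_(y in K) `|f y - exp_sum ip s y|%:E)%E by [].
  apply: eq_integral => y _; rewrite E -normrN; congr (`|_|%:E); ring.
Qed.

Lemma approximable_mul f g : approximable f -> approximable g ->
  approximable (fun y => f y * g y).
Proof.
move=> [mf f01 af] [mg g01 ag]; split; first exact: measurable_funM.
  by move=> y Ky; have /andP[f0 f1] := f01 y Ky; have /andP[g0 g1] := g01 y Ky;
    rewrite mulr_ge0//= mulr_ile1.
move=> eps eps0; have e2 : 0 < eps / 2 by rewrite divr_gt0.
have [s [ds s01 hs]] := af _ e2; have [t [dt t01 ht]] := ag _ e2.
pose st := [seq (p.1 * q.1, p.2 + q.2) | p <- s, q <- t].
have E y : exp_sum ip st y = exp_sum ip s y * exp_sum ip t y.
  rewrite /exp_sum big_allpairs_dep /= mulr_suml; apply: eq_bigr => p _.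
  rewrite mulr_sumr; apply: eq_bigr => q _ /=.
  by rewrite ipDl opprD expRD; ring.
exists st; split.
- by move=> _ /allpairsP[[p q] /= [ps qt ->]] /=; apply: dual_coneD; [exact: ds|exact: dt].
- by move=> y Ky; rewrite E; have /andP[f0 f1] := s01 y Ky; have /andP[g0 g1] := t01 y Ky;
    rewrite mulr_ge0//= mulr_ile1.
apply: (@le_trans _ _ (\int[m]_(y in K) (`|f y - exp_sum ip s y|%:E + `|g y - exp_sum ip t y|%:E))%E).
  apply: ge0_le_integral => //.
  - by apply: mL1; [exact: measurable_funM|exact: measurable_exp_sum].
  - by apply: emeasurable_funD; apply: mL1 => //; exact: measurable_exp_sum.
  move=> y Ky; rewrite -EFinD lee_fin E.
  have /andP[g0 g1] := g01 y Ky; have /andP[s0 s1] := s01 y Ky.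
  have -> : f y * g y - exp_sum ip s y * exp_sum ip t y =
    (f y - exp_sum ip s y) * g y + exp_sum ip s y * (g y - exp_sum ip t y) by ring.
  apply: (le_trans (ler_normD _ _)); apply: lerD; rewrite normrM.
    by rewrite ler_piMr// ger0_norm.
  by rewrite ler_piMl// ger0_norm.
rewrite ge0_integralD//; try by apply: mL1 => //; exact: measurable_exp_sum.
by rewrite [eps]splitr EFinD leeD.
Qed.

Lemma approximable_cvg (F : nat -> borel V -> R) f : (forall j, approximable (F j)) ->
  measurable_fun setT f -> (forall y, K y -> F j y @[j --> \oo] --> f y) -> approximable f.
Proof.
move=> aF mf Ff; have F01 j y : K y -> 0 <= F j y <= 1 by have [_ + _] := aF j; apply.
have mF j : measurable_fun setT (F j) by have [] := aF j.
have f01 y : K y -> 0 <= f y <= 1.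
  move=> Ky; apply/andP; split.
    apply: (@cvgr_to_ge _ _ _ _ _ _ _ (Ff y Ky)); apply: nearW => j.
    by have /andP[] := F01 j y Ky.
  apply: (@cvgr_to_le _ _ _ _ _ _ _ (Ff y Ky)); apply: nearW => j.
  by have /andP[] := F01 j y Ky.
split=> // eps eps0; have e2 : 0 < eps / 2 by rewrite divr_gt0.
have [_ H _] : [/\ m.-integrable K (EFin \o f),
    (\int[m]_(y in K) `|(F j y)%:E - (EFin \o f) y| @[j --> \oo] --> 0)%E &
    (\int[m]_(y in K) (F j y)%:E @[j --> \oo] --> \int[m]_(y in K) (EFin \o f) y)%E].
  apply: (@dominated_convergence _ _ _ m K mK (fun j y => (F j y)%:E) (EFin \o f) (fun=> 1%E)).
  - by move=> j; apply: measurable_funTS; apply/measurable_EFinP.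
  - by apply: measurable_funTS; apply/measurable_EFinP.
  - by apply: aeW => y Ky; apply: cvg_EFin; [exact: nearW|exact: Ff].
  - by apply: (@bounded_integrable _ _ _ mK m m_fin (cst 1) 1) => // y _ /=; rewrite normr1.
  - by apply: aeW => y j Ky; have /andP[? ?] := F01 j y Ky; rewrite /= lee_fin ger0_norm.
have [j hj] : exists j, (\int[m]_(y in K) `|(F j y)%:E - (f y)%:E| < (eps / 2)%:E)%E.
  have : \forall j \near \oo, (\int[m]_(y in K) `|(F j y)%:E - (EFin \o f) y| < (eps / 2)%:E)%E.
    by have := H [set y | (y < (eps / 2)%:E)%E]; apply; apply: open_ereal_lt'; rewrite lte_fin.
  by case=> j _ /(_ j (leqnn _)); exists j.
have [_ _ /(_ _ e2)[s [ds s01 hs]]] := aF j.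
exists s; split=> //.
apply: (@le_trans _ _ (\int[m]_(y in K) (`|F j y - f y|%:E + `|F j y - exp_sum ip s y|%:E))%E).
  apply: ge0_le_integral => //.
  - by apply: mL1 => //; exact: measurable_exp_sum.
  - by apply: emeasurable_funD; apply: mL1 => //; exact: measurable_exp_sum.
  by move=> y Ky; rewrite -EFinD lee_fin (distrC (F j y)); exact: ler_distD.
rewrite ge0_integralD//; try by apply: mL1 => //; exact: measurable_exp_sum.
by rewrite [eps]splitr EFinD leeD// ltW.
Qed.

Lemma eq_approximable f g : measurable_fun setT g -> (forall y, K y -> f y = g y) ->
  approximable f -> approximable g.
Proof.
move=> mg fg af; apply: (@approximable_cvg (fun=> f)) => // y Ky.
by rewrite -fg//; exact: cvg_cst.
Qed.

Lemma approximable_one : approximable (fun=> 1).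
Proof.
apply: (eq_approximable _ _ (approximable_exp (@dual_cone0 _ _ ip K))) => // y _.
by rewrite ip0l oppr0 expR0.
Qed.

Lemma approximable_expn f k : approximable f -> approximable (fun y => f y ^+ k).
Proof.
move=> af; elim: k => [|k IH]; first exact: approximable_one.
by apply: (eq_approximable _ _ (approximable_mul af IH)) => [|y _];
  [by apply: measurable_funX; have [] := af|rewrite exprS].
Qed.

Definition approximable_sets : set (set (borel V)) :=
  [set A | measurable A /\ approximable (\1_A : borel V -> R)].

Lemma approximable_setsC A : approximable_sets A -> approximable_sets (~` A).
Proof.
move=> [mA aA]; split; first exact: measurableC.
apply: (eq_approximable _ _ (approximable_compl aA)) => [|y _].
  by apply: measurable_indic; exact: measurableC.
by rewrite !indicE in_setC; case: (y \in A); rewrite /= ?subrr ?subr0.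
Qed.

(** Complements correspond to [1 - f], finite intersections to products, and countable ones to
    limits of products. *)
Lemma approximable_sets_algebra : sigma_algebra setT approximable_sets.
Proof.
have C := approximable_setsC.
have T0 : approximable_sets setT.
  split=> //; rewrite indicT; exact: approximable_one.
split; first by rewrite -setCT; exact: C.
  by move=> A aA; rewrite setTD; exact: C.
move=> A aA.
rewrite -[\bigcup_k _]setCK setC_bigcup; apply: C.
suff H (B : nat -> set (borel V)) : (forall i, approximable_sets (B i)) ->
    approximable_sets (\bigcap_k B k).
  by apply: H => i; exact: approximable_setsC (aA i).
move=> aB.
have mB : measurable (\bigcap_k B k) by apply: bigcapT_measurable => i; have [] := aB i.
split=> //.
pose F (j : nat) (y : borel V) : R := \prod_(i < j) \1_(B i) y.
apply: (@approximable_cvg F).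
- elim=> [|j IH].
    apply: (eq_approximable _ _ approximable_one) => [|y _]; last by rewrite /F big_ord0.
    rewrite (_ : F 0%N = cst 1)//; apply/funext => y; by rewrite /F big_ord0.
  have [mBj aBj] := aB j.
  rewrite (_ : F j.+1 = fun y => F j y * \1_(B j) y); last first.
    by apply/funext => y; rewrite /F big_ord_recr.
  exact: approximable_mul.
- exact: measurable_indic.
move=> y Ky; apply: cvg_near_cst; have [By|nBy] := pselect ((\bigcap_k B k) y).
  apply: nearW => j; rewrite /F big1 ?indicE ?mem_set// => i _.
  by rewrite indicE mem_set//; exact: By.
have [k nBk] : exists k, ~ B k y.
  by apply: contrapT => h; apply: nBy => k _; apply: contrapT => nk; apply: h; exists k.
exists k.+1 => //= j kj; rewrite /F (bigD1 (Ordinal kj))//= !indicE.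
by rewrite memNset// mul0r memNset.
Qed.

(** [threshold_power] is built from [e_v] by powers and complements, and it tends to the indicator
    of [e_v < b]. Levels outside ]0, 1] are trivial on [K]. *)
Lemma approximable_superlevel v (b : R) : dualK v ->
  approximable_sets [set y | expR (- ip v y) < b].
Proof.
move=> dv; have [A0 AC _] := approximable_sets_algebra.
have mS : measurable ([set y | expR (- ip v y) < b] : set (borel V)).
  rewrite -[X in measurable X]setTI; apply: measurable_fun_ltr => //; exact: measurable_expip.
split=> //.
have [b0|b0] := leP b 0.
  rewrite (_ : [set y | _] = set0); first by have [] := A0.
  by apply/seteqP; split=> // y /=; rewrite ltNge (le_trans b0)// expR_ge0.
have [b1|b1] := leP b 1; last first.
  apply: (eq_approximable _ _ approximable_one) => [|y Ky]; first exact: measurable_indic.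
  have /andP[_ y1] := expip01 dv Ky.
  by rewrite indicE mem_set//=; exact: le_lt_trans b1.
apply: (@approximable_cvg (fun j y => threshold_power b (expR (- ip v y)) j)).
- move=> j; apply: approximable_expn; apply: approximable_compl; apply: approximable_expn.
  exact: approximable_exp.
- exact: measurable_indic.
move=> y Ky; have /andP[y0 y1] := expip01 dv Ky.
have := cvg_threshold_power b0 b1 y0 y1.
rewrite indicE; case: ltP => yb; first by rewrite mem_set.
by rewrite memNset//= ltNge yb.
Qed.

(** Pairings with dual vectors are measurable for the sigma-algebra of approximable sets. Every
    coordinate is a difference of two of them, because [w + M u0] is in the dual cone for large
    [M]. *)
Lemma approximable_borel (A : set (borel V)) : measurable A -> approximable_sets A.
Proof.
have sA := approximable_sets_algebra.
pose T := g_sigma_algebraType approximable_sets.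
have mE : @measurable _ T = approximable_sets by exact: measurable_g_measurableTypeE.
have mip v : dualK v -> measurable_fun setT (ip v : T -> R).
  move=> dv; have m1 : measurable_fun setT (fun y : T => expR (- ip v y)).
    apply: (@measurability _ _ T _ setT _ _ (RGenInftyO.measurableE R)) => _ [_ [b ->] <-].
    by rewrite setTI mE; exact: (approximable_superlevel b dv).
  rewrite (_ : (ip v : T -> R) = (fun y => - ln (expR (- ip v y)))).
    apply: measurable_funN; apply: measurableT_comp m1; exact: measurable_ln.
  by apply/funext => y; rewrite expRK opprK.
have [C C0 hC] := ip_bound ip.
suff mid : measurable_fun setT (fun y : T => (y : borel V)).
  by move=> mA; have := mid measurableT A mA; rewrite setTI mE.
apply: measurable_fun_rV => i.
have [w hw] : exists w, forall x : V, x ord0 i = ip x w.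
  by apply: riesz => a x y; rewrite !mxE.
pose M := C * `|w| / c.
have M0 : 0 <= M by rewrite divr_ge0 ?mulr_ge0// ltW.
have dM : dualK (M *: u0) by exact: dual_coneZ.
have dw : dualK (w + M *: u0).
  move=> x Kx; rewrite ipDl ipZl.
  have := hC w x; rewrite ler_norml => /andP[h _].
  have : C * `|w| * `|x| <= M * ip u0 x.
    have -> : C * `|w| * `|x| = M * (c * `|x|) by rewrite /M mulrA divfK// gt_eqF.
    by rewrite ler_wpM2l// hc.
  by move: h; lra.
rewrite (_ : (fun t => _) = (fun t => ip (w + M *: u0) t - ip (M *: u0) t)).
  by apply: measurable_funB; exact: mip.
by apply/funext => t; rewrite -ipBl addrK hw ipC.
Qed.

End exp_sum_density.

Lemma exp_sum_shift (R : realType) n (ip : inner_product R n) (u : 'rV[R]_n) s y :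
  exp_sum ip [seq (p.1, p.2 + u) | p <- s] y = expR (- ip u y) * exp_sum ip s y.
Proof.
rewrite /exp_sum big_map mulr_sumr; apply: eq_bigr => p _ /=.
by rewrite ipDl opprD expRD; ring.
Qed.

Section borel_lower_bound.
Context (R : realType) (n : nat) (ip : inner_product R n).
Local Notation V := 'rV[R]_n.
Variables (K : set V) (mK : measurable (K : set (borel V))).
Variables (u0 : V) (c : R) (c_gt0 : 0 < c).
Hypotheses (du0 : dual_cone ip K u0) (hc : forall x, K x -> c * `|x| <= ip u0 x).

Let weighted_indic_integrable (m : {measure set (borel V) -> \bar R}) (A : set (borel V)) :
  (m K < +oo)%E -> measurable A ->
  m.-integrable K (EFin \o (fun y : borel V => expR (- ip u0 y) * \1_A y)).
Proof.
move=> mfin mA; apply: (bounded_integrable mK mfin (M := 1)).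
  by apply: measurable_funM; [exact: measurable_expip|exact: measurable_indic].
move=> y Ky; have /andP[e0 e1] := expip01 du0 Ky.
by rewrite normrM !ger0_norm// mulr_ile1// indicE; case: (y \in A).
Qed.

Let weighted_indic_dist (m : {measure set (borel V) -> \bar R}) (A : set (borel V))
    (s : seq (R * V)) (eps : R) :
  (m K < +oo)%E -> measurable A -> dual_exponents ip K s ->
  (\int[m]_(y in K) `|\1_A y - exp_sum ip s y|%:E <= eps%:E)%E ->
  `|\int[m]_(y in K) (expR (- ip u0 y) * \1_A y)
    - \int[m]_(y in K) exp_sum ip [seq (p.1, p.2 + u0) | p <- s] y| <= eps.
Proof.
move=> mfin mA ds hs.
have ds' p : p \in [seq (p.1, p.2 + u0) | p <- s] -> dual_cone ip K p.2.
  by move=> /mapP[q qs ->]; apply: dual_coneD => //; exact: ds.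
have i1 := weighted_indic_integrable mfin mA.
have [i2 _] := expip_sum_integral mK mfin ds'.
have mD : measurable_fun setT (fun y : borel V => expR (- ip u0 y) * \1_A y
    - exp_sum ip [seq (p.1, p.2 + u0) | p <- s] y).
  apply: measurable_funB; last exact: measurable_exp_sum.
  by apply: measurable_funM; [exact: measurable_expip|exact: measurable_indic].
rewrite -RintegralB//; apply: le_trans; first by apply: le_normr_Rintegral => //; exact: (integrableB mK i1 i2).
rewrite -lee_fin; apply: le_trans hs.
rewrite /Rintegral fineK; last first.
  apply: integrable_fin_num => //.
  exact: (integrable_norm (integrableB mK i1 i2)).
apply: ge0_le_integral => //.
- by apply: measurable_funTS; apply/measurable_EFinP; apply: measurableT_comp => //; exact: normr_measurable.
- apply: measurable_funTS; apply/measurable_EFinP; apply: measurableT_comp; first exact: normr_measurable.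
  by apply: measurable_funB; [exact: measurable_indic|exact: measurable_exp_sum].
move=> y Ky; have /andP[e0 e1] := expip01 du0 Ky.
by rewrite lee_fin exp_sum_shift -mulrBr normrM (ger0_norm e0) ler_piMl.
Qed.

(** The indicator is approximated in L^1 of [P + Q], hence for both measures by the same sum.
    Multiplication by [e_u0] shifts all exponents above [u0], where the hypothesis applies; this
    explains the weight in the conclusion. *)
Lemma borel_lower_bound (P Q : {measure set (borel V) -> \bar R}) (a k : R) :
  (P K < +oo)%E -> (Q K < +oo)%E ->
  (forall s, above_u0 ip K u0 s -> (forall y, K y -> 0 <= exp_sum ip s y <= 1) ->
    a * \int[Q]_(y in K) exp_sum ip s y - k <= \int[P]_(y in K) exp_sum ip s y) ->
  forall A : set (borel V), measurable A ->
    a * \int[Q]_(y in K) (expR (- ip u0 y) * \1_A y) - k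
      <= \int[P]_(y in K) (expR (- ip u0 y) * \1_A y).
Proof.
move=> Pfin Qfin H A mA; apply/ler_addgt0Pr => eps eps0.
have a0 : 0 < `|a| + 1 by rewrite ltr_wpDl.
(* The errors are [|a| * e1] from [Q] and [e1] from [P], with sum [eps]. *)
pose e1 := eps / (`|a| + 1); have e10 : 0 < e1 by rewrite divr_gt0.
pose m : {measure set (borel V) -> \bar R} := measure_add P Q.
have mfin : (m K < +oo)%E.
  have -> : m K = (P K + Q K)%E by exact: measure_addE.
  exact: lte_add_pinfty.
have [_ [_ _ /(_ _ e10)[s [ds s01 hs]]]] := approximable_borel mK mfin c_gt0 du0 hc mA.
have mg : measurable_fun (K : set (borel V)) (fun y : borel V => `|\1_A y - exp_sum ip s y|%:E).
  apply: measurable_funTS; apply/measurable_EFinP; apply: measurableT_comp; first exact: normr_measurable.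
  by apply: measurable_funB; [exact: measurable_indic|exact: measurable_exp_sum].
have hsum : (\int[P]_(y in K) `|\1_A y - exp_sum ip s y|%:E +
    \int[Q]_(y in K) `|\1_A y - exp_sum ip s y|%:E <= e1%:E)%E.
  by rewrite -ge0_integral_measure_add.
have hP : (\int[P]_(y in K) `|\1_A y - exp_sum ip s y|%:E <= e1%:E)%E.
  by apply: le_trans hsum; rewrite leeDl// integral_ge0.
have hQ : (\int[Q]_(y in K) `|\1_A y - exp_sum ip s y|%:E <= e1%:E)%E.
  by apply: le_trans hsum; rewrite leeDr// integral_ge0.
have {hP} := weighted_indic_dist Pfin mA ds hP.
have {hQ} := weighted_indic_dist Qfin mA ds hQ.
have : above_u0 ip K u0 [seq (p.1, p.2 + u0) | p <- s].
  move=> p /mapP[q qs ->] /=; rewrite addrK; split; last exact: ds.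
  by apply: dual_coneD => //; exact: ds.
move=> /H H'; have {}H' := H' _.
set GP := \int[P]_(y in K) exp_sum _ _ _ in H' *.
set GQ := \int[Q]_(y in K) exp_sum _ _ _ in H' *.
set FP := \int[P]_(y in K) _ in H' *; set FQ := \int[Q]_(y in K) _ in H' *.
move=> hQ hP.
have {}H' : a * GQ - k <= GP.
  apply: H' => y Ky; rewrite exp_sum_shift.
  have /andP[x0 x1] := expip01 du0 Ky; have /andP[y0 y1] := s01 y Ky.
  by rewrite mulr_ge0//= mulr_ile1.
have h1 : a * (FQ - GQ) <= `|a| * e1.
  by apply: (le_trans (ler_norm _)); rewrite normrM ler_wpM2l.
have h2 : GP - FP <= e1 by apply: le_trans (ler_norm _) _; rewrite distrC.
have h3 : eps = `|a| * e1 + e1 by rewrite -[X in _ + X]mul1r -mulrDl /e1 mulrC divfK// gt_eqF.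
by rewrite h3; move: h1 h2 H'; rewrite mulrBr; lra.
Qed.

End borel_lower_bound.

(** * Conclusion *)

Section weighted_kernel.
Context d d' (T : measurableType d) (T' : measurableType d') (R : realType).
Variables (l : R.-spker T ~> T') (f : T' -> R).
Hypotheses (mf : measurable_fun setT f) (f01 : forall y, 0 <= f y <= 1).
Local Open Scope ereal_scope.

(** The proofs are arguments of the term so that the measure and kernel structures can be attached
    to it. *)
Definition weighted_measure of measurable_fun setT f & (forall y, (0 <= f y <= 1)%R) :=
  fun (x : T) (A : set T') => \int[l x]_(y in A) (f y)%:E.

Local Notation wm := (weighted_measure mf f01).

Let f_ge0 y : 0 <= (f y)%:E. Proof. by have /andP[+ _] := f01 y; rewrite lee_fin. Qed.

Let wm0 x : wm x set0 = 0. Proof. exact: integral_set0. Qed.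

Let wm_ge0 x A : 0 <= wm x A. Proof. exact: integral_ge0. Qed.

Let wm_additive x : semi_sigma_additive (wm x).
Proof.
move=> F mF tF mUF; rewrite /weighted_measure ge0_integral_bigcup//; last first.
  by apply: measurable_funTS; apply/measurable_EFinP.
by apply: is_cvg_ereal_nneg_natsum_cond => k _ _; exact: integral_ge0.
Qed.

HB.instance Definition _ x := isMeasure.Build _ _ _ (wm x) (wm0 x) (wm_ge0 x) (@wm_additive x).

Lemma weighted_measure_le x A : measurable A -> wm x A <= l x A.
Proof.
move=> mA; rewrite -[leRHS]mul1e -integral_cst//; apply: ge0_le_integral => //.
  by apply: measurable_funTS; apply/measurable_EFinP.
by move=> y _; have /andP[_] := f01 y; rewrite lee_fin.
Qed.

Definition weighted_kernel : T -> {measure set T' -> \bar R} := wm.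

Local Notation wk := weighted_kernel.

Let measurable_wk U : measurable U -> measurable_fun setT (wk ^~ U).
Proof.
move=> mU.
rewrite (_ : wk ^~ U = fun x => \int[l x]_y ((fun y => (f y)%:E) \_ U) y); last first.
  by apply/funext => x; rewrite -integral_mkcond.
apply: measurable_fun_integral_kernel.
- by move=> W mW; exact: measurable_kernel.
- by move=> y; rewrite patchE; case: ifP.
- apply/(measurable_restrictT _ mU); by apply: measurable_funTS; apply/measurable_EFinP.
Qed.

HB.instance Definition _ := isKernel.Build _ _ _ _ R wk measurable_wk.

Let wk_sub : ereal_sup [set wk x setT | x in setT] <= 1.
Proof.
apply: ge_ereal_sup => _ [x _ <-]; apply: le_trans (sprob_kernel_le1 l x).
exact: weighted_measure_le.
Qed.

HB.instance Definition _ := Kernel_isSubProbability.Build _ _ _ _ R wk wk_sub.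

Lemma weighted_kernel_eq0 x A : (forall y, (0 < f y)%R) -> measurable A ->
  wk x A = 0 <-> l x A = 0.
Proof.
move=> f0 mA; split => [|lA0]; last by apply/eqP; rewrite eq_le wm_ge0 andbT -lA0 weighted_measure_le.
move=> /(integral_eq0_null mA _ (fun y _ => f_ge0 y)) <-; last first.
  by apply: measurable_funTS; apply/measurable_EFinP.
by congr (l x _); apply/seteqP; split=> [y Ay|y []//]; split => //=; rewrite lte_fin.
Qed.

End weighted_kernel.

Theorem proposition4p3 (R : realType) (n : nat) (ip : inner_product R n)
    (K : set 'rV[R]_n) (hK : proper_cone K)
    (par par' : affine_params ip K) (X X' : markov_process K)
    (hX : affine_process par X)
    (hc : par_c par = 0) (hgamma : par_gamma par = 0)
    (hm : (par_m par K < +oo)%E)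
    (hmu : dual_cone ip K (par_mu par K))
    (hmu1 : exists2 w, dual_cone ip K w &
      is_cone_integral (par_mu par)
        (K `&` [set xi | 1 <= ip_norm ip xi]) (ip_norm ip) w)
    (hX' : affine_process par' X')
    (hQ' : forall u v, par_Q par' u v = par_Q par u v)
    (hB' : forall x, par_B par' x = par_B par x)
    (hb' : par_b par' = par_b par)
    (hc' : par_c par' = 0) (hgamma' : par_gamma par' = 0)
    (hm' : forall A : set (borel 'rV[R]_n), measurable A -> A `<=` K -> par_m par' A = 0%E)
    (hmu' : forall A : set (borel 'rV[R]_n), measurable A -> A `<=` K -> par_mu par' A = 0)
    (hdens : positive_lebesgue_density X') :
  (aperiodic X /\ irreducible_wrt X (lebesgue_rV R n)) /\
  (aperiodic X' /\ irreducible_wrt X' (lebesgue_rV R n)).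
Proof.
have cK := cone_closed hK; have mK := closed_measurable_rV cK.
have mSK := measurable_image_some mK.
have [adm [cvX [phi [psi [phi_ge0 lapX init dphi dpsi]]]]] := hX.
have [adm' [cvX' [phi' [psi' [phi_ge0' lapX' init' dphi' dpsi']]]]] := hX'.
have fl : riccati_flow par phi psi.
  by split=> //; [exact: (psi_dual hK mSK lapX)|exact: (psi_mono hK mSK lapX)].
have fl' : riccati_flow par' phi' psi'.
  by split=> //; [exact: (psi_dual hK mSK lapX')|exact: (psi_mono hK mSK lapX')].
have m0' := hm' K mK (@subset_refl _ K); have mu0' := hmu' K mK (@subset_refl _ K).
have [e Ke he] := cone_order_unit hK.
have [u0 [c [du0 c_gt0 hcu]]] := dual_cone_coercive ip hK.
have [t0 t0_gt0 decay] := decay_time hK adm hc hgamma hm fl Ke he du0 c_gt0 hcu.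
have [C1 [C2 [C10 C20 lb]]] := lower_bound_t0 hK adm hc hgamma hm adm' hc' hgamma' hQ' hB' hb'
  m0' mu0' fl fl' Ke he du0 c_gt0 hcu t0_gt0 decay (law_exp mSK lapX) (law_exp mSK lapX').
have lawX_gt0 := law_gt0 mSK lapX; have lawX'_gt0 := law_gt0 mSK lapX'.
pose k (y : borel 'rV[R]_n) : R := t0 * C1 * expR (C2 * t0) * (1 + ip u0 y).
have mk : measurable_fun setT k.
  by apply: measurable_funM => //; apply: measurable_funD => //; exact: measurable_ip.
have k_ge0 y : K y -> 0 <= k y.
  move=> Ky; apply: mulr_ge0; last by apply: addr_ge0 => //; exact: du0.
  by apply: mulr_ge0 (expR_ge0 _); apply: mulr_ge0 => //; exact: ltW.
(* A subprobability kernel needs a weight at most 1 everywhere, and off [K] the exponential may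
   exceed 1. On [K] the minimum changes nothing. *)
pose f (y : borel 'rV[R]_n) : R := Num.min 1 (expR (- ip u0 y)).
have mf : measurable_fun setT f by apply: measurable_minr => //; exact: measurable_expip.
have f_gt0 y : 0 < f y by rewrite lt_min ltr01 expR_gt0.
have f01 y : 0 <= f y <= 1 by rewrite (ltW (f_gt0 y))/= ge_min lexx.
have fK y : K y -> f y = expR (- ip u0 y).
  by move=> Ky; apply: min_r; have /andP[] := expip01 du0 Ky.
pose q : R.-spker (borel 'rV[R]_n) ~> (borel 'rV[R]_n) := weighted_kernel (law mSK X' t0) mf f01.
have t0_ge0 := ltW t0_gt0.
have q_le x A : measurable A -> (q x A <= law mSK X' t0 x A)%E by exact: weighted_measure_le.
have q_law x A : measurable A -> q x A = 0%E <-> law mSK X' t0 x A = 0%E.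
  exact: weighted_kernel_eq0.
have qE x A : measurable A ->
    fine (q x A) = \int[law mSK X' t0 x]_(y in K) (expR (- ip u0 y) * \1_A y).
  move=> mA; rewrite /Rintegral; congr fine.
  transitivity (\int[law mSK X' t0 x]_y ((fun y => (f y)%:E) \_ A) y)%E; first by rewrite -integral_mkcond.
  rewrite (law_restrict hK).
  - apply: eq_integral => y /[!inE] Ky; rewrite patchE indicE -fK//.
    by case: (y \in A); rewrite ?mulr1 ?mulr0.
  - by apply/(measurable_restrictT _ mA); apply: measurable_funTS; apply/measurable_EFinP.
  - by move=> y; rewrite patchE; case: ifP => // _; rewrite lee_fin ltW.
have q_lb x A r : K x -> measurable A ->
    ((expR (- r) * ((1 + r) * fine (q x A) - k x))%:E <= law mSK X t0 x A)%E.
  move=> Kx mA; have lX := law_lty hK mSK X t0 x; have lX' := law_lty hK mSK X' t0 x.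
  have H s : above_u0 ip K u0 s -> (forall y, K y -> 0 <= exp_sum ip s y <= 1) ->
      expR (- r) * (1 + r) * \int[law mSK X' t0 x]_(y in K) exp_sum ip s y - expR (- r) * k x
      <= \int[law mSK X t0 x]_(y in K) exp_sum ip s y.
    move=> hs s01; have ds p : p \in s -> dual_cone ip K p.2 by move=> /hs[].
    rewrite (law_exp_sum hK (law_exp mSK lapX))// (law_exp_sum hK (law_exp mSK lapX'))//.
    by rewrite -mulrA -mulrBr; exact: lb.
  have := borel_lower_bound mK c_gt0 du0 hcu lX lX' H mA.
  rewrite -qE// -mulrA -mulrBr -lee_fin => /le_trans; apply.
  rewrite /Rintegral fineK; last first.
    apply: integrable_fin_num => //; apply: (bounded_integrable mK lX (M := 1)).
      by apply: measurable_funM; [exact: measurable_expip|exact: measurable_indic].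
    move=> y Ky; have /andP[e0 e1] := expip01 du0 Ky.
    by rewrite normrM !ger0_norm// mulr_ile1// indicE; case: (y \in A).
  apply: (@le_trans _ _ (\int[law mSK X t0 x]_(y in K) (\1_A y)%:E)%E).
    apply: ge0_le_integral => //.
    - apply: measurable_funTS; apply/measurable_EFinP.
      by apply: measurable_funM; [exact: measurable_expip|exact: measurable_indic].
    - by apply: measurable_funTS; apply/measurable_EFinP; exact: measurable_indic.
    - by move=> y Ky; have /andP[_ e1] := expip01 du0 Ky; rewrite lee_fin ler_piMl.
  rewrite integral_indic//; apply: le_measure; rewrite ?inE//; exact: measurableI.
(* For the diffusion itself the bound is immediate: [q] lies below its law, [k >= 0] on [K], and
   [exp(-r) * (1 + r) <= 1]. *)
have q_lb' x A r : K x -> measurable A ->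
    ((expR (- r) * ((1 + r) * fine (q x A) - k x))%:E <= law mSK X' t0 x A)%E.
  move=> Kx mA; apply: le_trans (q_le x A mA).
  have qfin : (q x A \is a fin_num).
    rewrite ge0_fin_numE//; apply: le_lt_trans (ltry 1); apply: le_trans (sprob_kernel_le1 q x).
    by apply: le_measure; rewrite ?inE.
  rewrite -[leRHS]fineK// lee_fin; set a := fine _; have a0 : 0 <= a by exact: fine_ge0.
  have kx := k_ge0 x Kx.
  apply: (@le_trans _ _ (expR (- r) * ((1 + r) * a))).
    by rewrite ler_wpM2l ?expR_ge0// gerBl.
  rewrite mulrA ler_piMl// expRN mulrC ler_pdivrMr ?expR_gt0// mul1r; exact: expR_ge1Dx.
(* The density is known to be positive only on the interior of [K]; the rest of [K] is
   Lebesgue-null. *)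
have q_eq0 x A : K x -> measurable A -> q x A = 0%E <-> lebesgue_rV R n (A `&` K) = 0%E.
  move=> Kx mA; have mAK : measurable (A `&` K : set (borel 'rV[R]_n)) by exact: measurableI.
  apply: (iff_trans (q_law x A mA)).
  have [g [mg g_ge0 g_gt0 gE]] := hdens t0 x t0_gt0 Kx.
  rewrite lawE gE//.
  have mgA : measurable_fun (A `&` K : set (borel 'rV[R]_n)) (fun y => (g y)%:E).
    by apply: measurable_funTS; apply/measurable_EFinP.
  split => [I0|L0]; last first.
    exact: null_set_integral.
  have N0 := integral_eq0_null mAK mgA (fun y _ => g_ge0 y) I0.
  have mI : measurable (K° : set (borel 'rV[R]_n)).
    by apply: sub_sigma_algebra; exact: open_interior.
  apply/eqP; rewrite -measure_le0.
  have -> : (0 = lebesgue_rV R n ((A `&` K) `&` [set y | 0 < (g y)%:E]) + lebesgue_rV R n (K `\` K°))%E.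
    by rewrite N0 lebesgue_cone_boundary// adde0.
  apply: le_trans (measureU2 _ _ _); rewrite ?inE//.
  - apply: le_measure; rewrite ?inE//.
      apply: measurableU; last exact: measurableD.
      exact: emeasurable_fun_o_infty.
    move=> y [Ay Ky]; have [Iy|nIy] := pselect (K° y); last by right.
    by left; split => //=; rewrite lte_fin; exact: g_gt0.
  - exact: emeasurable_fun_o_infty.
  - exact: measurableD.
have K0 := cone0 hK.
(* Otherwise the law of the diffusion started at 0 would have mass 0 at time [t0]. *)
have leb_gt0 : (0 < lebesgue_rV R n K)%E.
  rewrite lt_neqAle measure_ge0 andbT eq_sym; apply/eqP => L0.
  have /(q_law 0 setT measurableT) : q 0 setT = 0%E.
    by apply/q_eq0 => //; rewrite setTI.
  by apply/eqP; rewrite gt_eqF//; exact: lawX'_gt0.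
split; split.
- exact: (aperiodic_process (cK := cK) cvX lawX_gt0 t0_gt0 K0 mk q_lb q_eq0 leb_gt0).
- exact: (irreducible_lebesgue (cK := cK) cvX lawX_gt0 t0_gt0 q_lb q_eq0 leb_gt0).
- exact: (aperiodic_process (cK := cK) cvX' lawX'_gt0 t0_gt0 K0 mk q_lb' q_eq0 leb_gt0).
- exact: (irreducible_lebesgue (cK := cK) cvX' lawX'_gt0 t0_gt0 q_lb' q_eq0 leb_gt0).
Qed.
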